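(* Let $\xi\in\mathfrak{h}^*/\mathbb{Z}R$ be of nonzero central charge and assume that $\lambda(h)\notin\frac12\mathbb{Z}$ for any $\lambda\in\xi$. Then: (i) The Verma module $\Delta(\lambda)$ is simple for every $\lambda\in\xi$. (ii) There is a decomposition $\mathcal{O}[\xi]\cong\bigoplus_{\lambda\in\xi}\mathcal{O}[\xi]_\lambda$, where $\mathcal{O}[\xi]_\lambda$ denotes the Serre subcategory of $\mathcal{O}[\xi]$ generated by $\Delta(\lambda)$. (iii) For every $\lambda\in\xi$ the category $\mathcal{O}[\xi]_\lambda$ is equivalent to the category of finite dimensional complex vector spaces; more precisely, the functor given on objects by $N\mapsto N_\lambda$ (and on morphisms by restriction) is such an equivalence.
   Context: The Schrödinger algebra $\mathfrak{s}$ is the complex Lie algebra with basis $e,h,f,p,q,z$, with $z$ central and the remaining brackets $[h,e]=2e$, $[e,f]=h$, $[h,f]=-2f$, $[e,q]=p$, $[e,p]=0$, $[h,p]=p$, $[f,p]=q$, $[f,q]=0$, $[h,q]=-q$, $[p,q]=z$. Put $U=U(\mathfrak{s})$, $\mathfrak{h}=\mathbb{C}h\oplus\mathbb{C}z$, $\mathfrak{n}_+=\mathbb{C}e\oplus\mathbb{C}p$, $\mathfrak{n}_-=\mathbb{C}f\oplus\mathbb{C}q$, $\mathfrak{b}=\mathfrak{h}\oplus\mathfrak{n}_+$. Let $\{h^\vee,z^\vee\}\subset\mathfrak{h}^*$ be the basis dual to $\{h,z\}$, and $R=\{\pm h^\vee,\pm 2h^\vee\}$, so $\mathbb{Z}R=\mathbb{Z}h^\vee$.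 For a $U$-module $M$ and $\lambda\in\mathfrak{h}^*$ let $M_\lambda=\{v\in M: Hv=\lambda(H)v\ \forall H\in\mathfrak{h}\}$; $M$ is a weight module if $M=\bigoplus_\lambda M_\lambda$; its support $\mathrm{supp}(M)$ is the set of $\lambda$ with $M_\lambda\ne0$. Category $\mathcal{O}$ is the full subcategory of the category of $U$-modules consisting of the finitely generated weight modules $M$ with $\dim U(\mathfrak{n}_+)v<\infty$ for all $v\in M$. The Verma module is $\Delta(\lambda)=U\otimes_{U(\mathfrak{b})}\mathbb{C}_\lambda$, where $\mathfrak{n}_+$ acts on the one-dimensional $\mathfrak b$-module $\mathbb{C}_\lambda$ by $0$ and $\mathfrak{h}$ acts via $\lambda$. For a coset $\xi\in\mathfrak{h}^*/\mathbb{Z}R$, $\mathcal{O}[\xi]$ is the full subcategory of $\mathcal{O}$ of modules with support contained in $\xi$. The value $\lambda(z)$, which does not depend on $\lambda\in\xi$, is called the central charge of $\xi$. *)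

(* Defs.v *)
From HB Require Import structures.
From mathcomp Require Import all_boot all_order all_algebra.
From mathcomp Require Import generic_quotient ring.
From mathcomp Require Import boolp classical_sets functions cardinality fsbigop.
From mathcomp Require Import reals.
From mathcomp.real_closed Require Import complex.

Set Implicit Arguments.
Unset Strict Implicit.
Unset Printing Implicit Defensive.

Import GRing.Theory.
Local Open Scope quotient_scope.
Local Open Scope ring_scope.

Local Obligation Tactic := try by [].

Record category := Category {
  ob :> Type;
  hom : ob -> ob -> Type;
  idm : forall x, hom x x;
  cmp : forall x y z, hom y z -> hom x y -> hom x z;
  cmp_idl : forall x y (f : hom x y), cmp (idm y) f = f;
  cmp_idr : forall x y (f : hom x y), cmp f (idm x) = f;
  cmpA : forall x y z t (f : hom z t) (g : hom y z) (k : hom x y),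
    cmp f (cmp g k) = cmp (cmp f g) k }.

Record functor (C D : category) := Functor {
  fob :> C -> D;
  fmap : forall x y, hom x y -> hom (fob x) (fob y);
  fmap_id : forall x, fmap (idm x) = idm (fob x);
  fmap_cmp : forall x y z (f : hom y z) (g : hom x y),
    fmap (cmp f g) = cmp (fmap f) (fmap g) }.

Program Definition id_functor (C : category) : functor C C :=
  @Functor C C (fun x => x) (fun _ _ f => f) _ _.

Program Definition comp_functor (C D E : category)
    (G : functor D E) (F : functor C D) : functor C E :=
  @Functor C E (fun x => G (F x)) (fun _ _ f => fmap G (fmap F f)) _ _.
Next Obligation. by move=> C D E G F x /=; rewrite !fmap_id. Qed.
Next Obligation. by move=> C D E G F x y z f g /=; rewrite !fmap_cmp. Qed.

Definition is_iso (C : category) (x y : C) (f : hom x y) : Prop :=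
  exists g : hom y x, cmp g f = idm x /\ cmp f g = idm y.

Definition nat_isomorphic (C D : category) (F G : functor C D) : Prop :=
  exists eta : forall x, hom (F x) (G x),
    (forall x, is_iso (eta x)) /\
    (forall x y (f : hom x y), cmp (eta y) (fmap F f) = cmp (fmap G f) (eta x)).

Definition is_equivalence (C D : category) (F : functor C D) : Prop :=
  exists G : functor D C,
    nat_isomorphic (comp_functor G F) (id_functor C) /\
    nat_isomorphic (comp_functor F G) (id_functor D).

Program Definition full_subcat (C : category) (P : C -> Prop) : category :=
  @Category {x : C | P x} (fun x y => hom (sval x) (sval y))
    (fun x => idm (sval x)) (fun _ _ _ f g => cmp f g) _ _ _.
Next Obligation. by move=> C P x y f; exact: cmp_idl. Qed.
Next Obligation. by move=> C P x y f; exact: cmp_idr. Qed.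
Next Obligation. by move=> C P x y z t f g k; exact: cmpA. Qed.

Program Definition restrict_functor (C D : category) (F : functor C D)
    (P : C -> Prop) (Q : D -> Prop) (FPQ : forall x, P x -> Q (F x)) :
    functor (full_subcat P) (full_subcat Q) :=
  @Functor (full_subcat P) (full_subcat Q)
    (fun x => exist Q (F (sval x)) (FPQ _ (svalP x)))
    (fun _ _ f => fmap F f) _ _.
Next Obligation. by move=> C D F P Q FPQ x; exact: fmap_id. Qed.
Next Obligation. by move=> C D F P Q FPQ x y z f g; exact: fmap_cmp. Qed.

Definition is_zero_ob (C : category) (x : C) : Prop :=
  forall y : C, (exists f : hom x y, forall g, g = f) /\
                (exists f : hom y x, forall g, g = f).

(* Direct sum of categories with zero objects: families of objects almost all
   of which are zero objects, with families of morphisms. *)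
Program Definition dsum_cat (I : Type) (D : I -> category) : category :=
  @Category {x : forall i, D i | finite_set [set i | ~ is_zero_ob (x i)]%classic}
    (fun x y => forall i, hom (sval x i) (sval y i))
    (fun x i => idm (sval x i)) (fun _ _ _ f g i => cmp (f i) (g i)) _ _ _.
Next Obligation.
by move=> I D x y f; apply: functional_extensionality_dep => i; apply: cmp_idl.
Qed.
Next Obligation.
by move=> I D x y f; apply: functional_extensionality_dep => i; apply: cmp_idr.
Qed.
Next Obligation.
by move=> I D x y z t f g k; apply: functional_extensionality_dep => i;
  apply: cmpA.
Qed.

Lemma linear_ext (A : pzRingType) (M N : lmodType A) (f g : {linear M -> N}) :
  f =1 g -> f = g.
Proof.
move: f g => [f cf] [g cg] /= /funext fg; case: _ / fg in cg *.
congr GRing.Linear.Pack.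
case: cf cg => [[a] [b]] [[a'] [b']].
by congr GRing.Linear.Class; [congr Algebra.isNmodMorphism.Axioms_
  | congr GRing.isScalable.Axioms_]; apply: Prop_irrelevance.
Qed.

Program Definition modcat (A : pzRingType) : category :=
  @Category (lmodType A) (fun M N => {linear M -> N}) (fun M => idfun)
    (fun L M N g f => g \o f) _ _ _.
Next Obligation. by move=> *; apply: linear_ext. Qed.
Next Obligation. by move=> *; apply: linear_ext. Qed.
Next Obligation. by move=> *; apply: linear_ext. Qed.

(* [S] is the set of linear combinations of finitely many elements; over a
   field this says that [S] is a finite-dimensional subspace. *)
Definition fin_span (A : pzRingType) (M : lmodType A) (S : set M) : Prop :=
  exists (n : nat) (g : 'I_n -> M),
    S = [set v | exists c : 'I_n -> A, v = \sum_i c i *: g i]%classic.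

Definition fin_generated (A : pzRingType) (M : lmodType A) : Prop :=
  fin_span [set: M]%classic.

Definition simple_module (A : pzRingType) (M : lmodType A) : Prop :=
  (exists x : M, x != 0) /\
  (forall S : {pred M}, submod_closed S -> S =i pred1 0 \/ S =i predT).

Definition short_exact (A : pzRingType) (L M N : lmodType A)
    (f : {linear L -> M}) (g : {linear M -> N}) : Prop :=
  [/\ injective f, forall y, exists x, g x = y
    & forall m, g m = 0 <-> exists l, f l = m].

(* Full subcategories of modules are given by their classes of objects; [B] is
   a class such that exact sequences in the corresponding category are the
   exact sequences of modules. *)
Definition serre_subcat (A : pzRingType) (B S : lmodType A -> Prop) : Prop :=
  [/\ forall M, S M -> B M,
      exists M, S M
    & forall (L M N : lmodType A) (f : {linear L -> M}) (g : {linear M -> N}),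
        B L -> B M -> B N -> short_exact f g -> (S M <-> S L /\ S N)].

Definition serre_gen (A : pzRingType) (B : lmodType A -> Prop) (D : lmodType A)
    : lmodType A -> Prop :=
  fun M => B M /\
    forall S : lmodType A -> Prop, serre_subcat B S -> S D -> S M.

Section Restriction.
Variables (B A : pzRingType) (f : {rmorphism B -> A}) (M : lmodType A).

Definition restr : Type := let _ := f in M.
HB.instance Definition _ := GRing.Zmodule.copy restr M.

Definition restr_scale (b : B) (m : restr) : restr := f b *: (m : M).

Fact restr_scaleA a b v : restr_scale a (restr_scale b v) = restr_scale (a * b) v.
Proof. by rewrite /restr_scale scalerA rmorphM. Qed.
Fact restr_scale1 : left_id 1 restr_scale.
Proof. by move=> v; rewrite /restr_scale rmorph1 scale1r. Qed.
Fact restr_scaleDr : right_distributive restr_scale +%R.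
Proof. by move=> a u v; rewrite /restr_scale scalerDr. Qed.
Fact restr_scaleDl v : {morph restr_scale^~ v : a b / a + b}.
Proof. by move=> a b; rewrite /restr_scale rmorphD scalerDl. Qed.

HB.instance Definition _ := GRing.Zmodule_isLmodule.Build B restr
  restr_scaleA restr_scale1 restr_scaleDr restr_scaleDl.
End Restriction.

Section DirectSum.
Variables (A : pzRingType) (I : Type).

Section Object.
Variable M : I -> lmodType A.

Record dsum := DSum {
  dsum_fun :> forall i, M i;
  dsum_fin : finite_set [set i | dsum_fun i <> 0]%classic }.

HB.instance Definition _ := gen_eqMixin dsum.
HB.instance Definition _ := gen_choiceMixin dsum.

Lemma dsumP (x y : dsum) : (forall i, x i = y i) -> x = y.
Proof.
case: x y => [x fx] [y fy] /= xy.
have {}xy : x = y by apply: functional_extensionality_dep.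
by case: _ / xy in fy *; congr DSum; apply: Prop_irrelevance.
Qed.

Fact dsum0_fin : finite_set [set i | (0 : M i) <> 0]%classic.
Proof. by apply: (sub_finite_set _ (finite_set0 I)) => i /=. Qed.
Definition dsum0 := DSum dsum0_fin.

Fact dsumN_fin (x : dsum) : finite_set [set i | - x i <> 0]%classic.
Proof.
by apply: (sub_finite_set _ (dsum_fin x)) => i /= xi0 xi; rewrite xi oppr0 in xi0.
Qed.
Definition dsumN x := DSum (dsumN_fin x).

Fact dsumD_fin (x y : dsum) : finite_set [set i | x i + y i <> 0]%classic.
Proof.
have := dsum_fin x; have := dsum_fin y => fy fx.
apply: (@sub_finite_set _ _ ([set i | x i <> 0] `|` [set i | y i <> 0])%classic).
  move=> i /= xyi; have [xi|xi] := pselect (x i = 0); last by left.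
  by right=> yi; rewrite xi yi addr0 in xyi.
by rewrite finite_setU.
Qed.
Definition dsumD x y := DSum (dsumD_fin x y).

Fact dsumZ_fin (a : A) (x : dsum) : finite_set [set i | a *: x i <> 0]%classic.
Proof.
by apply: (sub_finite_set _ (dsum_fin x)) => i /= xi0 xi; rewrite xi scaler0 in xi0.
Qed.
Definition dsumZ a x := DSum (dsumZ_fin a x).

Fact dsumDA : associative dsumD.
Proof. by move=> x y z; apply: dsumP => i /=; rewrite addrA. Qed.
Fact dsumDC : commutative dsumD.
Proof. by move=> x y; apply: dsumP => i /=; rewrite addrC. Qed.
Fact dsum0D : left_id dsum0 dsumD.
Proof. by move=> x; apply: dsumP => i /=; rewrite add0r. Qed.
Fact dsumND : left_inverse dsum0 dsumN dsumD.
Proof. by move=> x; apply: dsumP => i /=; rewrite addNr. Qed.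

HB.instance Definition _ :=
  GRing.isZmodule.Build dsum dsumDA dsumDC dsum0D dsumND.

Fact dsumZA a b x : dsumZ a (dsumZ b x) = dsumZ (a * b) x.
Proof. by apply: dsumP => i /=; rewrite scalerA. Qed.
Fact dsumZ1 : left_id 1 dsumZ.
Proof. by move=> x; apply: dsumP => i /=; rewrite scale1r. Qed.
Fact dsumZDr : right_distributive dsumZ +%R.
Proof. by move=> a x y; apply: dsumP => i /=; rewrite scalerDr. Qed.
Fact dsumZDl x : {morph dsumZ^~ x : a b / a + b}.
Proof. by move=> a b; apply: dsumP => i /=; rewrite scalerDl. Qed.

HB.instance Definition _ := GRing.Zmodule_isLmodule.Build A dsum
  dsumZA dsumZ1 dsumZDr dsumZDl.
End Object.

Section Morphism.
Variables (M N : I -> lmodType A) (f : forall i, {linear M i -> N i}).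

Fact dsum_map_fin (x : dsum M) : finite_set [set i | f i (x i) <> 0]%classic.
Proof.
by apply: (sub_finite_set _ (dsum_fin x)) => i /= xi0 xi; rewrite xi linear0 in xi0.
Qed.
Definition dsum_map (x : dsum M) : dsum N := DSum (dsum_map_fin x).

Fact dsum_map_is_linear : linear dsum_map.
Proof. by move=> a x y; apply: dsumP => i /=; rewrite linearP. Qed.
HB.instance Definition _ :=
  GRing.isLinear.Build A (dsum M) (dsum N) *:%R dsum_map dsum_map_is_linear.
End Morphism.

(* (M_i)_i |-> the direct sum of the M_i *)
Program Definition dsum_functor (P : I -> lmodType A -> Prop)
    (Q : lmodType A -> Prop)
    (PQ : forall M : dsum_cat (fun i => @full_subcat (modcat A) (P i)),
       Q (dsum (fun i => sval (sval M i)))) :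
    functor (dsum_cat (fun i => @full_subcat (modcat A) (P i)))
            (@full_subcat (modcat A) Q) :=
  @Functor (dsum_cat (fun i => @full_subcat (modcat A) (P i)))
    (@full_subcat (modcat A) Q)
    (fun M => exist Q (dsum (fun i => sval (sval M i)) : lmodType A) (PQ M))
    (fun M N f => dsum_map f) _ _.
Next Obligation.
by move=> P Q PQ M; apply: linear_ext => x; apply: dsumP.
Qed.
Next Obligation.
by move=> P Q PQ L M N f g; apply: linear_ext => x; apply: dsumP.
Qed.
End DirectSum.

(* [ext_scal f N] is the tensor product of A and N over B, where A is a right
   B-module through f : B -> A; it is presented by the generators [a (x) n]
   and the usual relations. *)
Section ExtensionOfScalars.
Variables (B A : pzRingType) (f : {rmorphism B -> A}) (N : lmodType B).

Inductive tterm :=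
  | TPure of A & N
  | TZero
  | TOpp of tterm
  | TAdd of tterm & tterm.

HB.instance Definition _ := gen_eqMixin tterm.
HB.instance Definition _ := gen_choiceMixin tterm.

Inductive teq : tterm -> tterm -> Prop :=
  | teq_refl t : teq t t
  | teq_sym t u : teq t u -> teq u t
  | teq_trans t u v : teq t u -> teq u v -> teq t v
  | teq_opp t u : teq t u -> teq (TOpp t) (TOpp u)
  | teq_add t t' u u' : teq t t' -> teq u u' -> teq (TAdd t u) (TAdd t' u')
  | teq_addA t u v : teq (TAdd t (TAdd u v)) (TAdd (TAdd t u) v)
  | teq_addC t u : teq (TAdd t u) (TAdd u t)
  | teq_add0 t : teq (TAdd TZero t) t
  | teq_addN t : teq (TAdd (TOpp t) t) TZero
  | teq_pureDl a a' n : teq (TPure (a + a') n) (TAdd (TPure a n) (TPure a' n))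
  | teq_pureDr a n n' : teq (TPure a (n + n')) (TAdd (TPure a n) (TPure a n'))
  | teq_pureM a b n : teq (TPure (a * f b) n) (TPure a (b *: n)).

Definition teqb (t u : tterm) : bool := `[< teq t u >].

Fact teqb_refl : reflexive teqb.
Proof. by move=> t; apply/asboolP; apply: teq_refl. Qed.
Fact teqb_sym : symmetric teqb.
Proof. by move=> t u; apply: asbool_equiv_eq; split; apply: teq_sym. Qed.
Fact teqb_trans : transitive teqb.
Proof.
by move=> u t v /asboolP tu /asboolP uv; apply/asboolP; apply: teq_trans tu uv.
Qed.

Canonical teq_equiv := EquivRel teqb teqb_refl teqb_sym teqb_trans.

Definition ext_scal := {eq_quot teq_equiv}.
HB.instance Definition _ := Choice.on ext_scal.
HB.instance Definition _ := EqQuotient.on ext_scal.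

Lemma ext_scalP (t u : tterm) :
  teq t u <-> \pi_ext_scal t = \pi_ext_scal u.
Proof. by split=> [tu|/eqmodP /asboolP//]; apply/eqmodP/asboolP. Qed.

Let trepr t : teq (repr (\pi_ext_scal t)) t.
Proof. by apply/ext_scalP; rewrite reprK. Qed.

Definition tensor (a : A) (n : N) : ext_scal := \pi_ext_scal (TPure a n).
Definition ext0 : ext_scal := \pi_ext_scal TZero.
Definition extN (x : ext_scal) : ext_scal := \pi_ext_scal (TOpp (repr x)).
Definition extD (x y : ext_scal) : ext_scal := \pi_ext_scal (TAdd (repr x) (repr y)).

Lemma extN_pi t : extN (\pi_ext_scal t) = \pi_ext_scal (TOpp t).
Proof. by apply/ext_scalP/teq_opp/trepr. Qed.
Lemma extD_pi t u : extD (\pi_ext_scal t) (\pi_ext_scal u) = \pi_ext_scal (TAdd t u).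
Proof. by apply/ext_scalP/teq_add; apply: trepr. Qed.

Lemma ext_ind (P : ext_scal -> Prop) : (forall t, P (\pi_ext_scal t)) -> forall x, P x.
Proof. by move=> Pt x; rewrite -[x]reprK. Qed.

Fact extDA : associative extD.
Proof.
elim/ext_ind=> t; elim/ext_ind=> u; elim/ext_ind=> v.
by rewrite !extD_pi; apply/ext_scalP/teq_addA.
Qed.
Fact extDC : commutative extD.
Proof.
elim/ext_ind=> t; elim/ext_ind=> u.
by rewrite !extD_pi; apply/ext_scalP/teq_addC.
Qed.
Fact ext0D : left_id ext0 extD.
Proof. by elim/ext_ind=> t; rewrite !extD_pi; apply/ext_scalP/teq_add0. Qed.
Fact extND : left_inverse ext0 extN extD.
Proof.
by elim/ext_ind=> t; rewrite extN_pi extD_pi; apply/ext_scalP/teq_addN.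
Qed.

HB.instance Definition _ := GRing.isZmodule.Build ext_scal extDA extDC ext0D extND.

Fixpoint tscale (a : A) (t : tterm) : tterm :=
  match t with
  | TPure a' n => TPure (a * a') n
  | TZero => TZero
  | TOpp t => TOpp (tscale a t)
  | TAdd t u => TAdd (tscale a t) (tscale a u)
  end.

Fact teq_scale a t u : teq t u -> teq (tscale a t) (tscale a u).
Proof.
move=> tu; elim: t u / tu => /=; try by [constructor].
- by move=> t u v _ tu _; apply: teq_trans.
- by move=> a1 a2 n; rewrite mulrDr; constructor.
- by move=> a1 b n; rewrite mulrA; constructor.
Qed.

Definition extZ (a : A) (x : ext_scal) : ext_scal := \pi_ext_scal (tscale a (repr x)).

Lemma extZ_pi a t : extZ a (\pi_ext_scal t) = \pi_ext_scal (tscale a t).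
Proof. by apply/ext_scalP/teq_scale/trepr. Qed.

Fact extZA a b x : extZ a (extZ b x) = extZ (a * b) x.
Proof.
elim/ext_ind: x => t; rewrite !extZ_pi; congr (\pi_ext_scal _).
by elim: t => //= [c n|t ->|t -> u ->] //; rewrite mulrA.
Qed.
Fact extZ1 : left_id 1 extZ.
Proof.
elim/ext_ind=> t; rewrite extZ_pi; congr (\pi_ext_scal _).
by elim: t => //= [c n|t ->|t -> u ->] //; rewrite mul1r.
Qed.
Fact extZDr : right_distributive extZ +%R.
Proof.
move=> a; elim/ext_ind=> t; elim/ext_ind=> u.
by rewrite [_ + _]extD_pi !extZ_pi [RHS]extD_pi.
Qed.
Lemma pi_extD t u : \pi_ext_scal (TAdd t u) = \pi_ext_scal t + \pi_ext_scal u.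
Proof. by rewrite [RHS]extD_pi. Qed.
Lemma pi_extN t : \pi_ext_scal (TOpp t) = - \pi_ext_scal t.
Proof. by rewrite [RHS]extN_pi. Qed.
Fact extZDl x : {morph extZ^~ x : a b / a + b}.
Proof.
move=> a b; elim/ext_ind: x => t; rewrite !extZ_pi.
elim: t => /= [c n||t IH|t IHt u IHu].
- by rewrite mulrDl -pi_extD; apply/ext_scalP/teq_pureDl.
- by rewrite [RHS]ext0D.
- by rewrite !pi_extN IH opprD.
- by rewrite !pi_extD IHt IHu addrACA.
Qed.

HB.instance Definition _ := GRing.Zmodule_isLmodule.Build A ext_scal
  extZA extZ1 extZDr extZDl.
End ExtensionOfScalars.

HB.mixin Record Lmodule_isLieAlgebra (K : comNzRingType) L of GRing.Lmodule K L := {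
  lie : L -> L -> L;
  lie_linearl : forall y, linear (lie^~ y);
  lie_linearr : forall x, linear (lie x);
  liexx : forall x, lie x x = 0;
  lie_jacobi : forall x y z,
    lie x (lie y z) + lie y (lie z x) + lie z (lie x y) = 0 }.

#[short(type="lieAlgType")]
HB.structure Definition LieAlgebra (K : comNzRingType) :=
  { L of GRing.Lmodule K L & Lmodule_isLieAlgebra K L }.

(* The quotient of the free unital associative K-algebra on the elements of L
   by the relations making L -> env L linear and compatible with brackets. *)
Section Envelope.
Variables (K : comNzRingType) (L : lieAlgType K).

Inductive uterm :=
  | UGen of L
  | UScal of K
  | UAdd of uterm & uterm
  | UMul of uterm & uterm.

HB.instance Definition _ := gen_eqMixin uterm.
HB.instance Definition _ := gen_choiceMixin uterm.

Inductive ueq : uterm -> uterm -> Prop :=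
  | ueq_refl t : ueq t t
  | ueq_sym t u : ueq t u -> ueq u t
  | ueq_trans t u v : ueq t u -> ueq u v -> ueq t v
  | ueq_add t t' u u' : ueq t t' -> ueq u u' -> ueq (UAdd t u) (UAdd t' u')
  | ueq_mul t t' u u' : ueq t t' -> ueq u u' -> ueq (UMul t u) (UMul t' u')
  | ueq_addA t u v : ueq (UAdd t (UAdd u v)) (UAdd (UAdd t u) v)
  | ueq_addC t u : ueq (UAdd t u) (UAdd u t)
  | ueq_add0 t : ueq (UAdd (UScal 0) t) t
  | ueq_mulA t u v : ueq (UMul t (UMul u v)) (UMul (UMul t u) v)
  | ueq_mul1 t : ueq (UMul (UScal 1) t) t
  | ueq_mul0 t : ueq (UMul (UScal 0) t) (UScal 0)
  | ueq_mulDl t u v : ueq (UMul (UAdd t u) v) (UAdd (UMul t v) (UMul u v))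
  | ueq_mulDr t u v : ueq (UMul t (UAdd u v)) (UAdd (UMul t u) (UMul t v))
  | ueq_scalD a b : ueq (UScal (a + b)) (UAdd (UScal a) (UScal b))
  | ueq_scalM a b : ueq (UScal (a * b)) (UMul (UScal a) (UScal b))
  | ueq_scalC a t : ueq (UMul (UScal a) t) (UMul t (UScal a))
  | ueq_genD x y : ueq (UGen (x + y)) (UAdd (UGen x) (UGen y))
  | ueq_genZ a x : ueq (UGen (a *: x)) (UMul (UScal a) (UGen x))
  | ueq_lie x y : ueq (UMul (UGen x) (UGen y))
                      (UAdd (UMul (UGen y) (UGen x)) (UGen (lie x y))).

Definition ueqb (t u : uterm) : bool := `[< ueq t u >].

Fact ueqb_refl : reflexive ueqb.
Proof. by move=> t; apply/asboolP; apply: ueq_refl. Qed.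
Fact ueqb_sym : symmetric ueqb.
Proof. by move=> t u; apply: asbool_equiv_eq; split; apply: ueq_sym. Qed.
Fact ueqb_trans : transitive ueqb.
Proof.
by move=> u t v /asboolP tu /asboolP uv; apply/asboolP; apply: ueq_trans tu uv.
Qed.

Canonical ueq_equiv := EquivRel ueqb ueqb_refl ueqb_sym ueqb_trans.

Definition env := {eq_quot ueq_equiv}.
HB.instance Definition _ := Choice.on env.
HB.instance Definition _ := EqQuotient.on env.

Lemma envP (t u : uterm) : ueq t u <-> \pi_env t = \pi_env u.
Proof. by split=> [tu|/eqmodP /asboolP//]; apply/eqmodP/asboolP. Qed.

Let urepr t : ueq (repr (\pi_env t)) t.
Proof. by apply/envP; rewrite reprK. Qed.

Definition env_scal (a : K) : env := \pi_env (UScal a).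
Definition envD (x y : env) : env := \pi_env (UAdd (repr x) (repr y)).
Definition envM (x y : env) : env := \pi_env (UMul (repr x) (repr y)).
Definition envN (x : env) : env := envM (env_scal (-1)) x.
Definition env_gen (x : L) : env := \pi_env (UGen x).

Lemma envD_pi t u : envD (\pi_env t) (\pi_env u) = \pi_env (UAdd t u).
Proof. by apply/envP/ueq_add; apply: urepr. Qed.
Lemma envM_pi t u : envM (\pi_env t) (\pi_env u) = \pi_env (UMul t u).
Proof. by apply/envP/ueq_mul; apply: urepr. Qed.

Lemma env_ind (P : env -> Prop) : (forall t, P (\pi_env t)) -> forall x, P x.
Proof. by move=> Pt x; rewrite -[x]reprK. Qed.

Fact envDA : associative envD.
Proof.
elim/env_ind=> t; elim/env_ind=> u; elim/env_ind=> v.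
by rewrite !envD_pi; apply/envP/ueq_addA.
Qed.
Fact envDC : commutative envD.
Proof.
by elim/env_ind=> t; elim/env_ind=> u; rewrite !envD_pi; apply/envP/ueq_addC.
Qed.
Fact env0D : left_id (env_scal 0) envD.
Proof. by elim/env_ind=> t; rewrite !envD_pi; apply/envP/ueq_add0. Qed.
Fact envMDl : left_distributive envM envD.
Proof.
elim/env_ind=> t; elim/env_ind=> u; elim/env_ind=> v.
by rewrite !(envD_pi, envM_pi); apply/envP/ueq_mulDl.
Qed.
Fact env1M : left_id (env_scal 1) envM.
Proof. by elim/env_ind=> t; rewrite !envM_pi; apply/envP/ueq_mul1. Qed.
Lemma env_scalD a b : env_scal (a + b) = envD (env_scal a) (env_scal b).
Proof. by rewrite envD_pi; apply/envP/ueq_scalD. Qed.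
Lemma env_scalM a b : env_scal (a * b) = envM (env_scal a) (env_scal b).
Proof. by rewrite envM_pi; apply/envP/ueq_scalM. Qed.
Lemma env0M x : envM (env_scal 0) x = env_scal 0.
Proof. by elim/env_ind: x => t; rewrite envM_pi; apply/envP/ueq_mul0. Qed.
Lemma env_scalC a x : envM (env_scal a) x = envM x (env_scal a).
Proof. by elim/env_ind: x => t; rewrite !envM_pi; apply/envP/ueq_scalC. Qed.
Fact envND : left_inverse (env_scal 0) envN envD.
Proof.
by move=> x; rewrite /envN -[X in envD _ X]env1M -envMDl -env_scalD addNr env0M.
Qed.

HB.instance Definition _ := GRing.isZmodule.Build env envDA envDC env0D envND.

Fact envMA : associative envM.
Proof.
elim/env_ind=> t; elim/env_ind=> u; elim/env_ind=> v.
by rewrite !envM_pi; apply/envP/ueq_mulA.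
Qed.
Fact envM1 : right_id (env_scal 1) envM.
Proof. by move=> x; rewrite -env_scalC env1M. Qed.
Fact envMDr : right_distributive envM envD.
Proof.
elim/env_ind=> t; elim/env_ind=> u; elim/env_ind=> v.
by rewrite !(envD_pi, envM_pi); apply/envP/ueq_mulDr.
Qed.

(* Evaluation of terms, first used to see that env L is not the zero ring. *)
Section Eval.
Variables (A : algType K) (phi : {linear L -> A}).
Hypothesis phi_lie : forall x y, phi (lie x y) = phi x * phi y - phi y * phi x.

Fixpoint ueval (t : uterm) : A :=
  match t with
  | UGen x => phi x
  | UScal a => a%:A
  | UAdd t u => ueval t + ueval u
  | UMul t u => ueval t * ueval u
  end.

Lemma ueval_ueq t u : ueq t u -> ueval t = ueval u.
Proof.
move=> tu; elim: t u / tu => //=.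
- by move=> t u v _ -> _ ->.
- by move=> t t' u u' _ -> _ ->.
- by move=> t t' u u' _ -> _ ->.
- by move=> *; rewrite addrA.
- by move=> *; rewrite addrC.
- by move=> *; rewrite scale0r add0r.
- by move=> *; rewrite mulrA.
- by move=> *; rewrite scale1r mul1r.
- by move=> *; rewrite scale0r mul0r.
- by move=> *; rewrite mulrDl.
- by move=> *; rewrite mulrDr.
- by move=> *; rewrite scalerDl.
- by move=> *; rewrite mulr_algl scalerA.
- by move=> *; rewrite mulr_algl mulr_algr.
- by move=> *; rewrite linearD.
- by move=> *; rewrite linearZ mulr_algl.
- by move=> x y; rewrite phi_lie addrC subrK.
Qed.
End Eval.

Fact env1_neq0 : env_scal 1 != env_scal 0.
Proof.
apply/eqP => /envP h.
have /(_ K^o \0 (fun _ _ => _)) := @ueval_ueq.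
move=> /(_ _ _ _ h) /=; rewrite scale1r scale0r => H.
by have := oner_neq0 K; rewrite H ?eqxx // => *; rewrite /= mulr0 subr0.
Qed.

HB.instance Definition _ := GRing.Zmodule_isNzRing.Build env
  envMA env1M envM1 envMDl envMDr env1_neq0.

Definition envZ (a : K) (x : env) : env := env_scal a * x.
Fact envZA a b x : envZ a (envZ b x) = envZ (a * b) x.
Proof. by rewrite /envZ mulrA -[_ a * _ b]env_scalM. Qed.
Fact envZ1 : left_id 1 envZ.
Proof. exact: mul1r. Qed.
Fact envZDr : right_distributive envZ +%R.
Proof. by move=> a x y; rewrite /envZ mulrDr. Qed.
Fact envZDl x : {morph envZ^~ x : a b / a + b}.
Proof. by move=> a b; rewrite /envZ [env_scal _]env_scalD -mulrDl. Qed.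

HB.instance Definition _ := GRing.Zmodule_isLmodule.Build K env
  envZA envZ1 envZDr envZDl.

Fact envZAl a (x y : env) : a *: (x * y) = a *: x * y.
Proof. exact: mulrA. Qed.
HB.instance Definition _ := GRing.Lmodule_isLalgebra.Build K env envZAl.
Fact envZAr a (x y : env) : a *: (x * y) = x * (a *: y).
Proof.
have aC z : env_scal a * z = z * env_scal a := env_scalC a z.
by rewrite -[LHS]/(env_scal a * (x * y)) mulrA aC -mulrA.
Qed.
HB.instance Definition _ := GRing.Lalgebra_isAlgebra.Build K env envZAr.

Lemma env_algE a : a%:A = env_scal a :> env.
Proof. exact: mulr1. Qed.
Lemma pi_envD t u : \pi_env (UAdd t u) = \pi_env t + \pi_env u.
Proof. by rewrite [RHS]envD_pi. Qed.
Lemma pi_envM t u : \pi_env (UMul t u) = \pi_env t * \pi_env u.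
Proof. by rewrite [RHS]envM_pi. Qed.

Fact env_gen_linear : linear env_gen.
Proof.
move=> a x y; rewrite /env_gen.
have /envP -> := ueq_genD (a *: x) y; rewrite pi_envD; congr (_ + _).
by have /envP -> := ueq_genZ a x; rewrite pi_envM.
Qed.
HB.instance Definition _ := GRing.isLinear.Build K L env *:%R env_gen env_gen_linear.

Lemma env_gen_lie x y :
  env_gen (lie x y) = env_gen x * env_gen y - env_gen y * env_gen x.
Proof.
rewrite -[_ x * _ y]pi_envM -[_ y * _ x]pi_envM.
by have /envP -> := ueq_lie x y; rewrite pi_envD addrAC subrr add0r.
Qed.

Section Lift.
Variables (A : algType K) (phi : {linear L -> A}).
Hypothesis phi_lie : forall x y, phi (lie x y) = phi x * phi y - phi y * phi x.

Definition env_lift of (forall x y, phi (lie x y) = phi x * phi y - phi y * phi x)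
  : env -> A := fun x => ueval phi (repr x).

Local Notation lift := (env_lift phi_lie).

Lemma env_lift_pi t : lift (\pi_env t) = ueval phi t.
Proof. by apply: ueval_ueq => //; apply: urepr. Qed.

Fact env_lift_is_linear : linear lift.
Proof.
move=> a; elim/env_ind=> t; elim/env_ind=> u.
have -> : a *: \pi_env t + \pi_env u = \pi_env (UAdd (UMul (UScal a) t) u).
  by rewrite pi_envD pi_envM.
by rewrite !env_lift_pi /= mulr_algl.
Qed.
HB.instance Definition _ := GRing.isLinear.Build K env A *:%R lift env_lift_is_linear.

Fact env_lift_is_monoid_morphism : monoid_morphism lift.
Proof.
split; first by rewrite env_lift_pi /= scale1r.
elim/env_ind=> t; elim/env_ind=> u.
by rewrite -pi_envM !env_lift_pi.
Qed.
HB.instance Definition _ :=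
  GRing.isMonoidMorphism.Build env A lift env_lift_is_monoid_morphism.

Lemma env_lift_gen x : lift (env_gen x) = phi x.
Proof. exact: env_lift_pi. Qed.
End Lift.
End Envelope.

Section EnvelopeMap.
Variables (K : comNzRingType) (L L' : lieAlgType K) (f : {linear L -> L'}).
Hypothesis f_lie : forall x y, f (lie x y) = lie (f x) (f y).

Fact env_gen_comp_lie (x y : L) : (@env_gen K L' \o f) (lie x y) =
  (@env_gen K L' \o f) x * (@env_gen K L' \o f) y
  - (@env_gen K L' \o f) y * (@env_gen K L' \o f) x.
Proof. by rewrite /= f_lie env_gen_lie. Qed.

Definition env_map : {rmorphism env L -> env L'} := env_lift env_gen_comp_lie.
End EnvelopeMap.

Inductive sbasis := Be | Bh | Bf | Bp | Bq | Bz.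

Definition sbasis_code (i : sbasis) : 'I_6 :=
  inord match i with Be => 0 | Bh => 1 | Bf => 2 | Bp => 3 | Bq => 4 | Bz => 5 end.
Definition sbasis_decode (k : 'I_6) : sbasis :=
  nth Be [:: Be; Bh; Bf; Bp; Bq; Bz] k.
Fact sbasis_codeK : cancel sbasis_code sbasis_decode.
Proof. by case; rewrite /sbasis_decode inordK. Qed.
HB.instance Definition _ := Finite.copy sbasis (can_type sbasis_codeK).

Lemma big_sbasis (V : zmodType) (F : sbasis -> V) :
  \sum_i F i = F Be + F Bh + F Bf + F Bp + F Bq + F Bz.
Proof.
rewrite (perm_big [:: Be; Bh; Bf; Bp; Bq; Bz]) /=.
  by rewrite !big_cons big_nil addr0 !addrA.
apply: uniq_perm; rewrite ?index_enum_uniq //=.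
  by rewrite !inE -!(inj_eq (can_inj sbasis_codeK)) -!(inj_eq val_inj) /= !inordK.
by move=> i; rewrite mem_index_enum; case: i;
  rewrite !inE -!(inj_eq (can_inj sbasis_codeK)) -!(inj_eq val_inj) /= !inordK.
Qed.

Section Schroedinger.
Variable K : fieldType.

Definition schroedinger : Type := {ffun sbasis -> K^o}.
HB.instance Definition _ := Vector.copy schroedinger {ffun sbasis -> K^o}.
Local Notation s := schroedinger.

Definition sbv (i : sbasis) : s := [ffun j => (i == j)%:R : K^o].

(* Each bracket is listed in one order only; [slie] below antisymmetrizes. *)
Definition brk (i j : sbasis) : s :=
  match i, j with
  | Bh, Be => 2%:R *: sbv Be
  | Be, Bf => sbv Bh
  | Bh, Bf => - 2%:R *: sbv Bf
  | Be, Bq => sbv Bp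
  | Bh, Bp => sbv Bp
  | Bf, Bp => sbv Bq
  | Bh, Bq => - sbv Bq
  | Bp, Bq => sbv Bz
  | _, _ => 0
  end.

Definition slie (x y : s) : s :=
  \sum_i \sum_j ((x i * y j - x j * y i) : K) *: brk i j.

Definition slie_coord (x y : s) (k : sbasis) : K :=
  match k with
  | Be => 2%:R * (x Bh * y Be - x Be * y Bh)
  | Bh => x Be * y Bf - x Bf * y Be
  | Bf => - 2%:R * (x Bh * y Bf - x Bf * y Bh)
  | Bp => (x Be * y Bq - x Bq * y Be) + (x Bh * y Bp - x Bp * y Bh)
  | Bq => (x Bf * y Bp - x Bp * y Bf) - (x Bh * y Bq - x Bq * y Bh)
  | Bz => x Bp * y Bq - x Bq * y Bp
  end.

Lemma sbasis_eqE (i j : sbasis) : (i == j) =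
  match i, j with
  | Be, Be | Bh, Bh | Bf, Bf | Bp, Bp | Bq, Bq | Bz, Bz => true
  | _, _ => false
  end.
Proof. by case: i; case: j; apply/eqP. Qed.

Lemma slieE x y k : slie x y k = slie_coord x y k.
Proof.
rewrite /slie !big_sbasis /= !scaler0 !addr0 !add0r.
rewrite !ffunE !sbasis_eqE /=.
by case: k => /=; rewrite /GRing.scale /=; ring.
Qed.

Fact slie_linearr x : linear (slie x).
Proof.
move=> a y z; apply/ffunP => k; rewrite !ffunE !slieE.
by case: k => /=; rewrite !ffunE /GRing.scale /=; ring.
Qed.
Fact sliexx x : slie x x = 0.
Proof. by apply/ffunP => k; rewrite slieE ffunE; case: k => /=; ring. Qed.
Fact slie_linearl y : linear (slie^~ y).
Proof.
move=> a x z; apply/ffunP => k; rewrite !ffunE !slieE.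
by case: k => /=; rewrite !ffunE /GRing.scale /=; ring.
Qed.
Fact slie_jacobi x y z :
  slie x (slie y z) + slie y (slie z x) + slie z (slie x y) = 0.
Proof.
apply/ffunP => k; rewrite !ffunE !slieE.
by case: k => /=; rewrite !slieE /=; ring.
Qed.

HB.instance Definition _ := Lmodule_isLieAlgebra.Build K s
  slie_linearl slie_linearr sliexx slie_jacobi.

Definition lie_closed (V : {vspace s}) : Prop :=
  forall x y, x \in V -> y \in V -> lie x y \in V.

Section SubLie.
Variables (V : {vspace s}) (Vlie : lie_closed V).

Definition sublie : Type := let _ := Vlie in subvs_of V.
HB.instance Definition _ := Vector.copy sublie (subvs_of V).

Definition sublie_val (x : sublie) : s := vsval x.
Arguments sublie_val : simpl never.
Fact sublie_val_linear : linear sublie_val.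
Proof. exact: linearP. Qed.
HB.instance Definition _ :=
  GRing.isLinear.Build K sublie s *:%R sublie_val sublie_val_linear.

Definition sublie_lie (x y : sublie) : sublie :=
  Subvs (Vlie (subvsP (x : subvs_of V)) (subvsP (y : subvs_of V))).

Lemma sublie_valP (x y : sublie) :
  sublie_val (sublie_lie x y) = lie (sublie_val x) (sublie_val y).
Proof. by []. Qed.
Lemma sublie_val_inj : injective sublie_val.
Proof. exact: val_inj. Qed.

Fact sublie_linearl y : linear (sublie_lie^~ y).
Proof.
move=> a x z; apply: sublie_val_inj.
by rewrite [RHS]linearP /= !sublie_valP linearP lie_linearl.
Qed.
Fact sublie_linearr x : linear (sublie_lie x).
Proof.
move=> a y z; apply: sublie_val_inj.
by rewrite [RHS]linearP /= !sublie_valP linearP lie_linearr.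
Qed.
Fact subliexx x : sublie_lie x x = 0.
Proof. by apply: sublie_val_inj; rewrite sublie_valP liexx linear0. Qed.
Fact sublie_jacobi x y z :
  sublie_lie x (sublie_lie y z) + sublie_lie y (sublie_lie z x)
  + sublie_lie z (sublie_lie x y) = 0.
Proof.
apply: sublie_val_inj.
by rewrite !linearD /= !sublie_valP lie_jacobi linear0.
Qed.
HB.instance Definition _ := Lmodule_isLieAlgebra.Build K sublie
  sublie_linearl sublie_linearr subliexx sublie_jacobi.

Definition env_incl : {rmorphism env sublie -> env s} :=
  env_map (f := sublie_val) sublie_valP.
End SubLie.

Definition hh : {vspace s} := (<[sbv Bh]> + <[sbv Bz]>)%VS.
Definition nplus : {vspace s} := (<[sbv Be]> + <[sbv Bp]>)%VS.
Definition bb : {vspace s} := (hh + nplus)%VS.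

Lemma nplusP (x : s) : reflect (exists a b : K, x = a *: sbv Be + b *: sbv Bp)
  (x \in nplus).
Proof.
apply: (iffP memv_addP) => [[u /vlineP[a ->] [v /vlineP[b ->] ->]]|[a [b ->]]].
  by exists a, b.
by exists (a *: sbv Be); rewrite ?memvZ ?memv_line//;
  exists (b *: sbv Bp); rewrite ?memvZ ?memv_line.
Qed.

Lemma bb_coord (x : s) : x \in bb -> x Bf = 0 /\ x Bq = 0.
Proof.
move=> /memv_addP[_ /memv_addP[_ /vlineP[a ->] [_ /vlineP[b ->] ->]]].
move=> [_ /nplusP[c [d ->]] ->]; rewrite !ffunE !sbasis_eqE.
by rewrite !scaler0 !addr0.
Qed.

Lemma lie_bb (x y : s) : x \in bb -> y \in bb -> lie x y \in nplus.
Proof.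
move=> /bb_coord[xf xq] /bb_coord[yf yq]; apply/nplusP.
exists (slie_coord x y Be), (slie_coord x y Bp).
apply/ffunP => k; rewrite [LHS]slieE !ffunE !sbasis_eqE.
by case: k; rewrite /= ?xf ?xq ?yf ?yq /GRing.scale /=; ring.
Qed.

Fact bb_lie : lie_closed bb.
Proof. by move=> x y xb yb; apply: (subvP (addvSr _ _)); apply: lie_bb. Qed.

Fact nplus_lie : lie_closed nplus.
Proof.
have sub := subvP (addvSr hh nplus).
by move=> x y xn yn; apply: lie_bb; apply: sub.
Qed.

Fact mem_h : sbv Bh \in hh. Proof. by rewrite (subvP (addvSl _ _)) ?memv_line. Qed.
Fact mem_z : sbv Bz \in hh. Proof. by rewrite (subvP (addvSr _ _)) ?memv_line. Qed.
Definition elh : subvs_of hh := Subvs mem_h.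
Definition elz : subvs_of hh := Subvs mem_z.

Definition hdual := 'Hom(subvs_of hh, K^o).

Definition hvee : hdual := linfun (fun H : subvs_of hh => (vsval H : s) Bh).
Definition zvee : hdual := linfun (fun H : subvs_of hh => (vsval H : s) Bz).

Fact coord_linear (i : sbasis) : linear (fun H : subvs_of hh => (vsval H : s) i).
Proof. by move=> a x y; rewrite linearP !ffunE. Qed.

Lemma dual_basis : [/\ hvee elh = 1, hvee elz = 0, zvee elh = 0 & zvee elz = 1].
Proof.
pose lin i := GRing.isLinear.Build K (subvs_of hh) K^o *:%R _ (coord_linear i).
pose f i : {linear subvs_of hh -> K^o} := HB.pack (fun H : subvs_of hh => (vsval H : s) i) (lin i).
by rewrite /hvee /zvee; split; rewrite (lfunE (f _)) /= ffunE sbasis_eqE.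
Qed.

Definition roots : seq hdual := [:: hvee; - hvee; hvee *+ 2; - (hvee *+ 2)].

Definition root_lattice : set hdual :=
  [set nu | exists m : 'I_(size roots) -> int, 
    nu = \sum_(i < size roots) roots`_i *~ m i]%classic.

Definition is_coset (xi : set hdual) : Prop :=
  exists mu : hdual, xi = [set mu + nu | nu in root_lattice]%classic.

Definition is_central_charge (xi : set hdual) (c : K) : Prop :=
  forall lam, xi lam -> lam elz = c.

Local Notation U := (env s).

Section Verma.
Variable lam : hdual.

(* [lam] extended to the Borel subalgebra by 0 on nplus *)
Definition bchar (x : sublie bb_lie) : K^o :=
  lam (((sublie_val x : s) Bh : K) *: elh + ((sublie_val x : s) Bz : K) *: elz).

Fact bchar_linear : linear bchar.
Proof.
move=> a x y; rewrite /bchar -linearP; congr (lam _).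
rewrite linearP !ffunE /= !scalerDl scalerDr !scalerA.
by rewrite addrACA.
Qed.
HB.instance Definition _ :=
  GRing.isLinear.Build K (sublie bb_lie) K^o *:%R bchar bchar_linear.

Fact bchar_lie x y : bchar (lie x y) = bchar x * bchar y - bchar y * bchar x.
Proof.
rewrite [in RHS]mulrC subrr /bchar.
have /nplusP[a [b ->]] : sublie_val (lie x y) \in nplus.
  by apply: lie_bb; apply: (subvsP (_ : subvs_of bb)).
by rewrite !ffunE !sbasis_eqE !scaler0 !addr0 !scale0r addr0 linear0.
Qed.

(* env b acts on K through the algebra morphism extending [bchar]. *)
Definition one_dim_mod : lmodType (env (sublie bb_lie)) :=
  restr (env_lift bchar_lie) (K^o)^o.

Definition verma : lmodType U := ext_scal (env_incl bb_lie) one_dim_mod.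
End Verma.

Section Weight.
Variable M : lmodType U.

(* M as a vector space over K, through K -> U. *)
Definition kvect : lmodType K := restr (in_alg U) M.

Definition is_weight (lam : hdual) (v : M) : Prop :=
  forall H : subvs_of hh, env_gen (vsval H : s) *: v = (lam H)%:A *: v.

Definition weight_pred (lam : hdual) : {pred kvect} :=
  [pred v | `[< is_weight lam v >]].

Fact weight_closed lam : submod_closed (weight_pred lam).
Proof.
split=> [|a u v /asboolP ulam /asboolP vlam]; apply/asboolP => H.
  by rewrite !scaler0.
have swap b x : x *: (b%:A *: (u : M)) = b%:A *: (x *: (u : M)) :> M.
  by rewrite !scalerA mulr_algr mulr_algl.
rewrite -[a *: u]/(a%:A *: (u : M)) 2!scalerDr vlam; congr (_ + _).
by rewrite swap ulam swap.
Qed.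
HB.instance Definition _ lam :=
  GRing.isSubmodClosed.Build K kvect (weight_pred lam) (weight_closed lam).

Record weight_space (lam : hdual) := WeightSpace {
  weight_val :> kvect;
  weight_valP : weight_val \in weight_pred lam }.
HB.instance Definition _ lam := [isSub for @weight_val lam].
HB.instance Definition _ lam := [Choice of weight_space lam by <:].
HB.instance Definition _ lam := [SubChoice_isSubZmodule of weight_space lam by <:].
HB.instance Definition _ lam := [SubZmodule_isSubLmodule of weight_space lam by <:].

Definition support : set hdual :=
  [set lam | exists2 v, is_weight lam v & v <> 0]%classic.

Definition weight_module : Prop :=
  forall v : M, exists! w : hdual -> M,
    [/\ finite_set [set lam | w lam <> 0]%classic,
        forall lam, is_weight lam (w lam)
      & v = \sum_(lam \in [set: hdual]%classic) w lam].

(* The subspace U(n_+) v, U(n_+) acting through U(n_+) -> U. *)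
Definition nplus_orbit (v : M) : set kvect :=
  [set (env_incl nplus_lie u *: v : M) | u in [set: env (sublie nplus_lie)]]%classic.

Definition in_O : Prop :=
  [/\ fin_generated M, weight_module & forall v, fin_span (nplus_orbit v)].

Definition in_Oxi (xi : set hdual) : Prop := in_O /\ (support `<=` xi)%classic.
End Weight.

Section WeightMap.
Variables (M N : lmodType U) (lam : hdual) (f : {linear M -> N}).

Fact weight_map_subproof (v : weight_space M lam) :
  (f (weight_val v : M) : kvect N) \in @weight_pred N lam.
Proof.
have /asboolP vlam := weight_valP v.
by apply/asboolP => H; rewrite -!linearZ vlam.
Qed.
Definition weight_map (v : weight_space M lam) : weight_space N lam :=
  WeightSpace (weight_map_subproof v).

Fact weight_map_linear : linear weight_map.
Proof. by move=> a u v; apply: val_inj; rewrite /= [LHS]linearP. Qed.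
HB.instance Definition _ := GRing.isLinear.Build K
  (weight_space M lam) (weight_space N lam) *:%R weight_map weight_map_linear.
End WeightMap.

Program Definition weight_functor (lam : hdual) : functor (modcat U) (modcat K) :=
  @Functor (modcat U) (modcat K) (fun M => weight_space M lam : lmodType K)
    (fun M N f => @weight_map M N lam f) _ _.
Next Obligation. by move=> lam M; apply: linear_ext => v; apply: val_inj. Qed.
Next Obligation.
by move=> lam L M N f g; apply: linear_ext => v; apply: val_inj.
Qed.

Definition cat_Oxi (xi : set hdual) : category :=
  @full_subcat (modcat U) (fun M => in_Oxi M xi).

Definition in_block (xi : set hdual) (lam : hdual) : lmodType U -> Prop :=
  serre_gen (fun M => in_Oxi M xi) (verma lam).

Definition cat_block (xi : set hdual) (lam : hdual) : category :=
  @full_subcat (modcat U) (in_block xi lam).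

Definition cat_fdvect : category := @full_subcat (modcat K) (@fin_generated K).

End Schroedinger.

(* Main.v *)
(* Fix a module on which z acts by c <> 0. The element F = f + q^2/(2c) commutes
   with p and q, and on ker p one has e F = F e + h + 1/2. Hence, for a vector s
   killed by e and p with h s = l s,
     p q^(j+1) F^i s = c (j+1) q^j F^i s,
     e F^(i+1) s = (i+1) (l + 1/2 - i) F^i s,
   and the hypothesis on l says that no coefficient vanishes. So if p and e are
   locally nilpotent, an element killed by p^n can be corrected step by step to an
   element of ker p, and an element of ker p to one killed by e: every module in
   O[xi] is spanned by the q^j F^i s. No further singular vectors occur in such a
   span, because q p and F e act there with nonzero eigenvalues. This gives the
   simplicity of the Verma modules, the exactness of taking singular vectors, and
   the fact that a module whose singular vectors all have weight lam is a direct
   power of the Verma module of lam; these modules form the block of lam. A linear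
   map between lam-weight spaces is extended through the submodule of a product
   generated by its graph: it meets the second factor in a submodule without
   nonzero singular vectors, that is, in 0. *)
Require Import Defs.
From HB Require Import structures.
From mathcomp Require Import all_boot all_order all_algebra.
From mathcomp Require Import generic_quotient ring.
From mathcomp Require Import boolp classical_sets functions cardinality fsbigop.
From mathcomp Require Import reals.
From mathcomp.real_closed Require Import complex.

Set Implicit Arguments.
Unset Strict Implicit.
Unset Printing Implicit Defensive.

Import GRing.Theory.
Local Open Scope ring_scope.

(** * Categories and modules *)

(** [env] and [verma] are quotients of sets of terms, with no Poincare-Birkhoff-Witt basis at hand.
    Spanning statements follow from the relations alone. Linear independence of the [q^j F^i s] is
    never established; eigenvalue arguments take its place. That the highest weight vector is
    nonzero does need a lower bound, and this comes from an explicit module of coefficient families,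
    where [f] acts as [F - q^2/(2c)] and [e] as [E + p^2/(2c)], with [E] the raising operator of the
    sl_2 commuting with [p] and [q]. Finite generation is awkward to carry to submodules, so it is
    split off: [locally_O] keeps only the weights and the local nilpotency, and finite generation
    returns as finite dimension of a weight space. A block is defined by quantifying over all Serre
    classes. It is computed from both sides: the modules of O[xi] with all singular vectors of
    weight lam form a Serre class, and each of them is a finite power of the Verma module, hence an
    iterated extension. *)

Section Equivalence.
Variables (C D : category) (F : functor C D).
Hypothesis faithful : forall x y (f g : Defs.hom x y), fmap F f = fmap F g -> f = g.
Hypothesis full : forall x y (k : Defs.hom (F x) (F y)), exists f, fmap F f = k.
Hypothesis ess_surj : forall d, exists c (k : Defs.hom (F c) d), is_iso k.

(** The quasi-inverse is built by choice: it sends [k] to a lift of its conjugate by the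
    isomorphisms [i]. Faithfulness moves every identity to be checked in [C] to one in [D], where
    [j] cancels [i]. *)
Lemma ff_ess_surj_equivalence : is_equivalence F.
Proof.
pose G0 d := sval (cid (ess_surj d)).
pose i d : Defs.hom (F (G0 d)) d := sval (cid (svalP (cid (ess_surj d)))).
have iP d : is_iso (i d) := svalP (cid (svalP (cid (ess_surj d)))).
pose j d : Defs.hom d (F (G0 d)) := sval (cid (iP d)).
have jP d : cmp (j d) (i d) = idm _ /\ cmp (i d) (j d) = idm _ := svalP (cid (iP d)).
pose lift x y k : Defs.hom x y := sval (cid (@full x y k)).
have liftK x y k : fmap F (@lift x y k) = k := svalP (cid (full k)).
pose G1 d d' (k : Defs.hom d d') : Defs.hom (G0 d) (G0 d') := lift _ _ (cmp (j d') (cmp k (i d))).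
have G1_id d : G1 d d (idm d) = idm (G0 d).
  by apply: faithful; rewrite liftK fmap_id cmp_idl (jP d).1.
have G1_cmp x y z (f : Defs.hom y z) (g : Defs.hom x y) : G1 _ _ (cmp f g) = cmp (G1 _ _ f) (G1 _ _ g).
  apply: faithful; rewrite fmap_cmp !liftK -!cmpA; congr cmp; congr cmp.
  by rewrite !cmpA (jP y).2 cmp_idl.
exists (Functor G1_id G1_cmp); split.
  exists (fun x => lift (G0 (F x)) x (i (F x))); split=> [x|x y f].
    exists (lift _ _ (j (F x))); split; apply: faithful;
      by rewrite fmap_cmp !liftK fmap_id ?(jP _).1 ?(jP _).2.
  apply: faithful; rewrite /= !fmap_cmp !liftK.
  by rewrite cmpA (jP _).2 cmp_idl.
exists i; split=> // x y f /=.
by rewrite liftK cmpA (jP _).2 cmp_idl.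
Qed.
End Equivalence.

Lemma bij_is_iso (A : pzRingType) (M N : lmodType A) (f : {linear M -> N}) :
  bijective f -> @is_iso (modcat A) M N f.
Proof.
case=> g fK gK.
pose gL := GRing.isLinear.Build A N M *:%R g (can2_linear fK gK).
pose g' : {linear N -> M} := HB.pack g gL.
by exists g'; split; apply: linear_ext.
Qed.

Lemma inj_surj_bij (T T' : Type) (f : T -> T') :
  injective f -> (forall y, exists x, f x = y) -> bijective f.
Proof.
move=> fI fS; pose g y := sval (cid (fS y)).
have gK y : f (g y) = y := svalP (cid (fS y)).
by exists g => // x; apply: fI; rewrite gK.
Qed.

Section Submodules.
Variable A : pzRingType.

Definition is_submod (M : lmodType A) (P : M -> Prop) : Prop :=
  [/\ P 0, forall x y, P x -> P y -> P (x + y) & forall (a : A) x, P x -> P (a *: x)].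

Lemma submod_sum (M : lmodType A) (P : M -> Prop) (I : Type) (r : seq I) (F : I -> M) :
  is_submod P -> (forall i, P (F i)) -> P (\sum_(i <- r) F i).
Proof. by case=> P0 PD _ PF; elim/big_ind: _ => // i _; apply: PF. Qed.

Lemma submodB (M : lmodType A) (P : M -> Prop) x y :
  is_submod P -> P x -> P y -> P (x - y).
Proof. by case=> _ PD PZ Px Py; rewrite -scaleN1r; apply/PD/PZ. Qed.

Lemma ker_submod (M N : lmodType A) (f : {linear M -> N}) :
  is_submod (fun x => f x = 0).
Proof.
by split=> [|x y fx fy|a x fx]; rewrite ?linear0 ?linearD ?linearZ /= ?fx ?fy ?addr0 ?scaler0.
Qed.

(** Finite generation as an induction principle: later arguments name a submodule containing the
    generators and never handle coefficients. *)
Lemma fin_generatedP (M : lmodType A) : fin_generated M <->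
  exists g : seq M, forall P : M -> Prop, is_submod P ->
    (forall x, x \in g -> P x) -> forall v, P v.
Proof.
split=> [[n [g gP]]|[g gP]].
  exists [seq g i | i : 'I_n] => P Psub Pg v.
  have : [set: M]%classic v by [].
  rewrite gP => -[c ->]; apply: submod_sum => // i.
  by case: Psub => _ _; apply; apply: Pg; apply: codom_f.
exists (size g), (fun i => g`_i); rewrite eqEsubset; split=> // v _.
apply: gP v => [|x /(nthP 0)[i ilt <-]].
  split=> [|_ _ [c ->] [d ->]|a _ [c ->]].
  - by exists (fun=> 0); rewrite big1 // => i _; rewrite scale0r.
  - by exists (fun i => c i + d i); rewrite -big_split; apply: eq_bigr => i _; rewrite scalerDl.
  - by exists (fun i => a * c i); rewrite scaler_sumr; apply: eq_bigr => i _; rewrite scalerA.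
exists (fun j => (val j == i)%:R); rewrite (bigD1 (Ordinal ilt)) //= eqxx scale1r.
rewrite big1 ?addr0 // => j; rewrite -val_eqE /= => /negbTE ->; exact: scale0r.
Qed.

Lemma fin_generated_surj (M N : lmodType A) (f : {linear M -> N}) :
  (forall y, exists x, f x = y) -> fin_generated M -> fin_generated N.
Proof.
move=> fS /fin_generatedP[g gP]; apply/fin_generatedP; exists (map f g) => P [P0 PD PZ] Pg v.
have [x <-] := fS v; apply: (gP (fun x => P (f x))) => [|y yg].
  by split=> [|y z Py Pz|a y Py]; rewrite ?linear0 ?linearD ?linearZ //; [apply: PD | apply: PZ].
by apply/Pg/map_f.
Qed.

End Submodules.

Section SubModule.
Variables (A : pzRingType) (M : lmodType A) (P : M -> Prop) (Psub : is_submod P).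

(** The proof [Psub] is mentioned in the body so that the closure instance, which depends on it, can
    be attached to this predicate. *)
Definition submod_pred : {pred M} := let _ := Psub in [pred x | `[< P x >]].

Fact submod_pred_closed : submod_closed submod_pred.
Proof.
case: Psub => P0 PD PZ; split; first exact/asboolP.
by move=> a u v /asboolP Pu /asboolP Pv; apply/asboolP/PD => //; apply: PZ.
Qed.
HB.instance Definition _ :=
  GRing.isSubmodClosed.Build A M submod_pred submod_pred_closed.

Record submod := Submod { submod_val :> M; submod_valP : submod_val \in submod_pred }.
HB.instance Definition _ := [isSub for submod_val].
HB.instance Definition _ := [Choice of submod by <:].
HB.instance Definition _ := [SubChoice_isSubZmodule of submod by <:].
HB.instance Definition _ := [SubZmodule_isSubLmodule of submod by <:].

Lemma submodP (x : submod) : P (submod_val x).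
Proof. by case: x => x /= /asboolP. Qed.

Lemma submod_val_surj (x : M) : P x -> exists y : submod, submod_val y = x.
Proof. by move=> /asboolP Px; exists (Submod Px). Qed.

Lemma submod_val_linear : linear submod_val.
Proof. exact: (linearP (val : submod -> M)). Qed.
HB.instance Definition _ := GRing.isLinear.Build A submod M *:%R submod_val submod_val_linear.
End SubModule.

(** * Direct sums *)

Lemma finite_set_seq (I : Type) (A : set I) : finite_set A ->
  exists s : seq I, forall i, A i -> List.In i s.
Proof.
pose I' : choiceType := HB.pack I (gen_eqMixin I) (gen_choiceMixin I).
move=> /(@finite_seqP I')[s ->]; exists s => i; elim: s => // j s IHs.
by move=> /= /predU1P[->|/IHs]; [left | right].
Qed.

Lemma sum_subset (V : zmodType) (I : eqType) (r r' : seq I) (w : I -> V) :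
  uniq r -> uniq r' -> {subset r <= r'} -> (forall i, i \notin r -> w i = 0) ->
  \sum_(i <- r') w i = \sum_(i <- r) w i.
Proof.
move=> r_uniq r'_uniq rr' w0; rewrite (bigID (mem r)) /= [X in _ + X]big1 // addr0.
rewrite -big_filter; apply/perm_big/uniq_perm => //; first exact: filter_uniq.
by move=> i; rewrite mem_filter; case: (boolP (i \in r)) => //= /rr'.
Qed.

Section DirectSumTheory.
Variables (A : pzRingType) (I : Type) (M : I -> lmodType A).

(** The index type carries no decidable equality, so indices are compared classically and [x] is
    transported along the resulting equality. *)
Definition dsum_inj_fun (i : I) (x : M i) (j : I) : M j :=
  if pselect (i = j) is left e then ecast k (M k) e x else 0.

Lemma dsum_inj_fun_id i (x : M i) : dsum_inj_fun x i = x.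
Proof.
rewrite /dsum_inj_fun; case: pselect => // e.
by rewrite (Prop_irrelevance e erefl).
Qed.

Lemma dsum_inj_fun_neq i j (x : M i) : i <> j -> dsum_inj_fun x j = 0.
Proof. by rewrite /dsum_inj_fun; case: pselect. Qed.

Fact dsum_inj_fin i (x : M i) : finite_set [set j | dsum_inj_fun x j <> 0]%classic.
Proof.
apply: (sub_finite_set _ (finite_set1 i)) => j /= xj.
by apply: contrapT => ij; apply/xj/dsum_inj_fun_neq => /esym.
Qed.
Definition dsum_inj i (x : M i) : dsum M := DSum (dsum_inj_fin x).

Lemma dsum_inj_id i (x : M i) : dsum_inj x i = x.
Proof. exact: dsum_inj_fun_id. Qed.

Lemma dsum_inj_neq i j (x : M i) : i <> j -> dsum_inj x j = 0.
Proof. exact: dsum_inj_fun_neq. Qed.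

Fact dsum_inj_is_linear i : linear (@dsum_inj i).
Proof.
move=> a x y; apply: dsumP => j /=.
have [<-{j}|ij] := pselect (i = j); first by rewrite !dsum_inj_fun_id.
by rewrite !dsum_inj_fun_neq // scaler0 addr0.
Qed.
HB.instance Definition _ i :=
  GRing.isLinear.Build A (M i) (dsum M) *:%R (@dsum_inj i) (@dsum_inj_is_linear i).

Definition dsum_proj i (x : dsum M) : M i := x i.
Fact dsum_proj_is_linear i : linear (dsum_proj i).
Proof. by []. Qed.
HB.instance Definition _ i :=
  GRing.isLinear.Build A (dsum M) (M i) *:%R (dsum_proj i) (@dsum_proj_is_linear i).

Lemma dsum_addE (x y : dsum M) i : (x + y) i = x i + y i. Proof. by []. Qed.
Lemma dsum_oppE (x : dsum M) i : (- x) i = - x i. Proof. by []. Qed.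
Lemma dsum_scaleE a (x : dsum M) i : (a *: x) i = a *: x i. Proof. by []. Qed.
Lemma dsum_ind_inj (P : dsum M -> Prop) :
  P 0 -> (forall i x y, P y -> P (dsum_inj (x : M i) + y)) -> forall x, P x.
Proof.
move=> P0 PD x; have [s s_supp] := finite_set_seq (dsum_fin x).
have {s_supp} sP i : x i <> 0 -> List.In i s := s_supp i.
elim: s => [|i s IHs] in x sP *.
  suff -> : x = 0 by [].
  by apply: dsumP => i; apply: contrapT => /sP.
rewrite -[x](subrK (dsum_inj (x i))) addrC; apply/PD/IHs => j; rewrite dsum_addE dsum_oppE.
have [<-{j}|ij] := pselect (i = j); first by rewrite dsum_inj_id subrr.
by rewrite (dsum_inj_neq _ ij) subr0 => /sP[].
Qed.

Lemma dsum_supp (x : dsum M) : exists2 r : seq {classic I}, uniq r &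
  forall i : I, (i : {classic I}) \notin r -> x i = 0.
Proof.
have [r rP] := (@finite_seqP {classic I} _).1 (dsum_fin x).
exists (undup r) => [|i ir]; first exact: undup_uniq.
apply: contrapT => xi; move: ir; rewrite mem_undup => /negP; apply.
have : [set j | x j <> 0]%classic i by [].
by rewrite rP.
Qed.

(** The map is defined by a chosen support, but its formula holds for any list covering the support;
    additivity then compares two elements on a common list. *)
Lemma dsum_lift (N : lmodType A) (f : forall i, {linear M i -> N}) :
  exists g : {linear dsum M -> N}, forall (x : dsum M) (r : seq {classic I}), uniq r ->
    (forall i : I, (i : {classic I}) \notin r -> x i = 0) ->
    g x = \sum_(i <- r) f (i : I) (x (i : I)).
Proof.
pose supp x := s2val (cid2 (dsum_supp x)).
have supp_uniq x : uniq (supp x) := s2valP (cid2 (dsum_supp x)).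
have suppP x (i : I) : (i : {classic I}) \notin supp x -> x i = 0 :=
  s2valP' (cid2 (dsum_supp x)) i.
pose g x := \sum_(i <- supp x) f (i : I) (x (i : I)).
have gE (x : dsum M) (r : seq {classic I}) : uniq r ->
    (forall i : I, (i : {classic I}) \notin r -> x i = 0) ->
    g x = \sum_(i <- r) f (i : I) (x (i : I)).
  move=> r_uniq rP; rewrite /g; transitivity (\sum_(i <- undup (supp x ++ r)) f (i : I) (x (i : I))).
    apply/esym/(sum_subset (supp_uniq x) (undup_uniq _)) => i.
      by rewrite mem_undup mem_cat => ->.
    by move=> /suppP ->; rewrite linear0.
  apply: (sum_subset r_uniq (undup_uniq _)) => i.
    by rewrite mem_undup mem_cat => ->; rewrite orbT.
  by move=> /rP ->; rewrite linear0.
have g_linear : linear g.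
  move=> a x y; pose r := undup (supp x ++ supp y).
  have r_uniq : uniq r by apply: undup_uniq.
  have rx (i : I) : (i : {classic I}) \notin r -> x i = 0.
    by rewrite mem_undup mem_cat negb_or => /andP[/suppP].
  have ry (i : I) : (i : {classic I}) \notin r -> y i = 0.
    by rewrite mem_undup mem_cat negb_or => /andP[_ /suppP].
  rewrite (gE x r) // (gE y r) // (gE _ r) // => [|i ir]; last first.
    by rewrite dsum_addE dsum_scaleE rx // ry // scaler0 addr0.
  by rewrite scaler_sumr -big_split; apply: eq_bigr => i _; exact: linearP.
by exists (HB.pack_for {linear dsum M -> N} g (GRing.isLinear.Build A (dsum M) N *:%R g g_linear)).
Qed.

Lemma dsum_fgen : finite_set [set i | exists x : M i, x <> 0]%classic ->
  (forall i, fin_generated (M i)) -> fin_generated (dsum M).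
Proof.
move=> /finite_set_seq[s sP] Mfg; apply/fin_generatedP.
have [g gP] : exists g : forall i, seq (M i), forall i (P : M i -> Prop),
    is_submod P -> (forall x, x \in g i -> P x) -> forall v, P v.
  exists (fun i => sval (cid ((fin_generatedP (M i)).1 (Mfg i)))) => i.
  exact: svalP (cid ((fin_generatedP (M i)).1 (Mfg i))).
exists (flatten [seq [seq dsum_inj x | x <- g i] | i <- s]) => P Psub Pg.
have Pinj i x : P (dsum_inj (x : M i)).
  have [->|x0] := pselect (x = 0); first by rewrite linear0; case: Psub.
  apply: (gP i (fun x => P (dsum_inj x))) => [|y yg].
    case: Psub => P0 PD PZ.
    by split=> [|u v Pu Pv|a u Pu]; rewrite ?linear0 ?linearD ?linearZ //;
      [apply: PD | apply: PZ].
  apply: Pg; have : List.In i s by apply: sP; exists x.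
  elim: (s) => //= j s' IH [->|/IH]; rewrite mem_cat; last by move=> ->; rewrite orbT.
  by rewrite map_f.
apply: dsum_ind_inj => [|i x y Py]; first by case: Psub.
by case: Psub => _ PD _; apply: PD.
Qed.
End DirectSumTheory.

Lemma dsum_map_inj (A : pzRingType) (I : Type) (M N : I -> lmodType A)
    (f g : forall i, {linear M i -> N i}) :
  dsum_map f =1 dsum_map g -> forall i, f i =1 g i.
Proof.
move=> fg i x; have /(congr1 (@dsum_proj _ _ N i)) := fg (dsum_inj x).
by rewrite /dsum_proj /= dsum_inj_fun_id.
Qed.

(** * Singular vectors and lowering operators *)

Section AdditiveSpan.
Variable V : zmodType.

(** Closure under sums only. The generating sets in use need no separate scalar clause, and the same
    notion serves K-spaces and U-modules. *)
Inductive aspan (T : V -> Prop) : V -> Prop :=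
  | aspan_gen x of T x : aspan T x
  | aspan0 : aspan T 0
  | aspanD x y of aspan T x & aspan T y : aspan T (x + y).

Lemma aspan_mono (T T' : V -> Prop) :
  (forall x, T x -> T' x) -> forall x, aspan T x -> aspan T' x.
Proof.
move=> TT' x; elim=> [y /TT' Ty||y z _ Ty _ Tz]; first exact: aspan_gen.
  exact: aspan0.
exact: aspanD.
Qed.
End AdditiveSpan.

Lemma aspan_map (V W : zmodType) (g : V -> W) (T : V -> Prop) (T' : W -> Prop) :
  g 0 = 0 -> {morph g : x y / x + y} ->
  (forall x, T x -> aspan T' (g x)) -> forall x, aspan T x -> aspan T' (g x).
Proof.
move=> g0 gD TT' x; elim=> [y /TT' //||y z _ Ty _ Tz]; first by rewrite g0; apply: aspan0.
by rewrite gD; apply: aspanD.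
Qed.

Section LocallyNilpotent.
Variables (K : pzRingType) (V : lmodType K) (T : {linear V -> V}).

Lemma lin_iterZ n a x : iter n T (a *: x) = a *: iter n T x.
Proof. by elim: n => //= n ->; rewrite linearZ. Qed.

Lemma lin_iter0 n : iter n T 0 = 0.
Proof. by elim: n => //= n ->; rewrite linear0. Qed.

Lemma lin_iterD n x y : iter n T (x + y) = iter n T x + iter n T y.
Proof. by elim: n => //= n ->; rewrite linearD. Qed.

Lemma iter_eq0 n m x : (n <= m)%N -> iter n T x = 0 -> iter m T x = 0.
Proof. by move=> /subnK <- xn; rewrite iterD xn lin_iter0. Qed.

Definition nilp_at x := exists n, iter n T x = 0.

Lemma nilpD x y : nilp_at x -> nilp_at y -> nilp_at (x + y).
Proof.
move=> [m xm] [n yn]; exists (maxn m n); rewrite lin_iterD.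
by rewrite (iter_eq0 (leq_maxl _ _) xm) (iter_eq0 (leq_maxr _ _) yn) addr0.
Qed.

Lemma nilp_kernel (W : V -> Prop) x : (forall y, W y -> W (T y)) ->
  nilp_at x -> W x -> x <> 0 -> exists n, [/\ W (iter n T x), iter n T x <> 0 & T (iter n T x) = 0].
Proof.
move=> WT xN Wx x0; have ex : exists n, iter n T x == 0.
  by case: xN => n /eqP; exists n.
case: (ex_minnP ex) => -[|n] /eqP xn n_min; first by case: x0.
exists n; split=> //; last by move=> /eqP /n_min; rewrite ltnn.
by elim: n {xn n_min} => //= n; apply: WT.
Qed.
End LocallyNilpotent.

Section Eigenvectors.
Variables (K : fieldType) (V : lmodType K) (T : {linear V -> V}).

(** The product of the commuting operators [T - b], for [b] in [bs]. *)
Let op bs y := foldr (fun b z => T z - b *: z) y bs.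

Let opD bs x y : op bs (x + y) = op bs x + op bs y.
Proof.
elim: bs => //= b bs ->; by rewrite linearD scalerDr opprD addrACA.
Qed.

Let opZ bs a x : op bs (a *: x) = a *: op bs x.
Proof.
by elim: bs => //= b bs ->; rewrite linearZ scalerBr !scalerA mulrC.
Qed.

Let op0 bs : op bs 0 = 0.
Proof. by have := opZ bs 0 0; rewrite !scale0r. Qed.

Let op1C bs b x : op bs (T x - b *: x) = T (op bs x) - b *: op bs x.
Proof.
elim: bs => //= a bs ->; set y := op bs x.
rewrite !(linearB T) !(linearZ_LR T) /= !scalerBr !scalerA mulrC !opprB -!addrA. congr (_ + _).
by rewrite addrCA [RHS]addrCA; congr (_ + _); rewrite addrC.
Qed.

Let opC bs bs' x : op bs (op bs' x) = op bs' (op bs x).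
Proof. by elim: bs' => //= b bs' IH; rewrite op1C IH. Qed.

(** A sum of eigenvectors with nonzero eigenvalues is killed by a product of factors [T - b] with
    [b != 0]. On the kernel of [T] each factor is the invertible scalar [- b]. *)
Lemma eigen_sum_ker x :
  aspan (fun y => exists2 b, b != 0 & T y = b *: y) x -> T x = 0 -> x = 0.
Proof.
move=> xS Tx; have [bs bs0 bsx] : exists2 bs, all (fun b => b != 0) bs & op bs x = 0.
  have op_cat u v w : op (u ++ v) w = op u (op v w) by rewrite /op foldr_cat.
  elim: xS => [y [b b0 yb]||y z _ [b b0 yb] _ [b' b'0 zb']].
  - by exists [:: b]; rewrite /= ?b0 // yb subrr.
  - by exists [::].
  exists (b ++ b'); first by rewrite all_cat b0.
  by rewrite opD !op_cat zb' op0 addr0 opC yb op0.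
elim: bs bs0 bsx => //= b bs IH /andP[b0 bs0].
have -> : T (op bs x) = 0.
  (* At the value 0, [op1C] says that [T] commutes with [op bs]. *)
  by have := op1C bs 0 x; rewrite !scale0r !subr0 Tx op0 => <-.
rewrite sub0r => /eqP; rewrite oppr_eq0 scaler_eq0 (negPf b0) => /eqP; exact: IH.
Qed.
End Eigenvectors.

(** * Representations of central charge c and the operator F *)

Record schroedinger_rep (K : fieldType) (V : lmodType K) (c : K)
    (e f h p q : {linear V -> V}) : Prop := SchroedingerRep {
  rep_pq : forall x, p (q x) = q (p x) + c *: x;
  rep_eq : forall x, e (q x) = q (e x) + p x;
  rep_ep : forall x, e (p x) = p (e x);
  rep_hq : forall x, h (q x) = q (h x) - q x;
  rep_hf : forall x, h (f x) = f (h x) - 2%:R *: f x;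
  rep_ef : forall x, e (f x) = f (e x) + h x;
  rep_fp : forall x, f (p x) = p (f x) + q x;
  rep_fq : forall x, f (q x) = q (f x) }.

Section Representation.
Variables (K : fieldType) (V : lmodType K) (c : K) (e f h p q : {linear V -> V}).

(* With central charge [c], subtracting from sl_2 its oscillator realization in
   p and q gives an sl_2 commuting with p and q; [lowF] is its lowering operator. *)
Definition lowF (x : V) : V := f x + (2%:R * c)^-1 *: q (q x).
Fact lowF_linear : linear lowF.
Proof.
move=> a x y; rewrite /lowF !linearP scalerDr addrACA; congr (_ + _).
Qed.
HB.instance Definition _ := GRing.isLinear.Build K V V *:%R lowF lowF_linear.

Hypothesis pchar0 : forall n, n.+1%:R != 0 :> K.
Hypothesis c_neq0 : c != 0.
Hypothesis rep : schroedinger_rep c e f h p q.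

Let pqE := rep_pq rep.
Let eqE := rep_eq rep.
Let epE := rep_ep rep.
Let hqE := rep_hq rep.
Let hfE := rep_hf rep.
Let efE := rep_ef rep.
Let fpE := rep_fp rep.
Let fqE := rep_fq rep.
Let F : {linear V -> V} := lowF.

Lemma half_c : (2%:R * c)^-1 * c + (2%:R * c)^-1 * c = 1.
Proof. by have two0 := pchar0 1; field; rewrite two0 c_neq0. Qed.

Lemma qFE x : q (F x) = F (q x).
Proof. by rewrite /F /= /lowF linearD linearZ fqE. Qed.

(** Moving [p] past [q (q x)] yields [c *: q x] twice. Weighted by [1/(2c)] they add up to [q x],
    which cancels the bracket [[f,p] = q]; this fixes the constant in [lowF]. *)
Lemma pFE x : p (F x) = F (p x).
Proof.
rewrite /F /= /lowF linearD linearZ /= fpE -addrA; congr (_ + _).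
rewrite !(pqE, linearD, linearZ) /= -addrA -scalerDr scalerDr [q x + _]addrC; congr (_ + _).
by rewrite !scalerA ![c * _]mulrC -scalerDl half_c scale1r.
Qed.

Lemma hFE x : h (F x) = F (h x) - 2%:R *: F x.
Proof.
rewrite /F /= /lowF linearD linearZ /= hfE !hqE (linearB q) !scalerBr.
rewrite [in RHS]scalerDr [2%:R *: (_ *: _)]scaler_nat mulr2n !opprD.
by rewrite -[X in _ + X = _]addrA addrACA.
Qed.

(** The half comes from [e q q x = q q e x + c x], valid on the kernel of [p], weighted by
    [1/(2c)]. *)
Lemma eFE x : p x = 0 -> e (F x) = F (e x) + h x + 2%:R^-1 *: x.
Proof.
move=> px; rewrite /F /= /lowF linearD linearZ /= efE !eqE px addr0 pqE px linear0 add0r.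
rewrite scalerDr addrACA scalerA -!addrA; congr (_ + (_ + (_ + _ *: _))).
by have two0 := pchar0 1; field; rewrite two0 c_neq0.
Qed.

Definition singular (x : V) : Prop := p x = 0 /\ e x = 0.

(** For the sl_2 commuting with [p] and [q], a singular vector of [h]-weight [l] has highest weight
    [l + 1/2]. The condition is the classical one for simplicity of the sl_2 Verma module: this
    weight is not a natural number. *)
Definition generic (l : K) : Prop := forall i : nat, l + 2%:R^-1 - i%:R != 0.

Definition fspan_gen (S : V -> Prop) (x : V) : Prop :=
  exists i s, S s /\ x = iter i F s.
Definition qspan_gen (S : V -> Prop) (x : V) : Prop :=
  exists j i s, S s /\ x = iter j q (iter i F s).
Definition low_span (S : V -> Prop) : V -> Prop := aspan (qspan_gen S).

Lemma p_iterF i x : p x = 0 -> p (iter i F x) = 0.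
Proof. by move=> px; elim: i => //= i IH; rewrite pFE IH linear0. Qed.

Lemma p_iterq j x : p x = 0 -> p (iter j.+1 q x) = (c * j.+1%:R) *: iter j q x.
Proof.
move=> px; elim: j => [|j IH]; first by rewrite /= pqE px linear0 add0r mulr1.
by rewrite iterS pqE IH linearZ /= -scalerDl -[in RHS]natr1 mulrDr mulr1.
Qed.

Lemma h_iterF i l x : h x = l *: x -> h (iter i F x) = (l - (2 * i)%:R) *: iter i F x.
Proof.
move=> hx; elim: i => [|i IH]; first by rewrite subr0.
rewrite iterS hFE IH linearZ /= -scalerBl; congr (_ *: _).
by rewrite mulnS natrD; ring.
Qed.

Lemma h_iterq j l x : h x = l *: x -> h (iter j q x) = (l - j%:R) *: iter j q x.
Proof.
move=> hx; elim: j => [|j IH]; first by rewrite subr0.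
by rewrite iterS hqE IH linearZ -[X in _ - X]scale1r -scalerBl /= -natr1 opprD addrA.
Qed.

Lemma e_iterF i l x : singular x -> h x = l *: x ->
  e (iter i.+1 F x) = (i.+1%:R * (l + 2%:R^-1 - i%:R)) *: iter i F x.
Proof.
move=> [px ex] hx; elim: i => [|i IH].
  by rewrite /= eFE // ex linear0 add0r hx -scalerDl mul1r subr0.
rewrite iterS eFE; last exact: p_iterF.
rewrite IH linearZ (h_iterF _ hx) -!scalerDl; congr (_ *: _).
by rewrite natrM -[i.+2%:R]natr1 -[i.+1%:R]natr1; have two0 := pchar0 1; field.
Qed.

Section Span.
Variable S : V -> Prop.
Hypothesis S_sing : forall s, S s -> singular s.
Hypothesis S_wt : forall s, S s -> exists2 l, h s = l *: s & generic l.

Lemma fspan_p x : aspan (fspan_gen S) x -> p x = 0.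
Proof.
elim=> [_ [i [s [/S_sing[ps _] ->]]]||y z _ py _ pz]; first exact: p_iterF.
  exact: linear0.
by rewrite linearD py pz addr0.
Qed.

Section Scaled.
Hypothesis S_scale : forall a s, S s -> S (a *: s).

Lemma low_spanZ a x : low_span S x -> low_span S (a *: x).
Proof.
apply: (aspan_map (scaler0 _ a) (scalerDr a)) => _ [j [i [s [Ss ->]]]].
apply: aspan_gen; exists j, i, (a *: s); split; first exact: S_scale.
by rewrite !lin_iterZ.
Qed.

Lemma low_spanq x : low_span S x -> low_span S (q x).
Proof.
apply: (aspan_map (linear0 q) (linearD q)) => _ [j [i [s [Ss ->]]]].
by apply: aspan_gen; exists j.+1, i, s.
Qed.

Lemma low_spanF x : low_span S x -> low_span S (F x).
Proof.
apply: (aspan_map (linear0 F) (linearD F)) => _ [j [i [s [Ss ->]]]].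
apply: aspan_gen; exists j, i.+1, s; split=> //.
by elim: j => //= j <-; rewrite qFE.
Qed.

Lemma low_spanp x : low_span S x -> low_span S (p x).
Proof.
apply: (aspan_map (linear0 p) (linearD p)) => _ [j [i [s [Ss ->]]]].
have pF : p (iter i F s) = 0 by apply: p_iterF; case: (S_sing Ss).
case: j => [|j]; first by rewrite /= pF; apply: aspan0.
by rewrite p_iterq //; apply/low_spanZ/aspan_gen; exists j, i, s.
Qed.

Lemma low_spanh x : low_span S x -> low_span S (h x).
Proof.
apply: (aspan_map (linear0 h) (linearD h)) => _ [j [i [s [Ss ->]]]]; have [l hs _] := S_wt Ss.
by rewrite (h_iterq _ (h_iterF _ hs)); apply/low_spanZ/aspan_gen; exists j, i, s.
Qed.

Lemma low_spane x : low_span S x -> low_span S (e x).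
Proof.
apply: (aspan_map (linear0 e) (linearD e)) => _ [j [i [s [Ss ->]]]]; have [l hs _] := S_wt Ss.
elim: j => [|j IH]; last first.
  rewrite iterS eqE; apply: aspanD; first exact: low_spanq.
  by apply/low_spanp/aspan_gen; exists j, i, s.
case: i => [|i]; first by rewrite /= (S_sing Ss).2; apply: aspan0.
rewrite [iter 0 _ _]/= (e_iterF _ (S_sing Ss) hs).
by apply/low_spanZ/aspan_gen; exists 0%N, i, s.
Qed.

Lemma low_spanf x : low_span S x -> low_span S (f x).
Proof.
move=> Sx; have -> : f x = F x + (- (2%:R * c)^-1) *: q (q x).
  by rewrite /F /= /lowF scaleNr addrK.
by apply: aspanD; [apply: low_spanF | apply/low_spanZ/low_spanq/low_spanq].
Qed.

End Scaled.

Lemma low_span_nilp_p x : low_span S x -> nilp_at p x.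
Proof.
elim=> [_ [j [i [s [Ss ->]]]]||y z _ ? _ ?]; last exact: nilpD.
  have pF : p (iter i F s) = 0 by apply: p_iterF; case: (S_sing Ss).
  exists j.+1; elim: j => [//|j IH].
  by rewrite iterSr p_iterq // lin_iterZ IH scaler0.
by exists 0%N.
Qed.

Lemma low_span_nilp_e x : low_span S x -> nilp_at e x.
Proof.
elim=> [_ [j [i [s [Ss ->]]]]||y z _ ? _ ?]; last exact: nilpD.
  have [l hs _] := S_wt Ss; elim: j => [|j [n IH]].
    exists i.+1; elim: i => [|i IH]; first by case: (S_sing Ss).
    by rewrite iterSr [iter 0 _ _]/= (e_iterF _ (S_sing Ss) hs) lin_iterZ IH scaler0.
  have epC m y : iter m e (p y) = p (iter m e y) by elim: m => //= m ->; rewrite epE.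
  (* Since [[e,q] = p] commutes with [e], each factor [q] costs one extra power of [e]. The value of
     [m.-1] at [m = 0] is irrelevant because its coefficient is 0. *)
  have eqC m y : iter m e (q y) = q (iter m e y) + m%:R *: p (iter m.-1 e y).
    elim: m => [|m IHm]; first by rewrite scale0r addr0.
    rewrite iterS IHm linearD linearZ /= eqE epE -addrA; congr (_ + _).
    by case: m {IHm} => [|m]; rewrite ?scale0r ?addr0 ?scale1r // -[m.+2]add1n natrD scalerDl scale1r.
  by exists n.+1; rewrite [iter j.+1 _ _]/= eqC /= IH !linear0 addr0.
by exists 0%N.
Qed.

Section Generation.
Hypothesis S_scale : forall a s, S s -> S (a *: s).
Hypothesis sing_S : forall x, singular x -> aspan S x.

Lemma fspan_eS x : aspan (fspan_gen S) x -> exists2 y, aspan (fspan_gen S) y & e y = x.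
Proof.
elim=> [_ [i [s [Ss ->]]]||y z _ [y' Sy <-] _ [z' Sz <-]].
- have [l hs gl] := S_wt Ss; pose a := i.+1%:R * (l + 2%:R^-1 - i%:R).
  exists (iter i.+1 F (a^-1 *: s)).
    by apply: aspan_gen; exists i.+1, (a^-1 *: s); split=> //; apply: S_scale.
  by rewrite lin_iterZ linearZ /= (e_iterF _ (S_sing Ss) hs) -/a scalerK // mulf_neq0.
- by exists 0; [apply: aspan0 | rewrite linear0].
- by exists (y' + z'); [apply: aspanD | rewrite linearD].
Qed.

(** Induction on the nilpotency degree. [e x] is in the span and in the kernel of [p], so
    [e x = e y] for some [y] in the span ([fspan_eS]), and [x - y] is singular. *)
Lemma ker_p_fspan x : p x = 0 -> nilp_at e x -> aspan (fspan_gen S) x.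
Proof.
move=> px [n]; elim: n x px => [|n IH] x px; first by move=> /= ->; apply: aspan0.
rewrite iterSr => /IH; rewrite -epE px linear0 => /(_ erefl) /fspan_eS[y Sy ey].
rewrite -[x](subrK y); apply: aspanD => //.
apply: aspan_mono (sing_S _) => [s Ss|]; first by exists 0%N, s.
by split; rewrite linearB ?ey ?subrr // px (fspan_p Sy) subrr.
Qed.

Hypothesis nilp_e : forall x, nilp_at e x.
Hypothesis nilp_p : forall x, nilp_at p x.

Lemma low_span_pS x : low_span S x -> exists2 y, low_span S y & p y = x.
Proof.
elim=> [_ [j [i [s [Ss ->]]]]||y z _ [y' Sy <-] _ [z' Sz <-]].
- exists ((c * j.+1%:R)^-1 *: iter j.+1 q (iter i F s)).
    by apply: low_spanZ => //; apply: aspan_gen; exists j.+1, i, s.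
  have ps : p (iter i F s) = 0 by apply: p_iterF; case: (S_sing Ss).
  by rewrite linearZ /= p_iterq // scalerK // mulf_neq0.
- by exists 0; [apply: aspan0 | rewrite linear0].
- by exists (y' + z'); [apply: aspanD | rewrite linearD].
Qed.

Lemma low_span_full x : low_span S x.
Proof.
have [n] := nilp_p x; elim: n x => [|n IH] x; first by move=> /= ->; apply: aspan0.
rewrite iterSr => /IH /low_span_pS[y Sy py].
rewrite -[x](subrK y); apply: aspanD => //.
apply: aspan_mono (ker_p_fspan _ (nilp_e _)) => [_ [i [s [Ss ->]]]|].
  by exists 0%N, i, s.
by rewrite linearB py subrr.
Qed.

Lemma p_surj x : exists y, p y = x.
Proof. by have [y _ yx] := low_span_pS (low_span_full x); exists y. Qed.

Lemma e_surj_ker x : p x = 0 -> exists2 y, p y = 0 & e y = x.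
Proof.
move=> px; have [y Sy ey] := fspan_eS (ker_p_fspan px (nilp_e x)).
by exists y; rewrite ?(fspan_p Sy).
Qed.
End Generation.
End Span.

(** Take the last nonzero iterate of [p] at [x], then the last nonzero iterate of [e] at that
    vector; [e] preserves the kernel of [p]. *)
Lemma singular_in_submod (W : V -> Prop) x :
  (forall y, W y -> W (p y)) -> (forall y, W y -> W (e y)) ->
  (forall y, nilp_at e y) -> (forall y, nilp_at p y) ->
  W x -> x <> 0 -> exists y, [/\ W y, y <> 0 & singular y].
Proof.
move=> Wp We eN pN Wx x0; have [n [Wy y0 py]] := nilp_kernel Wp (pN x) Wx x0.
have [m [[Wz pz] z0 ez]] : exists m, [/\ W (iter m e (iter n p x)) /\ p (iter m e (iter n p x)) = 0,
    iter m e (iter n p x) <> 0 & e (iter m e (iter n p x)) = 0].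
  apply: (nilp_kernel (W := fun y => W y /\ p y = 0)) => // y [Wy' py'].
  by split; [apply: We | rewrite -epE py' linear0].
by exists (iter m e (iter n p x)).
Qed.

Section Subspace.
Variables (S : V -> Prop) (l : K).
Hypothesis l_generic : generic l.
Hypothesis S_sing : forall s, S s -> singular s.
Hypothesis S_wt : forall s, S s -> h s = l *: s.
Hypotheses (S0 : S 0) (S_add : forall x y, S x -> S y -> S (x + y)).

Let S_gen s : S s -> exists2 l, h s = l *: s & generic l.
Proof. by exists l => //; apply: S_wt. Qed.

Definition fspan_pos x := exists i s, S s /\ x = iter i.+1 F s.
Definition qspan_pos x := exists j i s, S s /\ x = iter j.+1 q (iter i F s).

(** The pieces are sorted by the operator that detects them: [q p] has nonzero eigenvalues on the
    last and kills the first two; [F e] has nonzero eigenvalues on the second and kills the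
    first. *)
Lemma low_span_split x : low_span S x ->
  exists s y z, [/\ S s, aspan fspan_pos y, aspan qspan_pos z & x = s + y + z].
Proof.
elim=> [_ [j [i [s [Ss ->]]]]||_ _ _ [s [y [z [Ss Sy Sz ->]]]] _ [s' [y' [z' [Ss' Sy' Sz' ->]]]]].
- case: j => [|j]; [case: i => [|i]|].
  + by exists s, 0, 0; split=> //; rewrite ?addr0 //; apply: aspan0.
  + exists 0, (iter i.+1 F s), 0; split=> //; try exact: aspan0.
      by apply: aspan_gen; exists i, s.
    by rewrite add0r addr0.
  + exists 0, 0, (iter j.+1 q (iter i F s)); split=> //; try exact: aspan0.
      by apply: aspan_gen; exists j, i, s.
    by rewrite !add0r.
- by exists 0, 0, 0; split; rewrite ?addr0 //; apply: aspan0.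
exists (s + s'), (y + y'), (z + z'); split; try exact: aspanD; first exact: S_add.
by rewrite addrACA [s + y + _]addrACA.
Qed.

Lemma fspan_pos_p y : aspan fspan_pos y -> p y = 0.
Proof.
move=> Sy; apply: (fspan_p S_sing); apply: aspan_mono Sy => _ [i [s [Ss ->]]].
by exists i.+1, s.
Qed.

(** The part with factors [q] is removed first, by means of [q p]; on what remains, the vectors
    [F^i s] are eigenvectors of [F e]. *)
Lemma low_span_singular x : low_span S x -> singular x -> S x.
Proof.
move=> /low_span_split[s [y [z [Ss Sy Sz ->]]]] [px ex].
have [[ps es] py] := (S_sing Ss, fspan_pos_p Sy).
have z0 : z = 0.
  apply: (@eigen_sum_ker _ _ (q \o p)); last first.
    by move: px; rewrite /= !linearD /= ps py !add0r => ->; rewrite linear0.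
  apply: aspan_mono Sz => _ [j [i [t [St ->]]]]; exists (c * j.+1%:R).
    by rewrite mulf_neq0.
  by rewrite [LHS]/= p_iterq ?linearZ //; apply: p_iterF; case: (S_sing St).
suff y0 : y = 0 by rewrite z0 y0 !addr0.
apply: (@eigen_sum_ker _ _ (F \o e)); last first.
  by move: ex; rewrite z0 addr0 /= linearD /= es add0r => ->; rewrite linear0.
apply: aspan_mono Sy => _ [i [t [St ->]]].
exists (i.+1%:R * (l + 2%:R^-1 - i%:R)); first by rewrite mulf_neq0.
by rewrite [LHS]/= (e_iterF _ (S_sing St) (S_wt St)) linearZ.
Qed.

(** [h - l] acts on [q^j F^i s] by [- (j + 2 i)], which vanishes only for [i = j = 0]. *)
Lemma low_span_weight x : low_span S x -> h x = l *: x -> S x.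
Proof.
move=> /low_span_split[s [y [z [Ss Sy Sz ->]]]] hx.
suff yz0 : y + z = 0 by rewrite -addrA yz0 addr0.
apply: (@eigen_sum_ker _ _ (h \- l \*: idfun)); last first.
  apply: (addrI (h s - l *: s)); rewrite addr0 [in RHS]S_wt // subrr.
  rewrite [_ (y + z)]/= addrACA -opprD -scalerDr -linearD addrA /=.
  by rewrite hx subrr.
have eigen_h i j s' : S s' -> exists2 b : K, b = - (j + 2 * i)%:R &
    (h \- l \*: idfun) (iter j q (iter i F s')) = b *: iter j q (iter i F s').
  move=> Ss'; exists (- (j + 2 * i)%:R) => //=.
  rewrite (h_iterq _ (h_iterF _ (S_wt Ss'))) -scalerBl; congr (_ *: _).
  by rewrite natrD; ring.
apply: aspanD; [apply: aspan_mono Sy | apply: aspan_mono Sz].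
  move=> _ [i [t [St ->]]]; have [b b_def] := eigen_h i.+1 0%N _ St.
  by exists b => //; rewrite b_def oppr_eq0 mulnS; apply: pchar0.
move=> _ [j [i [t [St ->]]]]; have [b b_def] := eigen_h i j.+1 _ St.
by exists b => //; rewrite b_def oppr_eq0; apply: pchar0.
Qed.
End Subspace.
End Representation.

(** * Weights *)

Section Weights.
Variable K : fieldType.
Local Notation s := (schroedinger K).
Local Notation U := (env s).
Local Notation hdual := (hdual K).
Local Notation elh := (elh K).
Local Notation elz := (elz K).

Definition gen (i : sbasis) : U := env_gen (sbv K i : s).

Lemma sbv_lie i j : lie (sbv K i : s) (sbv K j) = brk K i j - brk K j i.
Proof.
apply/ffunP => k; rewrite [LHS]slieE !ffunE.
by case: i; case: j; case: k; rewrite /= !ffunE !sbasis_eqE /= /GRing.scale /=; ring.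
Qed.

Lemma gen_comm i j : gen i * gen j = gen j * gen i + env_gen (brk K i j - brk K j i).
Proof. by rewrite -sbv_lie env_gen_lie addrC subrK. Qed.

Lemma sbvE (x : s) : x = \sum_i (x i : K) *: sbv K i.
Proof.
apply/ffunP => k; rewrite sum_ffunE (bigD1 k) //= !ffunE eqxx big1 => [|i ik].
  by rewrite addr0 [RHS]mulr1.
by rewrite !ffunE (negPf ik); apply: mulr0.
Qed.

Lemma hhE (H : subvs_of (hh K)) :
  H = ((vsval H : s) Bh : K) *: elh + ((vsval H : s) Bz : K) *: elz.
Proof.
apply: val_inj; case: H => /= _ /memv_addP[_ /vlineP[a ->] [_ /vlineP[b ->] ->]].
by rewrite !ffunE !sbasis_eqE /= /GRing.scale /= !mulr1 !mulr0 addr0 add0r.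
Qed.

Lemma hdual_eq (lam mu : hdual) : lam elh = mu elh -> lam elz = mu elz -> lam = mu.
Proof.
by move=> h z; apply/lfunP => H; rewrite (hhE H) !linearP /= !linearZ /= h z.
Qed.

Lemma hvee_mulnE n : ((hvee K *+ n) elh = n%:R) * ((hvee K *+ n) elz = 0).
Proof.
have [hh1 hz0 _ _] := dual_basis K.
split; elim: n => [|n IH]; rewrite ?mulr0n ?lfunE //= mulrS add_lfunE IH ?hh1 ?hz0 ?addr0 //.
by rewrite -natr1 addrC.
Qed.

Section Module.
Variable M : lmodType U.

Definition act (i : sbasis) (x : kvect M) : kvect M := gen i *: (x : M).

Lemma kvect_scaleE (a : K) (x : kvect M) : a *: x = a%:A *: (x : M). Proof. by []. Qed.

Fact act_is_linear i : linear (act i).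
Proof.
move=> a x y; rewrite /act scalerDr; congr (_ + _).
by rewrite !kvect_scaleE !scalerA mulr_algr mulr_algl.
Qed.
HB.instance Definition _ i :=
  GRing.isLinear.Build K (kvect M) (kvect M) *:%R (act i) (act_is_linear i).

Lemma act_gen (l : s) (x : M) : env_gen l *: x = \sum_i (l i : K) *: act i x.
Proof.
rewrite {1}[l]sbvE linear_sum scaler_suml; apply: eq_bigr => i _.
by rewrite linearZ kvect_scaleE /act scalerA mulr_algl.
Qed.

Lemma act_comm i j x : act i (act j x) = act j (act i x) +
  (env_gen (brk K i j - brk K j i) *: (x : M)).
Proof. by rewrite /act scalerA gen_comm scalerDl -scalerA. Qed.

Lemma is_submod_gen (P : M -> Prop) : P 0 -> (forall x y, P x -> P y -> P (x + y)) ->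
  (forall (a : K) (x : kvect M), P x -> P (a *: x)) -> (forall i x, P x -> P (act i x)) ->
  is_submod P.
Proof.
move=> P0 PD PZ Pact; split=> // u x Px; elim/env_ind: u => t.
elim: t x Px => [l|a|t IHt t' IHt'|t IHt t' IHt'] x Px.
- rewrite -/(env_gen l) act_gen.
  by elim/big_ind: _ => // i _; apply: (PZ (l i)); apply: Pact.
- by rewrite -/(env_scal _ a) -env_algE; apply: PZ.
- by rewrite pi_envD scalerDl; apply: PD; auto.
by rewrite pi_envM -scalerA; auto.
Qed.

Lemma is_weightP lam (x : kvect M) :
  is_weight lam (x : M) <-> act Bh x = lam elh *: x /\ act Bz x = lam elz *: x.
Proof.
split=> [wx|[hx zx] H]; first by split; [apply: (wx elh) | apply: (wx elz)].
rewrite act_gen big_sbasis hx zx -kvect_scaleE.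
rewrite [in RHS](hhE H) (linearP lam) (linearZ_LR lam) /=.
have -> : vsval H = (vsval H : s) Bh *: sbv K Bh + (vsval H : s) Bz *: sbv K Bz.
  by rewrite {1}(hhE H).
move: ((vsval H : s) Bh) ((vsval H : s) Bz) => a b.
have cE i : ((a *: sbv K Bh + b *: sbv K Bz : s) i : K) =
    match i with Bh => a | Bz => b | _ => 0 end.
  by rewrite !ffunE !sbasis_eqE; case: i; rewrite /GRing.scale /= ?mulr0 ?mulr1 ?addr0 ?add0r.
by rewrite !cE !scale0r !add0r !addr0 !scalerA -scalerDl.
Qed.

End Module.
End Weights.

(** Applying [T b - chi j b] to the relation removes [w j] and rescales the other terms; choosing
    [b] so that it separates [i] from [j], the scalar at [i] is nonzero and induction applies. A
    family of operators is allowed because two weights may differ on [h] or on [z]. *)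
Lemma joint_eigen_independent (K : fieldType) (V : lmodType K) (I : eqType) (B : Type)
    (T : B -> {linear V -> V}) (chi : I -> B -> K) (r : seq I) (w : I -> V) :
  (forall i j, i != j -> exists b, chi i b != chi j b) ->
  (forall i b, T b (w i) = chi i b *: w i) -> uniq r ->
  \sum_(i <- r) w i = 0 -> forall i, i \in r -> w i = 0.
Proof.
move=> chi_inj; elim: r w => //= j r IH w wE /andP[j_r r_uniq].
rewrite big_cons => sum0.
have r0 i : i \in r -> w i = 0.
  move=> i_r; have /chi_inj[b chi_ij] : i != j by apply: contraNneq j_r => <-.
  have sum' : \sum_(k <- r) (chi k b - chi j b) *: w k = 0.
    transitivity (T b (\sum_(k <- r) w k) - chi j b *: \sum_(k <- r) w k).
      rewrite linear_sum /= scaler_sumr -sumrB; apply: eq_bigr => k _.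
      by rewrite wE scalerBl.
    have -> : \sum_(k <- r) w k = - w j by apply/eqP; rewrite -addr_eq0 addrC sum0.
    by rewrite linearN wE scalerN subrr.
  have ij0 : chi i b - chi j b != 0 by rewrite subr_eq0.
  apply: (scalerI ij0); rewrite scaler0.
  apply: (IH (fun k => (chi k b - chi j b) *: w k) _ _ sum' i i_r) => // k b'.
  by rewrite linearZ /= wE !scalerA mulrC.
move=> i; rewrite inE => /predU1P[->|/r0//].
by move: sum0; rewrite big_seq big1 ?addr0.
Qed.

Section WeightDecomposition.
Variable K : fieldType.
Local Notation s := (schroedinger K).
Local Notation U := (env s).
Local Notation hdual := (hdual K).
Local Notation elh := (elh K).
Local Notation elz := (elz K).
Variable M : lmodType U.
Implicit Types (x y : kvect M) (lam mu : hdual) (xi : set hdual).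

Lemma is_weight0 lam : is_weight lam (0 : M).
Proof. by move=> H; rewrite !scaler0. Qed.

Lemma is_weightD lam x y :
  is_weight lam (x : M) -> is_weight lam (y : M) -> is_weight lam (x + y : M).
Proof. by move=> wx wy H; rewrite scalerDr wx wy -scalerDr. Qed.

Lemma is_weightZ lam a x : is_weight lam (x : M) -> is_weight lam (a *: x : M).
Proof.
move=> /is_weightP[hx zx]; apply/is_weightP.
by rewrite !linearZ /= hx zx !scalerA ![a * _]mulrC.
Qed.

Lemma is_weightB lam x y :
  is_weight lam (x : M) -> is_weight lam (y : M) -> is_weight lam (x - y : M).
Proof. by move=> wx wy; rewrite -scaleN1r; apply: is_weightD (is_weightZ _ _). Qed.

Lemma weight_independent (r : seq hdual) (w : hdual -> kvect M) : uniq r ->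
  (forall lam, is_weight lam (w lam : M)) -> \sum_(lam <- r) w lam = 0 ->
  forall lam, lam \in r -> w lam = 0.
Proof.
move=> r_uniq wW sum0.
apply: (joint_eigen_independent (chi := fun lam b => if b then lam elh else lam elz)
  (T := fun b => if b then act Bh : {linear kvect M -> kvect M} else act Bz)) sum0 => //.
  move=> lam mu; have [hE|] := eqVneq (lam elh) (mu elh); last by exists true.
  have [zE|] := eqVneq (lam elz) (mu elz); last by exists false.
  by move=> /eqP[]; apply: hdual_eq.
by move=> lam b; have /is_weightP[hl zl] := wW lam; case: b.
Qed.

Definition wt_sum xi (x : M) : Prop :=
  aspan (fun y : M => exists2 lam, xi lam & is_weight lam y) x.

Lemma wt_sum_decomp xi (x : kvect M) : wt_sum xi x ->
  exists (r : seq hdual) (w : hdual -> kvect M),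
  [/\ uniq r, forall lam, is_weight lam (w lam : M), forall lam, lam \in r -> xi lam,
      forall lam, lam \notin r -> w lam = 0 & x = \sum_(lam <- r) w lam].
Proof.
elim=> [y [lam xi_lam y_lam]||y z _ [r [w [ru wW rxi r0 ->]]] _ [r' [w' [r'u w'W r'xi r'0 ->]]]].
- exists [:: lam], (fun mu => if mu == lam then y else 0); split=> // [mu|mu|mu|].
  + by case: eqP => [->//|_]; apply: is_weight0.
  + by rewrite inE => /eqP ->.
  + by rewrite inE => /negPf ->.
  + by rewrite big_seq1 eqxx.
- exists [::], (fun=> 0); split=> //; last by rewrite big_nil.
  by move=> lam; apply: is_weight0.
exists (undup (r ++ r')), (fun lam => w lam + w' lam); split.
- exact: undup_uniq.
- by move=> lam; apply: is_weightD.
- by move=> lam; rewrite mem_undup mem_cat => /orP[/rxi|/r'xi].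
- by move=> lam; rewrite mem_undup mem_cat negb_or => /andP[/r0 -> /r'0 ->]; rewrite addr0.
rewrite big_split /= (sum_subset ru (undup_uniq (r ++ r')))
  ?(sum_subset r'u (undup_uniq (r ++ r'))) // => lam;
  by rewrite mem_undup mem_cat => ->; rewrite ?orbT.
Qed.

Lemma wt_sum_support xi (lam : hdual) (x : kvect M) :
  wt_sum xi x -> is_weight lam (x : M) -> x <> 0 -> xi lam.
Proof.
move=> /wt_sum_decomp[r [w [ru wW rxi r0 xE]]] wx x0.
(* Two decompositions of [x] are subtracted: the given one and [x] itself placed in weight [lam]. *)
pose r' := undup (lam :: r); pose w' mu := w mu - (if mu == lam then x else 0).
suff w'0 : w' lam = 0.
  apply: rxi; apply: contrapT => /negP /r0 wlam; apply: x0.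
  by move: w'0; rewrite /w' wlam eqxx sub0r => /eqP; rewrite oppr_eq0 => /eqP.
apply: (@weight_independent r'); rewrite ?undup_uniq ?mem_undup ?mem_head //.
  move=> mu; apply: is_weightB => //.
  by case: eqP => [->//|_]; apply: is_weight0.
rewrite sumrB (@sum_subset _ _ r) ?undup_uniq //; last first.
  by move=> mu mur; rewrite mem_undup in_cons mur orbT.
rewrite (@sum_subset _ _ [:: lam] r' (fun mu => if mu == lam then x else 0)) ?undup_uniq //.
- by rewrite big_seq1 eqxx -xE subrr.
- by move=> mu; rewrite inE => /eqP ->; rewrite mem_undup mem_head.
by move=> mu; rewrite inE => /negPf ->.
Qed.

(** The uniqueness of the decomposition in [weight_module] is automatic by independence of weights,
    so existence with weights in [xi], which is easy to propagate, is an equivalent condition. *)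
Lemma weight_moduleP xi :
  (weight_module M /\ (Defs.support M `<=` xi)%classic) <-> forall x : M, wt_sum xi x.
Proof.
split=> [[wM sM] x|xi_sum].
  have [w [[_ wW xE] _]] := wM x.
  rewrite xE; elim/big_ind: _ => [||lam _]; [exact: aspan0|exact: aspanD|].
  have [->|w0] := pselect (w lam = 0); first exact: aspan0.
  by apply: aspan_gen; exists lam => //; apply: sM; exists (w lam).
split=> [x|lam [x wx x0]]; last exact: wt_sum_support (xi_sum x) wx x0.
have [r [w [ru wW rxi r0 xE]]] := wt_sum_decomp (xi_sum x).
have sumE w' r' : uniq r' -> (forall lam, lam \notin r' -> w' lam = 0) ->
    \sum_(lam \in [set: hdual]%classic) w' lam = \sum_(lam <- r') w' lam :> M.
  move=> r'u w'0; rewrite (fsbigE r') //; last by move=> lam _; apply: w'0.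
  by apply: eq_bigl => lam; rewrite in_setT.
exists w; split=> [|w' [w'_fin w'W xE']].
  split=> //; last by rewrite (sumE _ r).
  apply: (sub_finite_set _ (finite_seq r)) => lam /= wlam.
  by apply: contrapT => /negP /r0.
have [r' r'E] := (finite_seqP _).1 w'_fin.
have r'0 lam : lam \notin r' -> w' lam = 0.
  move=> lam_r'; apply: contrapT => w'lam.
  have : [set` r']%classic lam by rewrite -r'E.
  by move=> /=; rewrite (negPf lam_r').
pose r'' := undup (r ++ r').
have r''u : uniq r'' by rewrite undup_uniq.
have r''0 lam : lam \notin r'' -> w lam = 0 /\ w' lam = 0.
  by rewrite mem_undup mem_cat negb_or => /andP[/r0 -> /r'0 ->].
apply: functional_extensionality_dep => lam.
have [lam_r|/r''0[-> ->]//] := boolP (lam \in r'').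
apply/eqP; rewrite -subr_eq0; apply/eqP.
apply: (weight_independent (w := fun mu => w mu - w' mu) r''u _ _ lam_r) => [mu|].
  exact: (is_weightB (wW mu) (w'W mu)).
rewrite sumrB -(sumE w) //; last by move=> mu /r''0[].
rewrite -(sumE w') //; last by move=> mu /r''0[].
rewrite -[X in _ - X]xE' (sumE w r) // -xE; exact: subrr.
Qed.
End WeightDecomposition.

Lemma natr_pchar0_inj (K : fieldType) :
  (forall n, n.+1%:R != 0 :> K) -> injective (fun n => n%:R : K).
Proof.
move=> pchar0 m n; wlog: m n / (m <= n)%N => [IH mn|mn /esym/eqP].
  by case/orP: (leq_total m n) => ?; [apply: IH | apply/esym/IH].
rewrite -(subnKC mn) natrD -subr_eq0 addrC addKr.
by case: (n - m)%N => [|k]; rewrite ?addn0 // (negPf (pchar0 k)).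
Qed.

(** The relation is a nonzero row in the kernel of the coefficient matrix, which has [n.+1] rows and
    [n] columns. *)
Lemma linear_dependence (K : fieldType) (V : lmodType K) n (g : 'I_n -> V) (w : nat -> V) :
  (forall k, exists a : 'I_n -> K, w k = \sum_i a i *: g i) ->
  exists2 b : 'I_n.+1 -> K, exists k, b k != 0 & \sum_k b k *: w k = 0.
Proof.
move=> wg; pose a (k : 'I_n.+1) := sval (cid (wg k)).
have aE k : w (val k) = \sum_i a k i *: g i := svalP (cid (wg k)).
pose A := \matrix_(k, i) a k i.
have : kermx A != 0.
  by rewrite kermx_eq0 /row_free neq_ltn ltnS rank_leq_col.
case/matrix0Pn => i [j bij]; exists (fun k => kermx A i k); first by exists j.
under eq_bigr => k _ do rewrite aE scaler_sumr.
rewrite exchange_big big1 //= => l _.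
transitivity (\sum_k (kermx A i k * a k l) *: g l).
  by apply: eq_bigr => k _; rewrite scalerA.
rewrite -scaler_suml -[RHS](scale0r (g l)); congr (_ *: _).
transitivity ((kermx A *m A) i l); last by rewrite mulmx_ker mxE.
by rewrite mxE; apply: eq_bigr => k _; rewrite [A k l]mxE.
Qed.

Lemma fin_span_finType (A : pzRingType) (M : lmodType A) (I : finType) (g : I -> M) (S : set M) :
  S = [set v | exists a : I -> A, v = \sum_i a i *: g i]%classic -> fin_span S.
Proof.
move=> ->; exists #|I|, (fun i => g (enum_val i)); rewrite eqEsubset; split=> _ [a ->] /=.
  exists (fun i => a (enum_val i)).
  by rewrite (reindex (fun i : 'I_#|I| => enum_val i)) //=; apply/onW_bij/enum_val_bij.
exists (fun i => a (enum_rank i)).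
rewrite [RHS](reindex (fun i : 'I_#|I| => enum_val i)) /=; last exact/onW_bij/enum_val_bij.
by apply: eq_bigr => i _; rewrite enum_valK.
Qed.

Lemma act_genZ (K : fieldType) (M : lmodType (env (schroedinger K))) (a : K) i (x : kvect M) :
  env_gen (a *: sbv K i : schroedinger K) *: (x : M) = a *: act i x.
Proof. by rewrite linearZ kvect_scaleE /act scalerA mulr_algl. Qed.

Section Relations.
Variables (K : fieldType) (M : lmodType (env (schroedinger K))).
Implicit Types x y : kvect M.
Local Notation act := (@act K M).

Lemma act_pq x : act Bp (act Bq x) = act Bq (act Bp x) + act Bz x.
Proof. by rewrite act_comm /= subr0. Qed.
Lemma act_eq x : act Be (act Bq x) = act Bq (act Be x) + act Bp x.
Proof. by rewrite act_comm /= subr0. Qed.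
Lemma act_ep x : act Be (act Bp x) = act Bp (act Be x).
Proof. by rewrite act_comm /= subr0 linear0 scale0r addr0. Qed.
Lemma act_hp x : act Bh (act Bp x) = act Bp (act Bh x) + act Bp x.
Proof. by rewrite act_comm /= subr0. Qed.
Lemma act_hq x : act Bh (act Bq x) = act Bq (act Bh x) - act Bq x.
Proof. by rewrite act_comm /= subr0 linearN scaleNr. Qed.
Lemma act_he x : act Bh (act Be x) = act Be (act Bh x) + 2%:R *: act Be x.
Proof. by rewrite act_comm /= subr0 act_genZ. Qed.
Lemma act_hf x : act Bh (act Bf x) = act Bf (act Bh x) - 2%:R *: act Bf x.
Proof. by rewrite act_comm /= subr0 act_genZ scaleNr. Qed.
Lemma act_ef x : act Be (act Bf x) = act Bf (act Be x) + act Bh x.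
Proof. by rewrite act_comm /= subr0. Qed.
Lemma act_fp x : act Bf (act Bp x) = act Bp (act Bf x) + act Bq x.
Proof. by rewrite act_comm /= subr0. Qed.
Lemma act_fq x : act Bf (act Bq x) = act Bq (act Bf x).
Proof. by rewrite act_comm /= subr0 linear0 scale0r addr0. Qed.
Lemma act_z i x : act Bz (act i x) = act i (act Bz x).
Proof. by rewrite act_comm; case: i; rewrite /= subr0 linear0 scale0r addr0. Qed.

Lemma is_weight_p (lam : hdual K) x :
  is_weight lam (x : M) -> is_weight (lam + hvee K *+ 1) (act Bp x : M).
Proof.
move=> /is_weightP[hx zx]; apply/is_weightP.
by rewrite !(add_lfunE lam) !hvee_mulnE act_hp act_z hx zx !linearZ /= addr0 scalerDl scale1r.
Qed.

Lemma is_weight_e (lam : hdual K) x :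
  is_weight lam (x : M) -> is_weight (lam + hvee K *+ 2) (act Be x : M).
Proof.
move=> /is_weightP[hx zx]; apply/is_weightP.
by rewrite !(add_lfunE lam) !hvee_mulnE act_he act_z hx zx !linearZ /= addr0 (scalerDl _ (lam _)).
Qed.

Lemma is_weight_q (lam : hdual K) x :
  is_weight lam (x : M) -> is_weight (lam - hvee K *+ 1) (act Bq x : M).
Proof.
move=> /is_weightP[hx zx]; apply/is_weightP.
rewrite !(add_lfunE lam) !(opp_lfunE (hvee K *+ _)) !hvee_mulnE act_hq act_z hx zx !linearZ /= subr0.
by rewrite scalerBl scale1r.
Qed.

Lemma is_weight_f (lam : hdual K) x :
  is_weight lam (x : M) -> is_weight (lam - hvee K *+ 2) (act Bf x : M).
Proof.
move=> /is_weightP[hx zx]; apply/is_weightP.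
by rewrite !(add_lfunE lam) !(opp_lfunE (hvee K *+ _)) !hvee_mulnE act_hf act_z hx zx
  !linearZ /= subr0 (scalerBl (lam _)) scalerN.
Qed.
End Relations.

(** * Category O *)

Section CategoryO.
Variables (K : fieldType) (xi : set (hdual K)) (c : K).
Hypothesis pchar0 : forall n, n.+1%:R != 0 :> K.
Hypothesis xi_charge : is_central_charge xi c.
Local Notation s := (schroedinger K).
Local Notation U := (env s).
Implicit Type M : lmodType U.

(** The part of membership in O[xi] that can be checked vector by vector. It passes to sums of
    images, and nilpotency of [e] and [p] stands in for finiteness of the [U(n_+)]-orbits. *)
Definition locally_O M : Prop :=
  [/\ forall x : M, wt_sum xi x, forall x : kvect M, nilp_at (act Be) x
    & forall x : kvect M, nilp_at (act Bp) x].

Lemma wt_sum_charge M (x : kvect M) : wt_sum xi (x : M) -> act Bz x = c *: x.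
Proof.
elim=> [y [lam xi_lam /is_weightP[_ ->]]||y z _ yE _ zE]; first by rewrite xi_charge.
  by rewrite (linear0 (act Bz)) scaler0.
by rewrite [LHS]scalerDr [X in X + _]yE [X in _ + X]zE [RHS]scalerDr.
Qed.

(** The iterates lie in a space spanned by [n] vectors, so [n.+1] of them are dependent. Their
    weights are pairwise distinct, since each step raises the weight by a positive multiple of
    [hvee]; an iterate with nonzero coefficient must therefore vanish. *)
Lemma nilp_weight M i m (x : kvect M) n (g : 'I_n -> kvect M) (lam : hdual K) :
  (forall mu (y : kvect M), is_weight mu (y : M) -> is_weight (mu + hvee K *+ m.+1) (act i y : M)) ->
  (forall k, exists a : 'I_n -> K, iter k (act i) x = \sum_i a i *: g i) ->
  is_weight lam (x : M) -> nilp_at (act i) x.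
Proof.
move=> act_wt /linear_dependence[b [k bk] sum0] x_lam.
exists k; apply: (scalerI bk); rewrite scaler0.
apply: (joint_eigen_independent (B := unit) (T := fun=> act Bh : {linear kvect M -> kvect M})
  (chi := fun (l : 'I_n.+1) _ => lam (elh K) + (l * m.+1)%:R)
  (w := fun l : 'I_n.+1 => b l *: iter l (act i) x)
  _ _ (index_enum_uniq _) sum0) => [l l' ll'|l _|]; last exact: mem_index_enum.
  exists tt; apply: contra ll' => /eqP/addrI/(natr_pchar0_inj pchar0)/eqP.
  by rewrite eqn_pmul2r.
suff /is_weightP[hx _] : is_weight (lam + hvee K *+ (l * m.+1)) (iter l (act i) x : M).
  by rewrite linearZ /= hx (add_lfunE lam) hvee_mulnE !scalerA mulrC.
elim: (val l) => [|j IH]; first by rewrite mul0n addr0.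
by rewrite iterS mulSn addnC mulrnDr addrA; apply: act_wt.
Qed.

Fact mem_e : sbv K Be \in nplus K.
Proof. by apply/nplusP; exists 1, 0; rewrite scale1r scale0r addr0. Qed.
Fact mem_p : sbv K Bp \in nplus K.
Proof. by apply/nplusP; exists 0, 1; rewrite scale1r scale0r add0r. Qed.

Let ee : env (sublie (@nplus_lie K)) := env_gen (Subvs mem_e : sublie (@nplus_lie K)).
Let ep : env (sublie (@nplus_lie K)) := env_gen (Subvs mem_p : sublie (@nplus_lie K)).

Lemma env_incl_gen (V : {vspace s}) (Vlie : lie_closed V) (x : sublie Vlie) :
  env_incl Vlie (env_gen x) = env_gen (sublie_val x).
Proof. exact: env_lift_gen. Qed.

Lemma env_incl_scal (V : {vspace s}) (Vlie : lie_closed V) (a : K) :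
  env_incl Vlie (env_scal _ a) = a%:A.
Proof. exact: env_lift_pi. Qed.

Lemma env_incl_exp M (V : {vspace s}) (Vlie : lie_closed V) (x : sublie Vlie) i n (y : kvect M) :
  sublie_val x = sbv K i -> env_incl Vlie (env_gen x ^+ n) *: (y : M) = iter n (act i) y.
Proof.
move=> gi; elim: n => [|n IH]; first by rewrite rmorph1 scale1r.
by rewrite exprS rmorphM -scalerA IH iterS env_incl_gen gi.
Qed.

Lemma nilp_of_orbit M i m (x : kvect M) (g : sublie (@nplus_lie K)) (lam : hdual K) :
  sublie_val g = sbv K i ->
  (forall mu (y : kvect M), is_weight mu (y : M) -> is_weight (mu + hvee K *+ m.+1) (act i y : M)) ->
  fin_span (nplus_orbit (x : M)) -> is_weight lam (x : M) -> nilp_at (act i) x.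
Proof.
move=> gi act_wt [n [b bE]]; apply: nilp_weight act_wt _ => // k.
have : nplus_orbit (x : M) (iter k (act i) x).
  by exists (env_gen g ^+ k) => //; apply: env_incl_exp.
by rewrite bE => -[a ->]; exists a.
Qed.

Lemma nilp_wt_sum M i (x : kvect M) :
  (forall lam (y : kvect M), is_weight lam (y : M) -> nilp_at (act i) y) ->
  wt_sum xi (x : M) -> nilp_at (act i) x.
Proof.
move=> wN; elim=> [y [lam _ /wN]||y z _ yN _ zN] //; first by exists 0%N.
exact: nilpD.
Qed.

(** As [e] and [p] commute, the orbit is spanned by the [e^i p^j x] with [i < m] and [j < n]. *)
Lemma orbit_fin_span M (x : kvect M) m n :
  iter m (act Be) x = 0 -> iter n (act Bp) x = 0 -> fin_span (nplus_orbit (x : M)).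
Proof.
move=> em pn; pose w i j := iter i (act Be) (iter j (act Bp) x).
have epC i j (y : kvect M) :
    iter i (act Be) (iter j (act Bp) y) = iter j (act Bp) (iter i (act Be) y).
  elim: j y => //= j IH y; rewrite -IH.
  by elim: i {IH} => //= i ->; rewrite act_ep.
have w_e i j : (m <= i)%N -> w i j = 0.
  by move=> mi; rewrite /w epC (iter_eq0 mi em) lin_iter0.
have w_p i j : (n <= j)%N -> w i j = 0.
  by move=> nj; rewrite /w (iter_eq0 nj pn) lin_iter0.
pose W (y : kvect M) := exists a : 'I_m * 'I_n -> K, y = \sum_k a k *: w k.1 k.2.
have W0 : W 0 by exists (fun=> 0); rewrite big1 // => k _; rewrite scale0r.
have WD y z : W y -> W z -> W (y + z).
  move=> [a ->] [b ->]; exists (fun k => a k + b k).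
  by rewrite -big_split; apply: eq_bigr => k _; rewrite scalerDl.
have WZ a y : W y -> W (a *: y).
  move=> [b ->]; exists (fun k => a * b k).
  by rewrite scaler_sumr; apply: eq_bigr => k _; rewrite scalerA.
have Ww i j : W (w i j).
  have [/w_e->//|im] := leqP m i; have [/w_p->//|jn] := leqP n j.
  exists (fun k => (k == (Ordinal im, Ordinal jn))%:R).
  rewrite (bigD1 (Ordinal im, Ordinal jn)) //= eqxx scale1r big1 ?addr0 // => k /negPf ->.
  exact: scale0r.
have Wsum (T : {linear kvect M -> kvect M}) y : (forall i j, W (T (w i j))) -> W y -> W (T y).
  move=> WT [a ->]; rewrite linear_sum; elim/big_ind: _ => // k _.
  by rewrite linearZ; apply: WZ.
have We y : W y -> W (act Be y) by apply: Wsum => i j; apply: (Ww i.+1 j).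
have Wp y : W y -> W (act Bp y).
  by apply: Wsum => i j; rewrite /w epC -iterS -epC; apply: Ww.
apply: (fin_span_finType (I := ('I_m * 'I_n)%type) (g := fun k => w k.1 k.2)).
rewrite eqEsubset; split=> [_ [u _ <-]|_ [a ->]]; last first.
  exists (\sum_k env_scal _ (a k) * (ee ^+ k.1 * ep ^+ k.2)) => //.
  rewrite rmorph_sum scaler_suml; apply: eq_bigr => k _.
  rewrite !rmorphM -!scalerA env_incl_scal.
  rewrite (env_incl_exp (x := Subvs mem_p) (i := Bp)) //.
  by rewrite (env_incl_exp (x := Subvs mem_e) (i := Be)).
suff : forall y : kvect M, W y -> W (env_incl (@nplus_lie K) u *: (y : M)).
  by apply; apply: (Ww 0%N 0%N).
elim/env_ind: u => t; elim: t => [l|a|t IHt t' IHt'|t IHt t' IHt'] y Wy.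
- rewrite -/(env_gen l) env_incl_gen.
  have /nplusP[a [b ->]] : sublie_val l \in nplus K := subvsP (l : subvs_of (nplus K)).
  by rewrite linearD scalerDl !act_genZ; apply: WD; apply: WZ; auto.
- by rewrite -/(env_scal _ a) env_incl_scal; apply: WZ.
- by rewrite pi_envD rmorphD scalerDl; apply: WD; auto.
by rewrite pi_envM rmorphM -scalerA; auto.
Qed.

Lemma in_OxiP M : in_Oxi M xi <-> fin_generated M /\ locally_O M.
Proof.
split=> [[[Mfg wM Mfin] sM]|[Mfg [xi_sum eN pN]]].
  have xi_sum := (weight_moduleP M xi).1 (conj wM sM).
  split=> //; split=> // x; apply: nilp_wt_sum (xi_sum x) => lam y y_lam.
    by apply: (@nilp_of_orbit _ _ 1%N _ (Subvs mem_e)) (Mfin y) y_lam => //; apply: is_weight_e.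
  by apply: (@nilp_of_orbit _ _ 0%N _ (Subvs mem_p)) (Mfin y) y_lam => //; apply: is_weight_p.
have [wM sM] := (weight_moduleP M xi).2 xi_sum; split=> //; split=> // x.
have [[m em] [n pn]] := (eN x, pN x); exact: orbit_fin_span em pn.
Qed.
End CategoryO.

(** * Isotypic modules *)

Section Isotypic.
Variables (K : fieldType) (xi : set (hdual K)) (c : K).
Hypothesis pchar0 : forall n, n.+1%:R != 0 :> K.
Hypothesis c_neq0 : c != 0.
Hypothesis xi_charge : is_central_charge xi c.
Hypothesis xi_generic : forall lam, xi lam -> generic (lam (elh K)).
Hypothesis xi_lower : forall lam n, xi lam -> xi (lam - hvee K *+ n).
Local Notation s := (schroedinger K).
Local Notation U := (env s).
Implicit Types M N L : lmodType U.

Definition charged M : Prop := forall x : kvect M, act Bz x = c *: x.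
Definition msingular M : kvect M -> Prop := singular (act Be) (act Bp).
Definition mspan M (S : kvect M -> Prop) : kvect M -> Prop := low_span c (act Bf) (act Bq) S.

Lemma charged_rep M : charged M -> schroedinger_rep c (V := kvect M)
  (act Be) (act Bf) (act Bh) (act Bp) (act Bq).
Proof.
move=> cM; split=> x; rewrite /=.
- by rewrite act_pq cM.
- exact: act_eq.
- exact: act_ep.
- exact: act_hq.
- exact: act_hf.
- exact: act_ef.
- exact: act_fp.
exact: act_fq.
Qed.

Lemma locally_O_charged M : locally_O xi M -> charged M.
Proof. by case=> xi_sum _ _ x; apply: (wt_sum_charge xi_charge) (xi_sum x). Qed.

Lemma generic_weight M (lam : hdual K) (x : kvect M) : xi lam -> is_weight lam (x : M) ->
  exists2 l, act Bh x = l *: x & generic l.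
Proof. by move=> /xi_generic lam_gen /is_weightP[hx _]; exists (lam (elh K)). Qed.

Section Span.
Variables (M : lmodType U) (S : kvect M -> Prop).
Hypothesis M_charged : charged M.
Hypothesis S_sing : forall x, S x -> msingular x.
Hypothesis S_wt : forall x, S x -> exists2 lam, xi lam & is_weight lam (x : M).

Let rep := charged_rep M_charged.
Let S_gen x : S x -> exists2 l, act Bh x = l *: x & generic l.
Proof. by move=> /S_wt[lam xi_lam x_lam]; apply: generic_weight x_lam. Qed.

Lemma mspan_submod : (forall a x, S x -> S (a *: x)) -> is_submod (mspan S : M -> Prop).
Proof.
move=> SZ; apply: is_submod_gen => [|x y|a x|i x]; first exact: aspan0.
- exact: aspanD.
- exact: low_spanZ.
case: i => Sx.
- exact: (low_spane pchar0 c_neq0 rep S_sing S_gen).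
- exact: (low_spanh rep S_gen).
- exact: (low_spanf rep).
- exact: (low_spanp pchar0 c_neq0 rep S_sing).
- exact: low_spanq.
by rewrite M_charged; apply: low_spanZ.
Qed.

Lemma is_weight_low (lam : hdual K) j i (x : kvect M) : is_weight lam (x : M) ->
  is_weight (lam - hvee K *+ (j + 2 * i))
    (iter j (act Bq) (iter i (lowF c (act Bf) (act Bq)) x) : M).
Proof.
move=> x_lam; elim: j => [|j IH]; last first.
  rewrite iterS addSn -addn1 mulrnDr opprD addrA; exact: is_weight_q.
elim: i => [|i IH]; first by rewrite subr0.
rewrite add0n mulnS addnC mulrnDr opprD addrA iterS.
apply: is_weightD; first exact: is_weight_f.
by apply: is_weightZ; rewrite -[2%N]/(1 + 1)%N mulrnDr opprD addrA; do 2!apply: is_weight_q.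
Qed.

Lemma mspan_wt_sum x : mspan S x -> wt_sum xi (x : M).
Proof.
apply: aspan_mono => _ [j [i [y [Sy ->]]]]; have [lam xi_lam y_lam] := S_wt Sy.
by exists (lam - hvee K *+ (j + 2 * i)); [apply: xi_lower | apply: is_weight_low].
Qed.

Lemma mspan_locally_O : (forall x, mspan S x) -> locally_O xi M.
Proof.
move=> S_full; split=> x; first exact: mspan_wt_sum (S_full x).
  exact: (low_span_nilp_e pchar0 c_neq0 rep S_sing S_gen (S_full x)).
exact: (low_span_nilp_p pchar0 c_neq0 rep S_sing (S_full x)).
Qed.
End Span.

Section LocallyO.
Variable M : lmodType U.
Hypothesis M_O : locally_O xi M.

Let M_charged := locally_O_charged M_O.
Let rep := charged_rep M_charged.

Definition wt_singular (x : kvect M) : Prop :=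
  msingular x /\ exists2 lam, xi lam & is_weight lam (x : M).

(** The operator shifts weights injectively, so the images of distinct weight components vanish
    separately. Hence the weight components of a singular vector are singular. *)
Lemma wt_sum_ker i m (r : seq (hdual K)) (w : hdual K -> kvect M) :
  (forall lam (x : kvect M), is_weight lam (x : M) ->
     is_weight (lam + hvee K *+ m) (act i x : M)) ->
  uniq r -> (forall lam, is_weight lam (w lam : M)) ->
  act i (\sum_(lam <- r) w lam) = 0 -> forall lam, lam \in r -> act i (w lam) = 0.
Proof.
move=> act_wt ru wW; rewrite (linear_sum (act i)) => sum0 lam lam_r.
pose w' mu := act i (w (mu - hvee K *+ m)).
have -> : act i (w lam) = w' (lam + hvee K *+ m) by rewrite /w' addrK.
apply: (@weight_independent _ _ [seq mu + hvee K *+ m | mu <- r]).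
- by rewrite map_inj_uniq //; apply: addIr.
- by move=> mu; have := act_wt _ _ (wW (mu - hvee K *+ m)); rewrite subrK.
- by rewrite big_map -[RHS]sum0; apply: eq_bigr => mu _; rewrite /w' addrK.
exact: map_f.
Qed.

Lemma singular_aspan x : msingular x -> aspan wt_singular x.
Proof.
case: M_O => xi_sum _ _ [px ex].
have [r [w [ru wW rxi _ xE]]] := wt_sum_decomp (xi_sum x).
rewrite xE big_seq; elim/big_ind: _ => [||lam lam_r]; [exact: aspan0|exact: aspanD|].
apply: aspan_gen; split; last by exists lam => //; apply: rxi.
rewrite xE in px ex; split.
  exact: (wt_sum_ker (@is_weight_p _ _) ru wW px).
exact: (wt_sum_ker (@is_weight_e _ _) ru wW ex).
Qed.

Lemma wt_singularZ a x : wt_singular x -> wt_singular (a *: x).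
Proof.
move=> [[px ex] [lam xi_lam x_lam]]; split; last by exists lam => //; apply: is_weightZ.
by split; rewrite linearZ /= ?px ?ex scaler0.
Qed.

Let S_gen x : wt_singular x -> exists2 l, act Bh x = l *: x & generic l.
Proof. by move=> [_ [lam xi_lam x_lam]]; apply: generic_weight x_lam. Qed.

Lemma locally_O_mspan x : mspan wt_singular x.
Proof.
case: M_O => _ eN pN; apply: (low_span_full pchar0 c_neq0 rep _ S_gen) => //.
- by move=> y [].
- exact: wt_singularZ.
exact: singular_aspan.
Qed.

Lemma act_p_surj (x : kvect M) : exists y, act Bp y = x.
Proof.
case: M_O => _ eN pN; apply: (p_surj pchar0 c_neq0 rep _ S_gen) => //.
- by move=> y [].
- exact: wt_singularZ.
exact: singular_aspan.
Qed.

Lemma act_e_surj_ker (x : kvect M) : act Bp x = 0 -> exists2 y, act Bp y = 0 & act Be y = x.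
Proof.
case: M_O => _ eN pN; apply: (e_surj_ker pchar0 c_neq0 rep _ S_gen) => //.
- by move=> y [].
- exact: wt_singularZ.
exact: singular_aspan.
Qed.

Lemma submod_singular (W : M -> Prop) (x : M) : is_submod W -> W x -> x <> 0 ->
  exists y : kvect M, [/\ W y, y <> 0 & msingular y].
Proof.
case: M_O => _ eN pN [_ _ WZ].
by apply: (singular_in_submod rep) => // y Wy; apply: WZ.
Qed.
End LocallyO.

Definition isotypic (lam : hdual K) M : Prop :=
  locally_O xi M /\ forall x : kvect M, msingular x -> is_weight lam (x : M).

Section Subspace.
Variables (M : lmodType U) (S : kvect M -> Prop) (lam : hdual K).
Hypothesis xi_lam : xi lam.
Hypothesis M_charged : charged M.
Hypothesis S_sing : forall x, S x -> msingular x.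
Hypothesis S_wt : forall x, S x -> is_weight lam (x : M).
Hypotheses (S0 : S 0) (S_add : forall x y, S x -> S y -> S (x + y)).

Let rep := charged_rep M_charged.
Let S_h x : S x -> act Bh x = lam (elh K) *: x.
Proof. by move=> /S_wt/is_weightP[]. Qed.

Lemma mspan_singular x : mspan S x -> msingular x -> S x.
Proof. exact: (low_span_singular pchar0 c_neq0 rep (xi_generic xi_lam)). Qed.

Lemma mspan_weight x : mspan S x -> is_weight lam (x : M) -> S x.
Proof. by move=> Sx /is_weightP[hx _]; apply: (low_span_weight pchar0 rep) Sx hx. Qed.

Lemma mspan_isotypic : (forall x, mspan S x) -> isotypic lam M.
Proof.
move=> S_full; split; last by move=> x x_sing; apply/S_wt/mspan_singular.
by apply: (mspan_locally_O M_charged S_sing) => // x Sx; exists lam => //; apply: S_wt.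
Qed.
End Subspace.
End Isotypic.

Section LinearMaps.
Variables (K : fieldType) (c : K).
Local Notation U := (env (schroedinger K)).
Variables (M N : lmodType U) (g : {linear M -> N}).

Lemma linear_act i (x : kvect M) : g (act i x) = act i (g x).
Proof. exact: linearZ. Qed.

Lemma linear_kscale (a : K) (x : kvect M) : g (a *: x) = a *: (g x : kvect N).
Proof. exact: linearZ. Qed.

Lemma linear_iter_act n i (x : kvect M) : g (iter n (act i) x) = iter n (act i) (g x).
Proof. by elim: n => //= n <-; apply: linear_act. Qed.

Lemma linear_low j i (x : kvect M) :
  g (iter j (act Bq) (iter i (lowF c (act Bf) (act Bq)) x)) =
  iter j (act Bq) (iter i (lowF c (act Bf) (act Bq)) (g x)).
Proof.
rewrite linear_iter_act; congr iter; elim: i => //= i IH.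
by rewrite -IH /lowF linearD linear_kscale !linear_act.
Qed.

Lemma msingular_map (x : kvect M) : msingular x -> msingular (g x).
Proof. by case=> px ex; split; rewrite /= -linear_act ?px ?ex linear0. Qed.

Lemma msingular_inj (x : kvect M) : injective g -> msingular (g x) -> msingular x.
Proof. by move=> gI [px ex]; split; apply: gI; rewrite linear0 linear_act. Qed.

Lemma is_weight_map lam (x : M) : is_weight lam x -> is_weight lam (g x).
Proof. by move=> wx H; rewrite -!linearZ wx. Qed.

Lemma is_weight_inj lam (x : M) : injective g -> is_weight lam (g x) -> is_weight lam x.
Proof. by move=> gI wx H; apply: gI; rewrite !linearZ; apply: wx. Qed.

Lemma wt_sum_map xi (x : M) : wt_sum xi x -> wt_sum xi (g x).
Proof.
apply: (aspan_map (linear0 g) (linearD g)) => y [lam xi_lam y_lam].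
by apply: aspan_gen; exists lam => //; apply: is_weight_map.
Qed.
End LinearMaps.

Section Singular.
Variables (K : fieldType) (M : lmodType (env (schroedinger K))).
Implicit Types x y : kvect M.

Lemma msingular0 : msingular (0 : kvect M).
Proof. by split; apply: linear0. Qed.

Lemma msingularD x y : msingular x -> msingular y -> msingular (x + y).
Proof. by move=> [px ex] [py ey]; split; rewrite linearD ?px ?ex ?py ?ey addr0. Qed.

Lemma msingularZ a x : msingular x -> msingular (a *: x).
Proof. by move=> [px ex]; split; rewrite linearZ /= ?px ?ex scaler0. Qed.

End Singular.

Lemma locally_O_aspan (K : fieldType) (xi : set (hdual K)) (N : lmodType (env (schroedinger K))) :
  (forall y : N, aspan (fun y => exists (M : lmodType (env (schroedinger K)))
    (g : {linear M -> N}) x, locally_O xi M /\ y = g x) y) -> locally_O xi N.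
Proof.
move=> N_span; split=> y.
- elim: (N_span y) => [_ [M [g [x [[MO _ _] ->]]]]||u v _ Iu _ Iv]; last exact: aspanD.
    exact: wt_sum_map.
  exact: aspan0.
- elim: (N_span y) => [_ [M [g [x [[_ eM _] ->]]]]||u v _ Iu _ Iv]; last exact: nilpD.
    by have [n xn] := eM x; exists n; rewrite -linear_iter_act xn linear0.
  by exists 0%N.
elim: (N_span y) => [_ [M [g [x [[_ _ pM] ->]]]]||u v _ Iu _ Iv]; last exact: nilpD.
  by have [n xn] := pM x; exists n; rewrite -linear_iter_act xn linear0.
by exists 0%N.
Qed.

(** * Homomorphisms and extensions of isotypic modules *)

Section IsotypicMaps.
Variables (K : fieldType) (xi : set (hdual K)) (c : K).
Hypothesis pchar0 : forall n, n.+1%:R != 0 :> K.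
Hypothesis c_neq0 : c != 0.
Hypothesis xi_charge : is_central_charge xi c.
Hypothesis xi_generic : forall lam, xi lam -> generic (lam (elh K)).
Hypothesis xi_lower : forall lam n, xi lam -> xi (lam - hvee K *+ n).
Local Notation s := (schroedinger K).
Local Notation U := (env s).
Implicit Types M N L : lmodType U.

Lemma isotypic_mspan lam M (x : kvect M) : isotypic xi lam M -> mspan c (@msingular K M) x.
Proof.
case=> M_O _; apply: aspan_mono (locally_O_mspan pchar0 c_neq0 xi_charge xi_generic M_O x).
by move=> _ [j [i [y [[y_sing _] ->]]]]; exists j, i, y.
Qed.

Lemma isotypic_weight lam M (x : kvect M) : isotypic xi lam M ->
  is_weight lam (x : M) -> msingular x.
Proof.
move=> M_iso x_lam; case: (M_iso) => M_O sing_wt.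
apply: (mspan_weight pchar0 (locally_O_charged xi_charge M_O) sing_wt _ _ _ x_lam).
- exact: msingular0.
- exact: msingularD.
exact: isotypic_mspan M_iso.
Qed.

Lemma isotypic_hom_eq lam M N (f g : {linear M -> N}) : isotypic xi lam M ->
  (forall x : M, is_weight lam x -> f x = g x) -> f =1 g.
Proof.
move=> M_iso fg x; elim: (isotypic_mspan x M_iso) => [_ [j [i [y [y_sing ->]]]]||u v _ Iu _ Iv].
- by rewrite !(linear_low c) fg //; case: M_iso => _; apply.
- by rewrite !linear0.
by rewrite !linearD Iu Iv.
Qed.

Lemma isotypic_extend lam M N (phi : {linear weight_space M lam -> weight_space N lam}) :
  isotypic xi lam M -> locally_O xi N -> xi lam ->
  (forall y : kvect N, is_weight lam (y : N) -> msingular y) ->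
  exists g : {linear M -> N}, @weight_map K M N lam g =1 phi.
Proof.
move=> M_iso N_O xi_lam N_sing; case: (M_iso) => M_O M_wt.
pose MN : lmodType U := (M * N)%type.
have MN_charged : charged c MN.
  move=> [x y]; apply/pair_equal_spec.
  by split; [apply: (locally_O_charged xi_charge M_O) | apply: (locally_O_charged xi_charge N_O)].
(* The graph of [phi]. It consists of singular vectors of weight [lam], so [mspan] turns it into a
   submodule [G], which will be the graph of the extension. *)
pose S (u : kvect MN) := exists v : weight_space M lam, u = (v : M, phi v : N).
have weightP L (v : weight_space L lam) : is_weight lam (v : L).
  by apply/asboolP; apply: weight_valP.
have S_sing u : S u -> msingular u.
  move=> [v ->]; have [pv ev] := isotypic_weight M_iso (weightP _ v).
  have [pw ew] := N_sing _ (weightP _ (phi v)).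
  by split; apply/pair_equal_spec.
have S_wt u : S u -> is_weight lam (u : MN).
  by move=> [v ->] H; apply/pair_equal_spec; split; apply: weightP.
have S0 : S 0 by exists 0; rewrite linear0.
have S_add x y : S x -> S y -> S (x + y).
  by move=> [v ->] [w ->]; exists (v + w); rewrite linearD.
have S_scale a x : S x -> S (a *: x).
  by move=> [v ->]; exists (a *: v); rewrite linearZ.
pose G : MN -> Prop := mspan c S.
have G_sub : is_submod G.
  by apply: (mspan_submod pchar0 c_neq0 xi_generic) => // u /S_wt; exists lam.
have G_total x : exists y, G (x, y).
  elim: (isotypic_mspan x M_iso) => [_ [j [i [y [y_sing ->]]]]||u v _ [u' Gu] _ [v' Gv]].
  - have /asboolP y_wt := M_wt _ y_sing; pose v := WeightSpace y_wt.
    pose w := iter j (act Bq) (iter i (lowF c (act Bf) (act Bq)) ((v : M, phi v : N) : kvect MN)).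
    exists w.2; have <- : w.1 = iter j (act Bq) (iter i (lowF c (act Bf) (act Bq)) y).
      exact: (linear_low c (fst : {linear MN -> M})).
    rewrite -surjective_pairing; apply: aspan_gen.
    by exists j, i, (v : M, phi v : N); split=> //; exists v.
  - by exists 0; case: G_sub.
  by exists (u' + v'); case: G_sub => _ GD _; apply: (GD (u, u') (v, v')).
(* Otherwise the fibre over 0 contains a nonzero singular [z]. Then [(0, z)] is singular in [G],
   hence lies in the graph [S] itself, and [z = phi 0 = 0]. *)
have G_fun y : G (0, y) -> y = 0.
  move=> Gy; apply: contrapT => y0.
  have W_sub : is_submod (fun z : N => G (0, z)).
    case: G_sub => G0 GD GZ; split=> // [z z' Gz Gz'|a z Gz].
      suff -> : (0, z + z') = (0, z) + (0, z') :> MN by apply: GD.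
      by apply/pair_equal_spec; split=> //; rewrite /= addr0.
    suff -> : (0, a *: z) = a *: (0, z) :> MN by apply: GZ.
    by apply/pair_equal_spec; split=> //; rewrite /= scaler0.
  have [z [Gz z0 [pz ez]]] := submod_singular xi_charge N_O W_sub Gy y0.
  have : S (0, z).
    apply: (mspan_singular pchar0 c_neq0 xi_generic xi_lam MN_charged S_sing S_wt S0 S_add Gz).
    by split; apply/pair_equal_spec; split=> //; apply: scaler0.
  move=> [v [/esym v0 zE]]; apply: z0; rewrite zE.
  have -> : v = 0 by apply: val_inj.
  by rewrite linear0.
pose g x := sval (cid (G_total x)).
have gP x : G (x, g x) := svalP (cid (G_total x)).
have G_eq x y y' : G (x, y) -> G (x, y') -> y = y'.
  move=> Gy Gy'; apply/eqP; rewrite -subr_eq0; apply/eqP/G_fun.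
  by have := submodB G_sub Gy Gy'; rewrite -[(x, y) - (x, y')]/(x - x, y - y') subrr.
have g_lin : linear g.
  move=> a x y; apply: (G_eq (a *: x + y)) => //.
  by case: G_sub => _ GD GZ; have := GD _ _ (GZ a _ (gP x)) (gP y).
pose g' : {linear M -> N} := HB.pack g (GRing.isLinear.Build U M N *:%R g g_lin).
exists g' => v.
apply: val_inj; apply: (G_eq (v : M)) => //; apply: aspan_gen.
by exists 0%N, 0%N, (v : M, phi v : N); split=> //; exists v.
Qed.

(** For a preimage [x] of [y], the obstruction [p x] comes from [L], where [p] is onto, so it can be
    removed. The remaining [e x'] then comes from the kernel of [p] in [L], on which [e] is onto;
    correcting inside that kernel does not disturb [p x' = 0]. *)
Lemma singular_lift L M N (f : {linear L -> M}) (g : {linear M -> N}) :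
  short_exact f g -> locally_O xi L -> forall y : kvect N, msingular y ->
  exists2 x : kvect M, msingular x & g x = y.
Proof.
move=> [fI gS fg] L_O y [py ey]; have [x gx] := gS y.
have [l fl] : exists l, f l = act Bp x.
  by apply/fg; rewrite linear_act gx.
have [l' l'E] := act_p_surj pchar0 c_neq0 xi_charge xi_generic L_O l.
pose x' : kvect M := x - f l'.
have gx' : g x' = y.
  by rewrite linearB gx (_ : g (f l') = 0) ?subr0 //; apply/fg; exists l'.
have px' : act Bp x' = 0.
  by rewrite linearB /= -fl -linear_act l'E; exact: subrr.
have [m fm] : exists m, f m = act Be x' by apply/fg; rewrite linear_act gx'.
have pm : act Bp m = 0.
  by apply: fI; rewrite linear0 linear_act fm -act_ep px'; exact: linear0.
have [m' pm' m'E] := act_e_surj_ker pchar0 c_neq0 xi_charge xi_generic L_O pm.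
exists (x' - f m'); last first.
  by rewrite linearB gx' (_ : g (f m') = 0) ?subr0 //; apply/fg; exists m'.
split; rewrite linearB /=; first by rewrite px' -linear_act pm' linear0 subr0.
rewrite -linear_act m'E fm; exact: subrr.
Qed.

Lemma isotypic_ses lam L M N (f : {linear L -> M}) (g : {linear M -> N}) : xi lam ->
  locally_O xi L -> locally_O xi M -> locally_O xi N -> short_exact f g ->
  isotypic xi lam M <-> isotypic xi lam L /\ isotypic xi lam N.
Proof.
move=> xi_lam L_O M_O N_O fg_ex; case: (fg_ex) => fI gS fgE.
split=> [[_ M_wt]|[[_ L_wt] [_ N_wt]]].
  split; split=> // x x_sing.
    by apply: (is_weight_inj fI); apply/M_wt/msingular_map.
  have [y y_sing <-] := singular_lift fg_ex L_O x_sing.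
  exact/is_weight_map/M_wt.
split=> // x x_sing.
elim: (singular_aspan M_O x_sing) => [y [y_sing [mu xi_mu y_mu]]||u v _ Iu _ Iv].
- have [->|y0] := pselect (y = 0); first exact: is_weight0.
  suff -> : lam = mu by [].
  have [/is_weightP[hmu _] cM] := (y_mu, xi_charge).
  apply: hdual_eq; last by rewrite !xi_charge.
  (* [y'] dies in [N], so it is a singular vector coming from [L] and has weight [lam]. As
     [y' = (mu - lam) y], applying [h] once more gives [(mu - lam)^2 y = 0]. *)
  pose y' : kvect M := act Bh y - lam (elh K) *: y.
  have y'E : y' = (mu (elh K) - lam (elh K)) *: y by rewrite /y' hmu scalerBl.
  have [l fl] : exists l, f l = y'.
    apply/fgE; have /is_weightP[hg _] := N_wt _ (msingular_map g y_sing).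
    by rewrite linearB linear_act hg linear_kscale; exact: subrr.
  have l_sing : msingular l.
    by apply: (msingular_inj fI); rewrite fl y'E; apply: msingularZ.
  have /is_weightP[hl _] := is_weight_map f (L_wt _ l_sing).
  move: hl; rewrite fl y'E linearZ /= hmu !scalerA => /eqP.
  rewrite -subr_eq0 -scalerBl scaler_eq0 [lam _ * _]mulrC -mulrBr mulf_eq0 orbb subr_eq0.
  by case/orP => /eqP // /y0.
- exact: is_weight0.
exact: is_weightD.
Qed.
End IsotypicMaps.

(** * Verma modules *)

Section EnvelopeModule.
Local Open Scope quotient_scope.
Variables (K : comNzRingType) (L : lieAlgType K) (V : lmodType K) (phi : L -> V -> V).
Hypothesis phi_linear : forall x, linear (phi x).
Hypothesis phi_linearl : forall v, linear (phi^~ v).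
Hypothesis phi_lie : forall x y v, phi (lie x y) v = phi x (phi y v) - phi y (phi x v).

(** Terms are interpreted directly as operators on [V], so a Lie action yields a module over the
    envelope without an algebra of endomorphisms. *)
Fixpoint uact (t : uterm L) (v : V) : V :=
  match t with
  | UGen x => phi x v
  | UScal a => a *: v
  | UAdd t u => uact t v + uact u v
  | UMul t u => uact t (uact u v)
  end.

Fact uact_linear t : linear (uact t).
Proof.
elim: t => [x|b|t IHt u IHu|t IHt u IHu] a v w /=; first exact: phi_linear.
- by rewrite scalerDr !scalerA mulrC.
- by rewrite IHt IHu scalerDr addrACA.
by rewrite IHu IHt.
Qed.

Let uactD t v w : uact t (v + w) = uact t v + uact t w.
Proof. by have := uact_linear t 1 v w; rewrite !scale1r. Qed.

Let uactZ t a v : uact t (a *: v) = a *: uact t v.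
Proof.
have u0 : uact t 0 = 0 by apply: (addrI (uact t 0)); rewrite -uactD !addr0.
by have := uact_linear t a v 0; rewrite u0 !addr0.
Qed.

Fact uact_ueq t u : ueq t u -> uact t =1 uact u.
Proof.
move=> tu; elim: t u / tu => //=.
- by move=> t u _ tu v; rewrite tu.
- by move=> t u w _ tu _ uw v; rewrite tu.
- by move=> t t' u u' _ tt' _ uu' v; rewrite tt' uu'.
- by move=> t t' u u' _ tt' _ uu' v; rewrite uu' tt'.
- by move=> * v /=; rewrite addrA.
- by move=> * v /=; rewrite addrC.
- by move=> * v /=; rewrite scale0r add0r.
- by move=> * v /=; rewrite scale1r.
- by move=> * v /=; rewrite !scale0r.
- by move=> * v /=; rewrite uactD.
- by move=> * v /=; rewrite scalerDl.
- by move=> * v /=; rewrite scalerA.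
- by move=> * v /=; rewrite uactZ.
- by move=> x y v /=; have := phi_linearl v 1 x y; rewrite !scale1r.
- by move=> a x v /=; have := phi_linearl v a x 0;
    have := phi_linearl v (-1) 0 0; rewrite scaler0 addr0 scaleN1r addNr => ->; rewrite !addr0.
by move=> x y v /=; rewrite phi_lie addrC subrK.
Qed.

Definition env_module : Type := let _ := (phi_linear, phi_linearl, phi_lie) in V.
HB.instance Definition _ := GRing.Zmodule.copy env_module V.

Definition env_act (u : env L) (v : env_module) : env_module := uact (repr u) v.

Lemma env_act_pi t v : env_act (\pi_(env L) t) v = uact t v.
Proof. by apply: uact_ueq; apply/envP; rewrite reprK. Qed.

Fact env_actA u w v : env_act u (env_act w v) = env_act (u * w) v.
Proof. by elim/env_ind: u => t; elim/env_ind: w => t'; rewrite -pi_envM !env_act_pi. Qed.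
Fact env_act1 : left_id 1 env_act.
Proof. by move=> v; rewrite [env_act _ _]env_act_pi /= scale1r. Qed.
Fact env_actDr : right_distributive env_act +%R.
Proof. by move=> u v w; exact: uactD. Qed.
Fact env_actDl v : {morph env_act^~ v : u w / u + w}.
Proof. by elim/env_ind=> t; elim/env_ind=> t'; rewrite -pi_envD !env_act_pi. Qed.

HB.instance Definition _ := GRing.Zmodule_isLmodule.Build (env L) env_module
  env_actA env_act1 env_actDr env_actDl.

Lemma env_module_gen (x : L) (v : env_module) : env_gen x *: v = phi x v.
Proof. exact: env_act_pi. Qed.
Lemma env_module_scal (a : K) (v : env_module) : env_scal _ a *: v = (a *: (v : V)).
Proof. exact: env_act_pi. Qed.
End EnvelopeModule.

(** * An explicit module with a nonzero singular vector *)

Section ModelModule.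
Variables (K : fieldType) (c l : K).
Hypothesis c_neq0 : c != 0.
Hypothesis two_neq0 : 2%:R != 0 :> K.
Local Notation s := (schroedinger K).
Local Notation V := (int -> int -> K^o).

(* [a i j] is the coefficient of F^i q^j v in a formal series; letting [i] and [j]
   range over all integers avoids boundary cases in the relations. *)
Definition model_act (x : s) (a : V) : V := fun i j =>
  (x Be : K) * ((i%:~R + 1) * (l + 2%:R^-1 - i%:~R) * a (i + 1) j
                + c / 2%:R * (j%:~R + 1) * (j%:~R + 2%:R) * a i (j + 1 + 1))
  + (x Bh : K) * ((l - 2%:R * i%:~R - j%:~R) * a i j)
  + (x Bf : K) * (a (i - 1) j - (2%:R * c)^-1 * a i (j - 1 - 1))
  + (x Bp : K) * (c * (j%:~R + 1) * a i (j + 1)) + (x Bq : K) * a i (j - 1)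
  + (x Bz : K) * (c * a i j).

Fact model_act_linear x : linear (model_act x).
Proof.
move=> b a a'; apply/funext => i; apply/funext => j.
rewrite /model_act /= !fctE /GRing.scale /=. 
by ring.
Qed.

Fact model_act_linearl a : linear (model_act^~ a).
Proof.
move=> b x y; apply/funext => i; apply/funext => j.
rewrite /model_act /= !fctE !ffunE /GRing.scale /=; ring.
Qed.

Fact model_act_lie x y a :
  model_act (lie x y) a = model_act x (model_act y a) - model_act y (model_act x a).
Proof.
apply/funext => i; apply/funext => j.
rewrite /model_act /= !fctE [lie x y]/(slie x y) !slieE /=.
rewrite !(addrK, subrK) !(intrD, intrB) /=.
field.
by rewrite two_neq0 c_neq0.
Qed.

Definition model : lmodType (env s) :=
  env_module model_act_linear model_act_linearl model_act_lie.

Definition model_vec : model := fun i j => ((i == 0) && (j == 0))%:R : K^o.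

Lemma model_actE k (a : model) : act k (a : kvect model) = model_act (sbv K k) a :> model.
Proof. exact: env_module_gen. Qed.

Lemma model_scaleE (b : K) (a : model) :
  (b *: (a : kvect model) : kvect model) = (fun i j => b * a i j : K^o) :> model.
Proof. by rewrite kvect_scaleE env_algE [LHS]env_module_scal. Qed.

Lemma model_vec_neq0 : model_vec <> 0.
Proof.
move=> /(congr1 (fun a : model => a 0 0)) /eqP.
by rewrite /model_vec /= [X in _ == X](_ : _ = 0) // oner_eq0.
Qed.

(** The shifted delta families are supported at [j = -1], [i = -1] and [j = -2], exactly where the
    polynomial coefficients [j + 1], [i + 1] and [j + 2] vanish. *)
Lemma model_vec_singular : msingular (model_vec : kvect model).
Proof.
split; rewrite /= [LHS]model_actE; apply/funext => i; apply/funext => j.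
  transitivity (c * (j%:~R + 1) * model_vec i (j + 1) : K).
    by rewrite /model_act !ffunE !sbasis_eqE /=; ring.
  rewrite /model_vec; have [|_] := boolP (j + 1 == 0); last by rewrite andbF mulr0.
  by rewrite addr_eq0 => /eqP ->; rewrite rmorphN1 addNr mulr0 mul0r.
transitivity ((i%:~R + 1) * (l + 2%:R^-1 - i%:~R) * model_vec (i + 1) j
    + c / 2%:R * (j%:~R + 1) * (j%:~R + 2%:R) * model_vec i (j + 1 + 1) : K).
  by rewrite /model_act !ffunE !sbasis_eqE /=; ring.
rewrite /model_vec.
have -> : (i%:~R + 1) * (l + 2%:R^-1 - i%:~R) * ((i + 1 == 0) && (j == 0))%:R = 0 :> K.
  have [|_] := boolP (i + 1 == 0); last by rewrite mulr0.
  by rewrite addr_eq0 => /eqP ->; rewrite rmorphN1 addNr !mul0r.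
rewrite add0r; have [|_] := boolP (j + 1 + 1 == 0); last by rewrite andbF mulr0.
rewrite addr_eq0 => /eqP /(congr1 (fun k : int => k%:~R : K)).
rewrite intrD rmorphN1 => jE.
by rewrite -[2%:R]/(1 + 1 : K) [j%:~R + (1 + 1)]addrA [j%:~R + 1]jE addNr mulr0 mul0r.
Qed.

Lemma model_vec_weight (lam : hdual K) : lam (elh K) = l -> lam (elz K) = c ->
  is_weight lam model_vec.
Proof.
move=> lh lz; apply/(is_weightP lam (model_vec : kvect model)); split.
  rewrite /= [LHS]model_actE [RHS]model_scaleE; apply/funext => i; apply/funext => j.
  transitivity ((l - 2%:R * i%:~R - j%:~R) * model_vec i j : K).
    by rewrite /model_act !ffunE !sbasis_eqE /=; ring.
  rewrite /model_vec lh; have [->|_] := eqVneq i 0; last by rewrite !mulr0.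
  have [->|_] := eqVneq j 0; last by rewrite !mulr0.
  by rewrite mulr0 !subr0.
rewrite /= [LHS]model_actE [RHS]model_scaleE; apply/funext => i; apply/funext => j.
by rewrite lz /model_act !ffunE !sbasis_eqE /=; ring.
Qed.
End ModelModule.

(** * The universal properties of extension of scalars and of Verma modules *)

Section ExtensionLift.
Local Open Scope quotient_scope.
Variables (B A : pzRingType) (f : {rmorphism B -> A}) (N : lmodType B) (M : lmodType A).
Variable phi : N -> M.
Hypothesis phi_add : {morph phi : x y / x + y}.
Hypothesis phi_scale : forall b x, phi (b *: x) = f b *: phi x.

Fixpoint tterm_eval (t : tterm A N) : M :=
  match t with
  | TPure a n => a *: phi n
  | TZero => 0
  | TOpp t => - tterm_eval t
  | TAdd t u => tterm_eval t + tterm_eval u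
  end.

Lemma tterm_eval_eq t u : teq f t u -> tterm_eval t = tterm_eval u.
Proof.
move=> tu; elim: t u / tu => //=.
- by move=> t u v _ -> _ ->.
- by move=> t u _ ->.
- by move=> t t' u u' _ -> _ ->.
- by move=> *; rewrite addrA.
- by move=> *; rewrite addrC.
- by move=> *; rewrite add0r.
- by move=> *; rewrite addNr.
- by move=> *; rewrite scalerDl.
- by move=> *; rewrite phi_add scalerDr.
by move=> *; rewrite phi_scale scalerA.
Qed.

Definition ext_lift (x : ext_scal f N) : M := tterm_eval (repr x).

Lemma ext_lift_pi t : ext_lift (\pi_(ext_scal f N) t) = tterm_eval t.
Proof. by apply: tterm_eval_eq; apply/ext_scalP; rewrite reprK. Qed.

Fact ext_lift_linear : linear ext_lift.
Proof.
move=> a; elim/ext_ind=> t; elim/ext_ind=> u.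
rewrite [a *: _]extZ_pi -pi_extD !ext_lift_pi /=; congr (_ + _).
by elim: t => /= [b n||t ->|t -> t' ->]; rewrite ?scalerA ?scaler0 ?scalerN ?scalerDr.
Qed.

Lemma ext_lift_exists : exists g : {linear ext_scal f N -> M},
  forall a n, g (tensor f a n) = a *: phi n.
Proof.
pose g : {linear ext_scal f N -> M} :=
  HB.pack ext_lift (GRing.isLinear.Build A (ext_scal f N) M *:%R ext_lift ext_lift_linear).
by exists g => a n; apply: ext_lift_pi.
Qed.
End ExtensionLift.

Section VermaModule.
Local Open Scope quotient_scope.
Variables (K : fieldType) (lam : hdual K).
Local Notation s := (schroedinger K).
Local Notation U := (env s).
Local Notation verma := (verma lam).
Local Notation N := (one_dim_mod lam).

Definition verma_vec : verma := tensor (env_incl (@bb_lie K)) 1 ((1 : K^o) : N).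

Lemma tensorM (u : U) (n : N) :
  tensor (env_incl (@bb_lie K)) u n = u *: tensor (env_incl (@bb_lie K)) 1 n.
Proof. by rewrite [RHS]extZ_pi /= mulr1. Qed.

Lemma tensor_scale (b : env (sublie (@bb_lie K))) (n : N) :
  tensor (env_incl (@bb_lie K)) 1 (b *: n) =
  env_incl (@bb_lie K) b *: tensor (env_incl (@bb_lie K)) 1 n.
Proof.
rewrite -tensorM; apply/ext_scalP; apply: teq_sym.
by rewrite -{1}[env_incl _ b]mul1r; apply: teq_pureM.
Qed.

Lemma one_dimE (b : env (sublie (@bb_lie K))) (n : K^o) :
  b *: (n : N) = env_lift (@bchar_lie K lam) b * n.
Proof. by []. Qed.

Lemma tensor_vec (n : K^o) :
  tensor (env_incl (@bb_lie K)) 1 (n : N) = (n : K)%:A *: verma_vec.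
Proof.
rewrite -(env_incl_scal (@bb_lie K)) -tensor_scale one_dimE.
by rewrite -env_algE linearZ /= rmorph1 mulr1 [n *: _]mulr1.
Qed.

Lemma verma_ind (P : verma -> Prop) : is_submod P -> P verma_vec -> forall x, P x.
Proof.
case=> P0 PD PZ Pv; elim/ext_ind; elim=> [u n||t Pt|t Pt u Pu].
- by rewrite -/(tensor _ u n) tensorM tensor_vec; apply/PZ/PZ.
- exact: P0.
- by rewrite pi_extN -scaleN1r; apply: PZ.
by rewrite pi_extD; apply: PD.
Qed.

Lemma verma_gen (x : sublie (@bb_lie K)) :
  env_gen (sublie_val x) *: verma_vec = (bchar lam x : K)%:A *: verma_vec.
Proof.
rewrite -env_incl_gen -tensor_scale one_dimE mulr1 [env_lift _ _]env_lift_gen.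
exact: tensor_vec.
Qed.

Lemma bb_gen (x : s) : x \in bb K -> exists y : sublie (@bb_lie K), sublie_val y = x.
Proof. by move=> xb; exists (Subvs xb). Qed.

Lemma verma_vec_weight : is_weight lam verma_vec.
Proof.
move=> H; have [y yE] : exists y : sublie (@bb_lie K), sublie_val y = vsval H.
  by apply/bb_gen/(subvP (addvSl _ _))/subvsP.
by rewrite -yE verma_gen /bchar yE -hhE.
Qed.

Lemma verma_vec_singular : msingular (verma_vec : kvect verma).
Proof.
have sing i : sbv K i \in nplus K -> env_gen (sbv K i : s) *: verma_vec = 0.
  move=> i_n; have [y yE] : exists y : sublie (@bb_lie K), sublie_val y = sbv K i.
    by apply/bb_gen/(subvP (addvSr _ _)).
  have [a [b iE]] := nplusP _ i_n.
  rewrite -yE verma_gen /bchar yE iE !ffunE !sbasis_eqE !scaler0 addr0 !scale0r addr0.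
  by rewrite linear0 !scale0r.
by split; apply: sing; [apply: mem_p | apply: mem_e].
Qed.

Lemma verma_lift (M : lmodType U) (m : kvect M) : is_weight lam (m : M) -> msingular m ->
  exists g : {linear verma -> M}, g verma_vec = m.
Proof.
move=> m_lam [pm em]; pose phi (n : N) : M := ((n : K) *: m : kvect M).
have /is_weightP[hm zm] := m_lam.
have phi_add : {morph phi : x y / x + y} by move=> x y; rewrite /phi !scalerDl.
have phi_scale b x : phi (b *: x) = env_incl (@bb_lie K) b *: phi x.
  elim/env_ind: b x => t; elim: t => [y|a|t IHt u IHu|t IHt u IHu] x.
  (* On [m] an element of the Borel subalgebra acts through its [h] and [z] coordinates: [e] and [p]
     kill [m], and the [f] and [q] coordinates are 0. *)
  - rewrite -/(env_gen y) env_incl_gen one_dimE [env_lift _ _]env_lift_gen act_gen big_sbasis.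
    have [-> ->] : sublie_val y Bf = 0 /\ sublie_val y Bq = 0.
      by apply/bb_coord/(subvsP (y : subvs_of (bb K))).
    have phiE i : act i (phi x) = (x : K) *: act i m by rewrite /phi linearZ.
    rewrite !phiE pm em hm zm !scaler0 !scale0r !addr0 add0r /phi !scalerA -scalerDl.
    congr (_ *: _); congr (GRing.in_alg _ _); rewrite [LHS](_ : _ = bchar lam y * x) //.
    by rewrite /bchar (linearP lam) (linearZ_LR lam) /= /GRing.scale /=; ring.
  - rewrite -/(env_scal _ a) env_incl_scal -kvect_scaleE /phi scalerA one_dimE -env_algE.
    by congr (_ *: m); rewrite linearZ /= rmorph1 [a *: _]mulr1.
  - by rewrite pi_envD scalerDl phi_add IHt IHu rmorphD scalerDl.
  by rewrite pi_envM -scalerA IHt IHu rmorphM scalerA.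
have [g gE] := ext_lift_exists phi_add phi_scale; exists g.
by rewrite gE scale1r /phi scale1r.
Qed.

Section Generic.
Variables (xi : set (hdual K)) (c : K).
Hypothesis pchar0 : forall n, n.+1%:R != 0 :> K.
Hypothesis c_neq0 : c != 0.
Hypothesis xi_charge : is_central_charge xi c.
Hypothesis xi_generic : forall lam, xi lam -> generic (lam (elh K)).
Hypothesis xi_lower : forall lam n, xi lam -> xi (lam - hvee K *+ n).
Hypothesis xi_lam : xi lam.

(** The universal property maps this vector to [model_vec], which is visibly nonzero. *)
Lemma verma_vec_neq0 : verma_vec <> 0.
Proof.
move=> v0; have lz := xi_charge xi_lam.
have [g gv] := verma_lift (@model_vec_weight K c _ c_neq0 (pchar0 1) lam erefl lz)
  (@model_vec_singular K c _ c_neq0 (pchar0 1)).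
by have := @model_vec_neq0 K c (lam (elh K)) c_neq0 (pchar0 1); rewrite -gv v0 linear0.
Qed.

Definition verma_line (x : kvect verma) : Prop := exists a : K, x = a *: (verma_vec : kvect verma).

Lemma verma_line_singular x : verma_line x -> msingular x.
Proof. by move=> [a ->]; apply/msingularZ/verma_vec_singular. Qed.

Lemma verma_line_weight x : verma_line x -> is_weight lam (x : verma).
Proof. by move=> [a ->]; apply/is_weightZ/verma_vec_weight. Qed.

Lemma verma_line0 : verma_line 0.
Proof. by exists 0; rewrite scale0r. Qed.

Lemma verma_lineD x y : verma_line x -> verma_line y -> verma_line (x + y).
Proof. by move=> [a ->] [b ->]; exists (a + b); rewrite scalerDl. Qed.

Lemma verma_lineZ a x : verma_line x -> verma_line (a *: x).
Proof. by move=> [b ->]; exists (a * b); rewrite scalerA. Qed.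

Lemma verma_charged : charged c verma.
Proof.
apply: verma_ind => [|/=].
  apply: is_submod_gen => [|x y xE yE|a x xE|i x xE].
  - by rewrite (linear0 (act Bz)) scaler0.
  - by rewrite [LHS]scalerDr [X in X + _]xE [X in _ + X]yE [RHS]scalerDr.
  - by rewrite [LHS]linearZ /= xE !scalerA mulrC.
  by rewrite act_z xE linearZ.
by have /is_weightP[_ ->] := verma_vec_weight; rewrite xi_charge.
Qed.

Lemma verma_mspan x : mspan c verma_line x.
Proof.
apply: verma_ind x.
  apply: (mspan_submod pchar0 c_neq0 xi_generic verma_charged verma_line_singular).
    by move=> x /verma_line_weight x_lam; exists lam.
  exact: verma_lineZ.
by apply: aspan_gen; exists 0%N, 0%N, verma_vec; split=> //; exists 1; rewrite scale1r.
Qed.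

Lemma verma_isotypic : isotypic xi lam verma.
Proof.
apply: (mspan_isotypic pchar0 c_neq0 xi_generic xi_lower xi_lam verma_charged
  verma_line_singular verma_line_weight verma_line0 verma_lineD).
exact: verma_mspan.
Qed.

(** A nonzero submodule contains a nonzero singular vector, and all singular vectors are multiples
    of the generator [verma_vec]. *)
Lemma verma_submod (P : verma -> Prop) x : is_submod P -> P x -> x <> 0 -> forall y, P y.
Proof.
move=> Psub Px x0; apply: verma_ind => //.
have [y [Py y0 y_sing]] := submod_singular xi_charge verma_isotypic.1 Psub Px x0.
have [a yE] : verma_line y.
  apply: (mspan_singular pchar0 c_neq0 xi_generic xi_lam verma_charged
    verma_line_singular verma_line_weight verma_line0 verma_lineD) => //.
  exact: verma_mspan.
have a0 : a != 0 by apply: contra_notN y0 => /eqP a0; rewrite yE a0 scale0r.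
have -> : verma_vec = a^-1%:A *: (y : verma).
  by rewrite yE -[RHS]kvect_scaleE scalerK.
by case: Psub => _ _; apply.
Qed.

Lemma verma_simple : simple_module verma.
Proof.
split; first by exists verma_vec; apply/eqP/verma_vec_neq0.
move=> S [S0 S_lin]; have [[x [Sx x0]]|S_zero] := pselect (exists x, x \in S /\ x <> 0).
  right=> y; apply: (@verma_submod (fun z => z \in S) x) => //.
  split=> // [u v Su Sv|a u Su]; first by have := S_lin 1 u v Su Sv; rewrite scale1r.
  by have := S_lin a u 0 Su S0; rewrite addr0.
left=> x; rewrite [RHS]inE; apply/idP/eqP => [Sx|->//].
by apply: contrapT => x0; apply: S_zero; exists x.
Qed.

Lemma verma_fin_generated : fin_generated verma.
Proof.
apply/fin_generatedP; exists [:: verma_vec] => P Psub Pv.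
by apply: verma_ind => //; apply: Pv; rewrite mem_head.
Qed.
End Generic.
End VermaModule.

(** * Blocks *)

Section Bases.
Variable K : fieldType.
Implicit Types V W : lmodType K.

Definition lin_comb V n (b : 'I_n -> V) (a : 'rV[K]_n) : V := \sum_i a 0 i *: b i.

Fact lin_comb_linear V n (b : 'I_n -> V) : linear (lin_comb b).
Proof.
move=> k x y; rewrite /lin_comb scaler_sumr -big_split; apply: eq_bigr => i _.
by rewrite !mxE scalerDl scalerA.
Qed.
HB.instance Definition _ V n (b : 'I_n -> V) :=
  GRing.isLinear.Build K 'rV[K]_n V *:%R (lin_comb b) (lin_comb_linear b).

Definition is_basis V n (b : 'I_n -> V) : Prop := bijective (lin_comb b).

Lemma fin_generated_basis V : fin_generated V -> exists n (b : 'I_n -> V), is_basis b.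
Proof.
move=> V_fg; pose gens n := exists b : 'I_n -> V, forall x, exists a, lin_comb b a = x.
have ex : exists n, `[< gens n >].
  have [n [g gE]] := V_fg; exists n; apply/asboolP; exists g => x.
  have : [set: V]%classic x by [].
  rewrite gE => -[a ->]; exists (\row_i a i).
  by apply: eq_bigr => i _; rewrite mxE.
case: (ex_minnP ex) => n /asboolP[b b_gen] n_min; exists n, b.
apply: inj_surj_bij => //; apply: raddf_inj => a a_ker; apply/rowP => k; rewrite mxE.
apply/eqP; apply: contraT => ak.
case: n => [|n] in b b_gen n_min a a_ker k ak *; first by case: k {ak}.
suff /n_min : `[< gens n >] by rewrite ltnn.
apply/asboolP; exists (fun j => b (lift k j)) => x; have [d <-] := b_gen x.
(* The multiple of the relation [a] subtracted from [d] is the one that makes coordinate [k]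
   vanish. *)
exists (\row_j (d 0 (lift k j) - d 0 k / a 0 k * a 0 (lift k j))).
transitivity (lin_comb b (d - (d 0 k / a 0 k) *: a)); last first.
  by rewrite linearB linearZ /= a_ker scaler0 subr0.
rewrite [RHS]/lin_comb (bigD1_ord k) //= !mxE divfK // subrr scale0r add0r.
by apply: eq_bigr => j _; rewrite !mxE.
Qed.

Lemma basis_iso V W n (b : 'I_n -> V) (b' : 'I_n -> W) : is_basis b -> is_basis b' ->
  exists (f : {linear V -> W}) (g : {linear W -> V}), cancel f g /\ cancel g f.
Proof.
case=> g bg gb [g' b'g' g'b'].
pose gl : {linear V -> 'rV[K]_n} :=
  HB.pack g (GRing.isLinear.Build K V 'rV[K]_n *:%R g (can2_linear bg gb)).
pose gl' : {linear W -> 'rV[K]_n} :=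
  HB.pack g' (GRing.isLinear.Build K W 'rV[K]_n *:%R g' (can2_linear b'g' g'b')).
exists (lin_comb b' \o gl), (lin_comb b \o gl').
by split=> x /=; rewrite ?b'g' ?gb ?bg ?g'b'.
Qed.
End Bases.

Section Powers.
Variables (A : pzRingType) (M : lmodType A).

Definition power_inj n (i : 'I_n) (x : M) : {ffun 'I_n -> M} :=
  [ffun j => if j == i then x else 0].

Fact power_inj_linear n (i : 'I_n) : linear (power_inj i).
Proof.
move=> a x y; apply/ffunP => j; rewrite !ffunE.
by case: eqP => // _; rewrite scaler0 addr0.
Qed.
HB.instance Definition _ n (i : 'I_n) :=
  GRing.isLinear.Build A M {ffun 'I_n -> M} *:%R (power_inj i) (power_inj_linear i).

Definition power_proj n (i : 'I_n) (x : {ffun 'I_n -> M}) : M := x i.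
Fact power_proj_linear n (i : 'I_n) : linear (power_proj i).
Proof. by move=> a x y; rewrite /power_proj !ffunE. Qed.
HB.instance Definition _ n (i : 'I_n) :=
  GRing.isLinear.Build A {ffun 'I_n -> M} M *:%R (power_proj i) (power_proj_linear i).

Definition power_tail n (x : {ffun 'I_n.+1 -> M}) : {ffun 'I_n -> M} :=
  [ffun i => x (lift ord0 i)].
Fact power_tail_linear n : linear (@power_tail n).
Proof. by move=> a x y; apply/ffunP => j; rewrite !ffunE. Qed.
HB.instance Definition _ n :=
  GRing.isLinear.Build A {ffun 'I_n.+1 -> M} {ffun 'I_n -> M} *:%R
    (@power_tail n) (@power_tail_linear n).

Lemma power_sum n (x : {ffun 'I_n -> M}) : x = \sum_i power_inj i (x i).
Proof.
apply/ffunP => j; rewrite sum_ffunE (bigD1 j) //= ffunE eqxx big1 ?addr0 // => i ij.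
by rewrite ffunE eq_sym (negPf ij).
Qed.

(** The induction step that puts all finite powers of a module into any Serre class containing
    it. *)
Lemma power_short_exact n :
  short_exact (power_inj (ord0 : 'I_n.+1) : {linear _ -> _}) (@power_tail n : {linear _ -> _}).
Proof.
split=> [x y /ffunP/(_ ord0)|y|m]; first by rewrite !ffunE.
  exists [ffun j => if unlift ord0 j is Some i then y i else 0].
  by apply/ffunP => i; rewrite !ffunE liftK.
split=> [m0|[l <-]]; last by apply/ffunP => i; rewrite !ffunE.
exists (m ord0); apply/ffunP => j; rewrite ffunE; case: (unliftP ord0 j) => [i ->|-> //].
by have /ffunP/(_ i) := m0; rewrite !ffunE.
Qed.
End Powers.

Lemma alg_scale_eq0 (K : fieldType) (M : lmodType (env (schroedinger K))) (a : K) (x : M) :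
  a%:A *: x = 0 -> a = 0 \/ x = 0.
Proof.
move=> ax; have [->|a0] := eqVneq a 0; [by left | right].
have <- : a^-1 *: (a *: (x : kvect M)) = x := scalerK a0 _.
by rewrite [X in _ *: X]ax; apply: scaler0.
Qed.

Fact weight_val_linear (K : fieldType) (M : lmodType (env (schroedinger K))) (lam : hdual K) :
  linear (@weight_val K M lam).
Proof. exact: (linearP (val : weight_space M lam -> kvect M)). Qed.
HB.instance Definition _ (K : fieldType) (M : lmodType (env (schroedinger K))) (lam : hdual K) :=
  GRing.isLinear.Build K (weight_space M lam) (kvect M) *:%R (@weight_val K M lam)
    (@weight_val_linear K M lam).

Section Blocks.
Variables (K : fieldType) (xi : set (hdual K)) (c : K).
Hypothesis pchar0 : forall n, n.+1%:R != 0 :> K.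
Hypothesis c_neq0 : c != 0.
Hypothesis xi_charge : is_central_charge xi c.
Hypothesis xi_generic : forall lam, xi lam -> generic (lam (elh K)).
Hypothesis xi_lower : forall lam n, xi lam -> xi (lam - hvee K *+ n).
Local Notation s := (schroedinger K).
Local Notation U := (env s).
Implicit Types M N L : lmodType U.

Section Block.
Variable lam : hdual K.
Hypothesis xi_lam : xi lam.

Definition verma_power n : lmodType U := {ffun 'I_n -> verma lam}.

Let verma_iso := verma_isotypic pchar0 c_neq0 xi_charge xi_generic xi_lower xi_lam.

Lemma verma_power_isotypic n : isotypic xi lam (verma_power n).
Proof.
split=> [|x x_sing].
  apply: locally_O_aspan => y; rewrite [y]power_sum.
  elim/big_ind: _ => [||i _]; [exact: aspan0|exact: aspanD|].
  apply: aspan_gen; exists (verma lam), (power_inj i), (y i); split=> //.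
  exact: verma_iso.1.
move=> H; apply/ffunP => i; rewrite !ffunE.
exact: (verma_iso.2 _ (msingular_map (power_proj i) x_sing)).
Qed.

Lemma verma_power_fin_generated n : fin_generated (verma_power n).
Proof.
apply/fin_generatedP; exists [seq power_inj i (verma_vec lam) | i : 'I_n] => P Psub Pv v.
rewrite [v]power_sum; apply: submod_sum => // i.
move: (v i); apply: verma_ind; last by apply/Pv/codom_f.
case: Psub => P0 PD PZ.
by split=> [|x y Px Py|a x Px]; rewrite ?linear0 ?linearD ?linearZ //; [apply: PD|apply: PZ].
Qed.

Lemma weight_spaceP N (v : weight_space N lam) : is_weight lam (v : N).
Proof. by apply/asboolP; apply: weight_valP. Qed.

Lemma weight_space_of N (x : N) : is_weight lam x -> exists v : weight_space N lam, (v : N) = x.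
Proof. by move=> /asboolP x_lam; exists (WeightSpace x_lam). Qed.

Lemma verma_power_basis n : exists b : 'I_n -> weight_space (verma_power n) lam, is_basis b.
Proof.
have v_wt i : is_weight lam (power_inj i (verma_vec lam) : verma_power n).
  exact: is_weight_map (verma_vec_weight lam).
pose b i := sval (cid (weight_space_of (v_wt i))).
have bE i : (b i : verma_power n) = power_inj i (verma_vec lam) :=
  svalP (cid (weight_space_of (v_wt i))).
exists b.
have combE a i : (lin_comb b a : verma_power n) i = (a 0 i)%:A *: verma_vec lam.
  have -> : (lin_comb b a : verma_power n) = \sum_j (a 0 j)%:A *: (b j : verma_power n).
    rewrite /lin_comb (linear_sum (@weight_val _ _ lam)); apply: eq_bigr => j _.
    by rewrite (linearZ_LR (@weight_val _ _ lam)).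
  rewrite sum_ffunE (bigD1 i) //= ffunE bE ffunE eqxx big1 ?addr0 // => j ji.
  by rewrite ffunE bE ffunE eq_sym (negPf ji) scaler0.
apply: inj_surj_bij => [|y].
  apply: raddf_inj => a a0; apply/rowP => i; rewrite mxE.
  have : (a 0 i)%:A *: verma_vec lam = 0 by rewrite -combE a0 ffunE.
  move=> /alg_scale_eq0[//|v0].
  by case: (verma_vec_neq0 pchar0 c_neq0 xi_charge xi_lam).
have y_line i : exists a : K, (y : verma_power n) i = a%:A *: verma_vec lam.
  apply: (mspan_weight pchar0 (verma_charged xi_charge xi_lam) (@verma_line_weight _ lam)
    (verma_line0 lam) (@verma_lineD _ lam)).
    exact: (verma_mspan pchar0 c_neq0 xi_charge xi_generic xi_lam).
  exact: (is_weight_map (power_proj i : {linear verma_power n -> verma lam}) (weight_spaceP y)).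
exists (\row_i sval (cid (y_line i))); apply: val_inj; apply/ffunP => i.
by rewrite combE mxE -(svalP (cid (y_line i))).
Qed.

(** The K-linear span, as an intersection of subspaces, so that no coefficients have to be
    carried. *)
Definition kspan N (r : seq N) (x : kvect N) : Prop :=
  forall P : kvect N -> Prop, is_submod P -> (forall y : N, y \in r -> P y) -> P x.

Lemma kspan_submod N (r : seq N) : is_submod (kspan r : kvect N -> Prop).
Proof.
split=> [P [] //|x y rx ry P Psub Pr|a x rx P Psub Pr]; case: (Psub) => P0 PD PZ.
  by apply: PD; [apply: rx | apply: ry].
by apply: PZ; apply: rx.
Qed.

Lemma kspan_mono N (r r' : seq N) : {subset r <= r'} ->
  forall x, mspan c (kspan r) x -> mspan c (kspan r') x.
Proof.
move=> rr'; apply: aspan_mono => _ [j [i [y [ry ->]]]]; exists j, i, y; split=> //.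
by move=> P Psub Pr'; apply: ry => // z /rr'; apply: Pr'.
Qed.

Lemma mspan_kspan N (x : kvect N) : mspan c (@msingular K N) x ->
  exists r : seq N, (forall y : kvect N, (y : N) \in r -> msingular y) /\ mspan c (kspan r) x.
Proof.
elim=> [_ [j [i [y [y_sing ->]]]]||u v _ [r [r_sing ru]] _ [r' [r'_sing r'v]]].
- exists [:: y : N]; split=> [z|]; first by rewrite inE => /eqP ->.
  by apply: aspan_gen; exists j, i, y; split=> // P _; apply; rewrite mem_head.
- by exists [::]; split=> //; apply: aspan0.
exists (r ++ r'); split=> [y|]; first by rewrite mem_cat => /orP[/r_sing|/r'_sing].
by apply: aspanD; [apply: kspan_mono ru | apply: kspan_mono r'v] => y yr;
  rewrite mem_cat yr ?orbT.
Qed.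

(** The finitely many generators involve only finitely many singular vectors [r]. The submodule
    obtained from the span of [r] is then everything, and its vectors of weight [lam] lie in that
    span by [mspan_weight]. *)
Lemma isotypic_weight_fin N : isotypic xi lam N -> fin_generated N ->
  fin_generated (weight_space N lam).
Proof.
move=> N_iso /fin_generatedP[g gP].
have N_charged := locally_O_charged xi_charge N_iso.1.
have [r [r_sing rg]] : exists r : seq N, (forall y : kvect N, (y : N) \in r -> msingular y) /\
    (forall y : N, y \in g -> mspan c (kspan r) y).
  elim: (g) => [|x g' [r [r_sing rg']]]; first by exists [::]; split.
  have [r' [r'_sing r'x]] :=
    mspan_kspan (isotypic_mspan pchar0 c_neq0 xi_charge xi_generic x N_iso).
  exists (r ++ r'); split=> y; first by rewrite mem_cat => /orP[/r_sing|/r'_sing].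
  rewrite inE => /predU1P[->|/rg' ry];
    [apply: kspan_mono r'x | apply: kspan_mono ry] => z zr; by rewrite mem_cat zr ?orbT.
have S_sing (x : kvect N) : kspan r x -> msingular x.
  apply=> //; split; [exact: msingular0 | exact: msingularD | move=> a y; exact: msingularZ].
have S_wt (x : kvect N) : kspan r x -> is_weight lam (x : N) by move=> /S_sing; apply: N_iso.2.
have [S0 SD SZ] := kspan_submod r.
have r_full : forall x : N, mspan c (kspan r) x.
  apply: gP rg; apply: (mspan_submod pchar0 c_neq0 xi_generic N_charged S_sing) => //.
  by move=> x /S_wt; exists lam.
(* [pmap] only repackages [r] inside the weight space; every element of [r] has weight [lam], so
   none is dropped. *)
apply/fin_generatedP; exists (pmap (fun x : N =>
  if pselect (exists v : weight_space N lam, (v : N) = x) is left e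
  then Some (sval (cid e)) else None) r).
move=> P Psub Pr v; have rv : kspan r (v : kvect N).
  exact: (mspan_weight pchar0 N_charged S_wt S0 SD (r_full v) (weight_spaceP v)).
have [w wv Pw] : exists2 w : weight_space N lam, (w : kvect N) = v & P w.
  apply: (rv (fun x => exists2 w : weight_space N lam, (w : kvect N) = x & P w)).
    case: Psub => P0 PD PZ; split=> [|_ _ [w <- Pw] [w' <- Pw']|a _ [w <- Pw]].
    - by exists 0.
    - by exists (w + w'); [rewrite linearD | apply: PD].
    by exists (a *: w); [rewrite linearZ | apply: PZ].
  move=> y yr; have [w wy] := weight_space_of (N_iso.2 _ (r_sing _ yr)).
  exists w => //; apply: Pr; rewrite mem_pmap; apply/mapP; exists y => //.
  case: pselect => [e|[]]; last by exists w.
  by congr Some; apply: val_inj; rewrite /= wy (svalP (cid e)).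
by have -> : v = w by apply: val_inj.
Qed.

(** Bases of equal length give inverse maps between the weight spaces. Both extend to the modules,
    and the composites are identities because maps out of an isotypic module are determined on
    weight [lam]. *)
Lemma isotypic_power N : isotypic xi lam N -> fin_generated N ->
  exists n (f : {linear verma_power n -> N}) (g : {linear N -> verma_power n}),
    cancel f g /\ cancel g f.
Proof.
move=> N_iso N_fg; have [n [b b_basis]] := fin_generated_basis (isotypic_weight_fin N_iso N_fg).
have [b' b'_basis] := verma_power_basis n.
have [phi [psi [phiK psiK]]] := basis_iso b'_basis b_basis.
have V_iso := verma_power_isotypic n.
have ext L L' (L_iso : isotypic xi lam L) (L'_iso : isotypic xi lam L') theta :=
  @isotypic_extend _ _ _ pchar0 c_neq0 xi_charge xi_generic lam L L' theta L_iso L'_iso.1 xi_lam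
    (fun x => @isotypic_weight _ _ _ pchar0 c_neq0 xi_charge xi_generic lam L' x L'_iso).
have [f fE] := ext _ _ V_iso N_iso phi; have [g gE] := ext _ _ N_iso V_iso psi.
exists n, f, g; split.
  apply: (isotypic_hom_eq pchar0 c_neq0 xi_charge xi_generic (f := g \o f) (g := idfun) V_iso).
  move=> x /weight_space_of[v <-]; transitivity (weight_val (weight_map g (weight_map f v))) => //.
  by rewrite fE gE phiK.
apply: (isotypic_hom_eq pchar0 c_neq0 xi_charge xi_generic (f := f \o g) (g := idfun) N_iso).
move=> x /weight_space_of[v <-]; transitivity (weight_val (weight_map f (weight_map g v))) => //.
by rewrite gE fE psiK.
Qed.

Lemma in_Oxi_isotypic_block N : in_Oxi N xi -> isotypic xi lam N -> in_block xi lam N.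
Proof.
move=> N_O N_iso; split=> // S [SB [M0 SM0] S_ses] S_verma.
have power_O n : in_Oxi (verma_power n) xi.
  apply/(in_OxiP xi pchar0); split; first exact: verma_power_fin_generated.
  exact: (verma_power_isotypic n).1.
have verma_O := SB _ S_verma.
(* [verma_power 0] is the zero module; it is the kernel of the identity of the given member [M0] of
   the class. *)
have S_zero : S (verma_power 0).
  have ex : short_exact (\0 : {linear verma_power 0 -> M0}) (idfun : {linear M0 -> M0}).
    split=> [x y _|y|m]; first by apply/ffunP => -[].
      by exists y.
    by split=> [/= ->|[l <-] //]; exists 0.
  by have [/(_ SM0)[]] := S_ses _ _ _ _ _ (power_O 0%N) (SB _ SM0) (SB _ SM0) ex.
have S_power n : S (verma_power n).
  elim: n => // n IH.
  by apply/(S_ses _ _ _ _ _ verma_O (power_O _) (power_O n) (power_short_exact (verma lam) n)).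
have [n [f [g [fg gf]]]] := isotypic_power N_iso ((in_OxiP xi pchar0 N).1 N_O).1.
have ex : short_exact f (\0 : {linear N -> verma_power 0}).
  split=> [|y|m]; [exact: can_inj fg|by exists 0; apply/ffunP => -[]|].
  by split=> // _; exists (g m); apply: gf.
by apply/(S_ses _ _ _ _ _ (power_O n) N_O (power_O 0%N) ex); split; apply: S_power.
Qed.

Lemma in_blockP N : in_block xi lam N <-> in_Oxi N xi /\ isotypic xi lam N.
Proof.
split=> [[N_O N_S]|[N_O N_iso]]; last exact: in_Oxi_isotypic_block.
(* The isotypic modules of O[xi] form one of the Serre classes over which [in_block] quantifies. *)
apply: (N_S (fun M => in_Oxi M xi /\ isotypic xi lam M)).
  split=> [M []//||L M L' f g L_O M_O L'_O fg].
    exists (verma_power 0); split; last exact: verma_power_isotypic.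
    apply/(in_OxiP xi pchar0); split; first exact: verma_power_fin_generated.
    exact: (verma_power_isotypic 0).1.
  have O_loc X (X_O : in_Oxi X xi) := ((in_OxiP xi pchar0 X).1 X_O).2.
  have := isotypic_ses pchar0 c_neq0 xi_charge xi_generic xi_lam
    (O_loc _ L_O) (O_loc _ M_O) (O_loc _ L'_O) fg.
  tauto.
split; last exact: verma_iso.
by apply/(in_OxiP xi pchar0); split; [apply: verma_fin_generated | apply: verma_iso.1].
Qed.
End Block.
End Blocks.

(** * The two equivalences *)

Section Equivalences.
Variables (K : fieldType) (xi : set (hdual K)) (c : K).
Hypothesis pchar0 : forall n, n.+1%:R != 0 :> K.
Hypothesis c_neq0 : c != 0.
Hypothesis xi_charge : is_central_charge xi c.
Hypothesis xi_generic : forall lam, xi lam -> generic (lam (elh K)).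
Hypothesis xi_lower : forall lam n, xi lam -> xi (lam - hvee K *+ n).
Local Notation s := (schroedinger K).
Local Notation U := (env s).
Implicit Types M N L : lmodType U.

Let blockP lam (xi_lam : xi lam) N :=
  in_blockP pchar0 c_neq0 xi_charge xi_generic xi_lower xi_lam N.
Let O_P N := in_OxiP xi pchar0 N.

Lemma block_weight_fin lam : xi lam ->
  forall N, in_block xi lam N -> fin_generated (weight_space N lam).
Proof.
move=> xi_lam N /(blockP xi_lam)[/O_P[N_fg _] N_iso].
exact: (isotypic_weight_fin pchar0 c_neq0 xi_charge xi_generic xi_lam N_iso N_fg).
Qed.

Lemma weight_functor_equivalence lam (xi_lam : xi lam)
    (weight_fin : forall N, in_block xi lam N -> fin_generated (weight_space N lam)) :
  is_equivalence
    (restrict_functor (F := weight_functor lam) weight_fin :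
       functor (cat_block xi lam) (cat_fdvect K)).
Proof.
apply: ff_ess_surj_equivalence => [[N N_b] [N' N'_b] f g /= fg|[N N_b] [N' N'_b] k|[V V_fd]].
- have [_ N_iso] := (blockP xi_lam N).1 N_b.
  apply: linear_ext; apply: (isotypic_hom_eq pchar0 c_neq0 xi_charge xi_generic N_iso) => x.
  move=> /weight_space_of[v <-].
  by have /(congr1 (fun h : {linear _ -> _} => h v))/(congr1 val) := fg.
- have [_ N_iso] := (blockP xi_lam N).1 N_b; have [_ N'_iso] := (blockP xi_lam N').1 N'_b.
  have [g gE] := isotypic_extend pchar0 c_neq0 xi_charge xi_generic k N_iso N'_iso.1 xi_lam
    (fun x => isotypic_weight pchar0 c_neq0 xi_charge xi_generic N'_iso).
  by exists g; apply: linear_ext.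
have [n [b b_basis]] := fin_generated_basis V_fd.
have [b' b'_basis] := verma_power_basis pchar0 c_neq0 xi_charge xi_generic xi_lam n.
have [f [g [fg gf]]] := basis_iso b'_basis b_basis.
have P_b : in_block xi lam (verma_power lam n).
  have P_iso := verma_power_isotypic pchar0 c_neq0 xi_charge xi_generic xi_lower xi_lam n.
  apply/(blockP xi_lam); split=> //; apply/O_P; split; last exact: P_iso.1.
  exact: verma_power_fin_generated.
exists (exist _ (verma_power lam n) P_b), f, g.
by split; apply: linear_ext.
Qed.

Lemma weight_disjoint M (x : kvect M) lam mu : is_weight lam (x : M) -> is_weight mu (x : M) ->
  lam != mu -> x = 0.
Proof.
move=> /is_weightP[hl zl] /is_weightP[hm zm] lam_mu; apply: contrapT => x0.
have inj (a b : K) : a *: x = b *: x -> a = b.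
  move=> /eqP; rewrite -subr_eq0 -scalerBl scaler_eq0 subr_eq0 => /orP[/eqP //|/eqP //].
move/eqP: lam_mu; apply; apply: hdual_eq; apply: inj; first by rewrite -hl -hm.
by rewrite -zl -zm.
Qed.

Lemma isotypic_hom0 lam mu M N (f : {linear M -> N}) : isotypic xi lam M ->
  isotypic xi mu N -> lam != mu -> forall x, f x = 0.
Proof.
move=> M_iso N_iso lam_mu.
apply: (isotypic_hom_eq pchar0 c_neq0 xi_charge xi_generic (g := \0) M_iso) => x x_lam.
apply: (weight_disjoint (is_weight_map f x_lam) _ lam_mu).
by apply/N_iso.2/msingular_map/(isotypic_weight pchar0 c_neq0 xi_charge xi_generic M_iso).
Qed.

Lemma block_zero lam (xi_lam : xi lam) (M : cat_block xi lam) :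
  is_zero_ob M <-> forall x : sval M, x = 0.
Proof.
split=> [/(_ M)[[f f_uniq] _] x|M0 N].
  have := f_uniq (idm M); rewrite -(f_uniq (\0 : {linear sval M -> sval M})).
  by move=> /(congr1 (fun h : {linear sval M -> sval M} => h x)).
split; exists (\0 : {linear _ -> _}) => g; apply: linear_ext => x; last exact: M0.
by rewrite [x]M0 !linear0.
Qed.

Lemma dsum_in_Oxi (M : dsum_cat (fun lam : {lam | xi lam} => cat_block xi (sval lam))) :
  in_Oxi (dsum (fun lam => sval (sval M lam))) xi.
Proof.
case: M => M M_fin; apply/O_P; split.
  apply: dsum_fgen => [|[lam xi_lam]]; last first.
    by have /(blockP xi_lam)[/O_P[]] := svalP (M (exist _ lam xi_lam)).
  apply: (sub_finite_set _ M_fin) => -[lam xi_lam] /= [x x0] /(block_zero xi_lam).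
  by move=> /(_ x).
apply: locally_O_aspan; apply: dsum_ind_inj => [|[lam xi_lam] x y Iy]; first exact: aspan0.
apply: aspanD => //; apply: aspan_gen.
exists (sval (M (exist _ lam xi_lam))), (@dsum_inj _ _ (fun i => sval (M i)) (exist _ lam xi_lam)), x.
split=> //; have /(blockP xi_lam)[/O_P[_ //]] := svalP (M (exist _ lam xi_lam)).
Qed.

(** * Decomposition of a module into its isotypic components *)

Section Decomposition.
Variable X : lmodType U.
Hypothesis X_O : in_Oxi X xi.

Let X_loc : locally_O xi X := ((O_P X).1 X_O).2.
Let X_charged := locally_O_charged xi_charge X_loc.

Section Component.
Variable lam : hdual K.
Hypothesis xi_lam : xi lam.

Definition wt_sing (x : kvect X) : Prop := msingular x /\ is_weight lam (x : X).

Lemma wt_singD x y : wt_sing x -> wt_sing y -> wt_sing (x + y).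
Proof. by move=> [sx wx] [sy wy]; split; [apply: msingularD | apply: is_weightD]. Qed.

Lemma wt_singZ a x : wt_sing x -> wt_sing (a *: x).
Proof. by move=> [sx wx]; split; [apply: msingularZ | apply: is_weightZ]. Qed.

Lemma wt_sing0 : wt_sing 0.
Proof. by split; [apply: msingular0 | apply: is_weight0]. Qed.

Lemma component_submod : is_submod (mspan c wt_sing : X -> Prop).
Proof.
apply: (mspan_submod pchar0 c_neq0 xi_generic X_charged) => [x []//|x [_ wx]|].
  by exists lam.
exact: wt_singZ.
Qed.

(** The submodule generated by the singular vectors of weight [lam], destined to be the summand of
    [X] in the block of [lam]. *)
Definition component : lmodType U := submod component_submod.

Let emb : {linear component -> X} := @submod_val _ _ _ component_submod.

Let emb_inj : injective emb. Proof. exact: val_inj. Qed.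

Lemma component_isotypic : isotypic xi lam component.
Proof.
pose S (x : kvect component) := wt_sing (emb x).
have S_sing x : S x -> msingular x by move=> [+ _]; apply: msingular_inj.
have S_wt x : S x -> is_weight lam (x : component) by move=> [_]; apply: is_weight_inj.
have comp_charged : charged c component.
  by move=> x; apply: emb_inj; rewrite linear_act linear_kscale X_charged.
apply: (mspan_isotypic pchar0 c_neq0 xi_generic xi_lower xi_lam comp_charged S_sing S_wt).
- by rewrite /S linear0; apply: wt_sing0.
- by move=> x y; rewrite /S linearD; apply: wt_singD.
(* The spanning property is known in [X]. It descends because the generating singular vectors lie in
   the component and [emb] is injective and commutes with [q] and [F]. *)
move=> x; have emb_span (y : kvect X) : mspan c wt_sing y ->
    exists2 x' : kvect component, emb x' = y & mspan c S x'.
  elim=> [_ [j [i [z [z_sing ->]]]]||u v _ [u' <- Iu] _ [v' <- Iv]].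
  - have [z' z'E] : exists z' : component, emb z' = z.
      by apply: submod_val_surj; apply: aspan_gen; exists 0%N, 0%N, z.
    exists (iter j (act Bq) (iter i (lowF c (act Bf) (act Bq)) (z' : kvect component))).
      by rewrite linear_low z'E.
    by apply: aspan_gen; exists j, i, z'; split=> //; rewrite /S z'E.
  - by exists 0; [rewrite linear0 | apply: aspan0].
  by exists (u' + v'); [rewrite linearD | apply: aspanD].
by have [x' /emb_inj <-] := emb_span _ (submodP x).
Qed.
End Component.

Let I := {lam | xi lam}.
Let C (i : I) : lmodType U := component (svalP i).
Let emb i : {linear C i -> X} := @submod_val _ _ _ (component_submod (svalP i)).

Let C_iso i : isotypic xi (sval i) (C i) := component_isotypic (svalP i).

(** A nonzero kernel would contain a nonzero singular [y]. Its coordinates are singular, so they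
    have pairwise distinct weights in [X]; as their sum is 0, each of them is 0. *)
Let emb_sum_inj (g : {linear dsum C -> X}) (gE : forall (x : dsum C) (r : seq {classic I}),
    uniq r -> (forall i : I, (i : {classic I}) \notin r -> x i = 0) ->
    g x = \sum_(i <- r) emb (i : I) (x (i : I))) : injective g.
Proof.
apply: raddf_inj => x gx; apply: contrapT => x0.
have D_loc : locally_O xi (dsum C).
  apply: locally_O_aspan; apply: dsum_ind_inj => [|i y z Iz]; first exact: aspan0.
  apply: aspanD => //; apply: aspan_gen.
  by exists (C i), (@dsum_inj _ _ C i), y; split=> //; case: (C_iso i).
have [y [gy y0 y_sing]] := submod_singular xi_charge D_loc (ker_submod g) gx x0.
have y_wt (i : I) : is_weight (sval i) (emb i (y i)).
  apply: is_weight_map; apply: (C_iso i).2.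
  exact: (msingular_map (@dsum_proj _ _ C i) y_sing).
have [r r_uniq rP] := dsum_supp y; apply: y0; apply: dsumP => i.
have [ir|/rP //] := boolP ((i : {classic I}) \in r).
apply: val_inj; rewrite /= -/(emb i _).
apply: (joint_eigen_independent (V := kvect X) (I := {classic I}) (B := bool)
  (T := fun b => if b then act Bh : {linear kvect X -> kvect X} else act Bz)
  (chi := fun (j : {classic I}) b => if b then sval (j : I) (elh K) else sval (j : I) (elz K))
  (w := fun j : {classic I} => emb (j : I) (y (j : I))) _ _ r_uniq _ ir).
- move=> j j' jj'.
  have [hE|] := eqVneq (sval (j : I) (elh K)) (sval (j' : I) (elh K)); last by exists true.
  have [zE|] := eqVneq (sval (j : I) (elz K)) (sval (j' : I) (elz K)); last by exists false.
  by case/eqP: jj'; apply/eq_sig_hprop => [mu|]; [apply: Prop_irrelevance | apply: hdual_eq].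
- by move=> j b; have /is_weightP[hj zj] := y_wt j; case: b.
by rewrite -[RHS]gy (gE y r).
Qed.

Lemma component_sum_bij : exists f : {linear dsum C -> X}, bijective f.
Proof.
have [g gE] := dsum_lift emb; exists g; apply: inj_surj_bij; first exact: emb_sum_inj.
have g_inj i x : g (@dsum_inj _ _ C i x) = emb i x.
  rewrite (gE _ [:: i : {classic I}]) // => [|j]; last first.
    by rewrite inE => /eqP ij; apply: dsum_inj_neq => /esym.
  by rewrite big_seq1 dsum_inj_id.
move=> x; have := locally_O_mspan pchar0 c_neq0 xi_charge xi_generic X_loc x.
elim=> [_ [j [i [z [[z_sing [lam xi_lam z_lam]] ->]]]]||u v _ [u' <-] _ [v' <-]].
- have [y <-] : exists y : C (exist _ lam xi_lam),
      emb _ y = iter j (act Bq) (iter i (lowF c (act Bf) (act Bq)) z).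
    by apply: submod_val_surj; apply: aspan_gen; exists j, i, z.
  by exists (@dsum_inj _ _ C (exist _ lam xi_lam) y).
- by exists 0; rewrite linear0.
by exists (u' + v'); rewrite linearD.
Qed.

Lemma block_decomposition :
  exists (M : dsum_cat (fun lam : {lam | xi lam} => cat_block xi (sval lam)))
    (f : {linear dsum (fun lam => sval (sval M lam)) -> X}), bijective f.
Proof.
have [f [g fg gf]] := component_sum_bij.
pose gl : {linear X -> dsum C} :=
  HB.pack g (GRing.isLinear.Build U X (dsum C) *:%R g (can2_linear fg gf)).
have proj_surj i y : exists x, (@dsum_proj _ _ C i \o gl) x = y.
  by exists (f (@dsum_inj _ _ C i y)); rewrite /= fg /dsum_proj dsum_inj_id.
have X_fg := ((O_P X).1 X_O).1.
have C_fg i : fin_generated (C i) := fin_generated_surj (proj_surj i) X_fg.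
have C_block i : in_block xi (sval i) (C i).
  by apply/(blockP (svalP i)); split=> //; apply/O_P; split=> //; case: (C_iso i).
(* A component is nonzero only if some generator of [X] projects nontrivially to it, and each of the
   finitely many generators has finite support. *)
have C_fin : finite_set [set i |
    ~ is_zero_ob (exist _ (C i) (C_block i) : cat_block xi (sval i))]%classic.
  have [r rP] := (fin_generatedP X).1 X_fg.
  apply: (@sub_finite_set _ _ [set i | exists2 x, x \in r & g x i <> 0]%classic).
    move=> i /= i_nz; apply: contrapT => r0; apply/i_nz/(block_zero (svalP i)) => /= y.
    have [x <-] := proj_surj i y; apply: (rP (fun x => (@dsum_proj _ _ C i \o gl) x = 0)).
      exact: ker_submod (@dsum_proj _ _ C i \o gl).
    by move=> z zr; apply: contrapT => gz; apply: r0; exists z.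
  elim: (r) => [|x r' IH]; first by apply: (sub_finite_set _ (finite_set0 I)) => i [].
  apply: (@sub_finite_set _ _ ([set i | g x i <> 0] `|`
    [set i | exists2 x, x \in r' & g x i <> 0])%classic).
    by move=> i /= [z]; rewrite inE => /predU1P[->|zr'] gz; [left | right; exists z].
  by rewrite finite_setU; split=> //; apply: dsum_fin.
exists (exist _ (fun i => exist _ (C i) (C_block i)) C_fin), f.
by exists g.
Qed.
End Decomposition.

Lemma dsum_functor_equivalence :
  is_equivalence
    (dsum_functor dsum_in_Oxi :
       functor (dsum_cat (fun lam : {lam | xi lam} => cat_block xi (sval lam)))
               (cat_Oxi xi)).
Proof.
apply: ff_ess_surj_equivalence => [M N f g /= fg|M N k|[X X_O]].
- apply: functional_extensionality_dep => i; apply: linear_ext; apply: dsum_map_inj i => y.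
  exact: (congr1 (fun h : {linear dsum (fun i => sval (sval M i)) ->
    dsum (fun i => sval (sval N i))} => h y) fg).
(* Only the diagonal entries of [k] are kept: the entries between blocks of different weights vanish
   by [isotypic_hom0]. *)
- pose f i : {linear sval (sval M i) -> sval (sval N i)} :=
    @dsum_proj _ _ (fun i => sval (sval N i)) i \o (k : {linear _ -> _}) \o
      @dsum_inj _ _ (fun i => sval (sval M i)) i.
  exists f; apply: linear_ext.
  apply: dsum_ind_inj => [|i x y Iy]; first by rewrite !linear0.
  rewrite !linearD Iy; congr (_ + _); apply: dsumP => j.
  have [<-{j}|ij] := pselect (i = j); first by rewrite /= dsum_inj_fun_id.
  rewrite [LHS]/= dsum_inj_fun_neq // !linear0; apply/esym.
  have [_ M_iso] := (blockP (svalP i) _).1 (svalP (sval M i)).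
  have [_ N_iso] := (blockP (svalP j) _).1 (svalP (sval N j)).
  have sij : sval i != sval j.
    by apply/eqP => /eq_sig_hprop ij'; apply: ij; apply: ij' => mu; apply: Prop_irrelevance.
  have kij := isotypic_hom0 (@dsum_proj _ _ (fun i => sval (sval N i)) j \o (k : {linear _ -> _}) \o
      @dsum_inj _ _ (fun i => sval (sval M i)) i) M_iso N_iso sij x.
  exact: kij.
have [M [f f_bij]] := block_decomposition X_O.
exists M, f; have [g [gf fg]] := bij_is_iso f_bij.
by exists g.
Qed.
End Equivalences.

Lemma coset_lower (K : fieldType) (xi : set (hdual K)) : is_coset xi ->
  forall lam n, xi lam -> xi (lam - hvee K *+ n).
Proof.
move=> [mu ->] _ n [_ [m ->] <-] /=.
(* The root at index 0 is [hvee], so lowering by [n] changes only its multiplicity. *)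
pose m' (i : 'I_(size (Defs.roots K))) := m i - (if i == ord0 then n%:Z else 0).
exists (\sum_(i < size (Defs.roots K)) (Defs.roots K)`_i *~ m' i); first by exists m'.
rewrite -addrA; congr (_ + _).
transitivity (\sum_(i < size (Defs.roots K)) ((Defs.roots K)`_i *~ m i
  - (Defs.roots K)`_i *~ (if i == ord0 then n%:Z else 0))).
  by apply: eq_bigr => i _; apply: mulrzBr.
rewrite sumrB; congr (_ - _).
by rewrite (bigD1 ord0) //= big1 ?addr0 // => i /negPf ->; rewrite mulr0z.
Qed.

Theorem proposition3 (R : realType) (xi : set (hdual R[i]))
    (xi_coset : is_coset xi)
    (c : R[i]) (xi_charge : is_central_charge xi c) (c_neq0 : c != 0)
    (xi_half : forall lam, xi lam ->
       ~ exists k : int, lam (elh R[i]) = (k%:~R / 2%:R : R[i])) :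
  [/\ forall lam, xi lam -> simple_module (verma lam),
      exists dsum_in_Oxi :
          forall M : dsum_cat (fun lam : {lam | xi lam} => cat_block xi (sval lam)),
            in_Oxi (dsum (fun lam => sval (sval M lam))) xi,
        is_equivalence
          (dsum_functor dsum_in_Oxi :
             functor (dsum_cat (fun lam : {lam | xi lam} => cat_block xi (sval lam)))
                     (cat_Oxi xi))
    & forall lam, xi lam ->
        exists weight_fin :
            forall N, in_block xi lam N -> fin_generated (weight_space N lam),
          is_equivalence
            (restrict_functor (F := weight_functor lam) weight_fin :
               functor (cat_block xi lam) (cat_fdvect R[i]))].

Proof.
have pchar0 n : n.+1%:R != 0 :> R[i] by rewrite Num.Theory.pnatr_eq0.
have xi_generic lam : xi lam -> generic (lam (elh R[i])).
  (* A vanishing coefficient would mean [lam(h) = i - 1/2 = (2 i - 1)/2], a half-integer. *)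
  move=> /xi_half half i; apply/eqP => lam0; apply: half; exists (2%:Z * i%:Z - 1).
  have -> : lam (elh R[i]) = i%:R - 2%:R^-1 by apply/eqP; rewrite -subr_eq0 opprB addrA lam0.
  by rewrite rmorphB rmorphM /= rmorph1; field.
have xi_lower := coset_lower xi_coset.
split=> [lam xi_lam||lam xi_lam].
- exact: verma_simple pchar0 c_neq0 xi_charge xi_generic xi_lower xi_lam.
- exists (dsum_in_Oxi pchar0 c_neq0 xi_charge xi_generic xi_lower).
  exact: dsum_functor_equivalence.
exists (block_weight_fin pchar0 c_neq0 xi_charge xi_generic xi_lower xi_lam).
exact: (weight_functor_equivalence pchar0 c_neq0 xi_charge xi_generic xi_lower xi_lam).
Qed.
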